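(* Let $\alpha\in(1/3,1/2)$, $T>0$, let $\mathcal M$ be a compact foliated space and let $V_0,\dots,V_d$ be leafwise $C^3$-vector fields on $\mathcal M$. Let $\Phi$ be the Lyons–Itô map of the RDE $dx_t=\sum_{i=1}^dV_i(x_t)\,dw^i_t+V_0(x_t)\,dt$ on $\mathcal M$ and let $\mathbf W=\mathbf W(w)$ be Brownian rough path. Then the map $$\mathcal M\times C_0([0,T],\mathbb R^d)\ni(m,w)\mapsto\Phi(m,\mathbf W)\in C_L([0,T],\mathcal M)$$ is $\mathcal B(\mathcal M)\otimes\overline{\mathcal B(C_0([0,T],\mathbb R^d))}^{\mu}/\mathcal B(C_L([0,T],\mathcal M))$-measurable, where $\overline{\mathcal B(C_0([0,T],\mathbb R^d))}^{\mu}$ is the completion of $\mathcal B(C_0([0,T],\mathbb R^d))$ by the $d$-dimensional Wiener measure $\mu$.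
   Context: **Leafwise regularity.** Let $W_1,W_2$ be topological spaces and $U\subset\mathbb R^p\times W_1$ open, with points $(y,z)$. A function $f:U\to\mathbb R^d$ is of class $C_L^k$ if $f(\cdot,z)$ is $C^k$ for each $z$ and all $\partial_y^\beta f$ with $|\beta|\le k$ are continuous on $U$. A map $f:U\to V$, $V\subset\mathbb R^d\times W_2$ open, is of class $C_L^k$ if it is locally of the form $f(y,z)=(f_1(y,z),f_2(z))$ with $f_1$ of class $C_L^k$ and $f_2$ continuous; leafwise smooth means of class $C_L^k$ for all $k$. **Foliated spaces.** Let $\mathcal M,\mathcal Z$ be locally compact, separable, metrizable spaces. $\mathcal M$ is a $p$-dimensional foliated space (modelled transversely on $\mathcal Z$) if it has an open cover $\{U_\alpha\}$ and homeomorphisms $\varphi_\alpha:U_\alpha\to B_{\alpha,1}\times B_{\alpha,2}$, $B_{\alpha,1}\subset\mathbb R^p$ connected open, $B_{\alpha,2}\subset\mathcal Z$ open, with leafwise smooth transition maps. The $(U_\alpha,\varphi_\alpha)$ are foliated charts; sets $\varphi_\alpha^{-1}(B_{\alpha,1}\times\{z\})$ are plaques. The atlas is assumed regular: locally finite; each $\overline{U_\alpha}$ is a compact subset of a foliated chart $(W_\alpha,\psi_\alpha)$ with $\varphi_\alpha=\psi_\alpha|_{U_\alpha}$; each plaque of $U_\alpha$ meets at most one plaque of $\overline{U_\beta}$. The leaf $\mathcal L_m$ through $m$ is the set of $x$ for which there are plaques $P_1,\dots,P_n$ with $m\in P_1$, $x\in P_n$, $P_i\cap P_{i+1}\ne\emptyset$;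 leaves are smooth $p$-manifolds. A leafwise $C^k$ vector field is a map $V:m\mapsto V(m)\in T_m(\mathcal L_m)$ whose components with respect to $\partial/\partial y^1,\dots,\partial/\partial y^p$ are of class $C_L^k$ in every foliated chart. A leafwise $C^k$-function is a real function on $\mathcal M$ of class $C_L^k$ in every chart. $C_L([0,T],\mathcal M)$ is the set of continuous maps $[0,T]\to\mathcal M$ whose image is contained in a single leaf, with the topology of uniform convergence. $\mathcal B(S)$ is the Borel $\sigma$-field of a topological space $S$. **Rough paths.** $\Omega_\alpha([0,T],\mathbb R^d)$ is the set of continuous maps $\mathbf w=(\mathbf w^1,\mathbf w^2)$ from $\triangle_T=\{0\le s\le t\le T\}$ to $\mathbb R^d\oplus(\mathbb R^d\otimes\mathbb R^d)$ with $\mathbf w^1_{s,t}=\mathbf w^1_{s,u}+\mathbf w^1_{u,t}$, $\mathbf w^2_{s,t}=\mathbf w^2_{s,u}+\mathbf w^2_{u,t}+\mathbf w^1_{s,u}\otimes\mathbf w^1_{u,t}$ for $s\le u\le t$ and $\|\mathbf w^i\|_{i\alpha}=\sup_{s<t}|\mathbf w^i_{s,t}|/(t-s)^{i\alpha}<\infty$, $i=1,2$; metric $\mathrm d_\alpha(\mathbf w,\hat{\mathbf w})=\max_{i=1,2}\|\mathbf w^i-\hat{\mathbf w}^i\|_{i\alpha}$. For a Lipschitz path $w$ with $w_0=0$ the natural lift $\mathbf L(w)$ is $\mathbf w^1_{s,t}=w_t-w_s$, $\mathbf w^2_{s,t}=\int_s^t(w_u-w_s)\otimes dw_u$. $G\Omega_\alpha([0,T],\mathbb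 R^d)$ is the $\mathrm d_\alpha$-closure of the set of such lifts. Components are written $\mathbf w^{1,i}$, $\mathbf w^{2,jk}$. **RDE and Lyons–Itô map.** $x\in C([0,T],\mathcal M)$ solves the RDE with initial condition $m$ if $x_0=m$ and for every leafwise $C^3$-function $f$ there is a constant $C$ (independent of $(s,t)$) such that for all $0\le s\le t\le T$ $$\Big|f(x_t)-f(x_s)-\sum_{i}V_if(x_s)\mathbf w^{1,i}_{s,t}-\sum_{j,k}V_jV_kf(x_s)\mathbf w^{2,jk}_{s,t}-V_0f(x_s)(t-s)\Big|\le C|t-s|^{3\alpha}.$$ For leafwise $C^3$ vector fields on compact $\mathcal M$ a unique solution exists for every $m$ and $\mathbf w$, and it stays in the leaf $\mathcal L_m$; it is denoted $\Phi(m,\mathbf w)$. **Brownian rough path.** $\mu$ is $d$-dimensional Wiener measure on $C_0([0,T],\mathbb R^d)$ (continuous paths starting at $0$). For $w\in C_0([0,T],\mathbb R^d)$ let $w(l)$ be its piecewise linear approximation along $\{jT/2^l\}_{0\le j\le2^l}$. The set $\mathcal N$ of $w$ for which $\{\mathbf L(w(l))\}_{l\ge1}$ is not Cauchy in $G\Omega_\alpha([0,T],\mathbb R^d)$ is $\mu$-null, and $\mathbf W=\lim_{l\to\infty}\mathbf L(w(l))$ for $w\notin\mathcal N$; on the null set $\mathcal N$, $\mathbf W$ is set equal to a fixed element of $G\Omega_\alpha([0,T],\mathbb R^d)$. *)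

(* Defs.v *)
From HB Require Import structures.
From mathcomp Require Import all_boot all_order all_algebra.
From mathcomp Require Import all_classical all_reals all_analysis.

Set Implicit Arguments.
Unset Strict Implicit.
Unset Printing Implicit Defensive.

Import Order.TTheory GRing.Theory Num.Theory.
Import numFieldNormedType.Exports.

Local Open Scope classical_set_scope.
Local Open Scope ring_scope.

(* [measurableType] requires a pointed carrier; a metrizable space on which a
   Borel sigma-algebra is put is therefore given as a pointed metric space. *)
#[short(type="pmetricType")]
HB.structure Definition PMetric (K : numDomainType) :=
  { M of Pointed M & Metric K M }.

Notation borel X := (g_sigma_algebraType (@open X)).

Definition separable (X : topologicalType) :=
  exists2 D : set X, countable D & dense D.

Section leafwise_regularity.
Context {R : realType} {p : nat}.

Definition partial {Z : Type} {W : normedModType R} (i : 'I_p)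
    (f : 'rV[R]_p * Z -> W) (u : 'rV[R]_p * Z) : W :=
  'D_(delta_mx ord0 i) (fun y => f (y, u.2)) u.1.

(* The iterated partial derivative along the list [s] of directions. Ranging
   over lists of length at most k, rather than over multi-indices beta with
   |beta| <= k, gives the same class of functions, since for C^k functions the
   order of differentiation is irrelevant. *)
Definition partials {Z : Type} {W : normedModType R} (s : seq 'I_p)
    (f : 'rV[R]_p * Z -> W) : 'rV[R]_p * Z -> W :=
  foldr partial f s.

(* [U] is meant to be open; the values of [f] outside [U] are irrelevant. *)
Definition CL_fun {Z : topologicalType} {W : normedModType R} (k : nat)
    (U : set ('rV[R]_p * Z)) (f : 'rV[R]_p * Z -> W) : Prop :=
  forall s : seq 'I_p, (size s <= k)%N ->
    (forall u, U u -> {for u, continuous (partials s f)}) /\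
    ((size s < k)%N -> forall (i : 'I_p) u, U u ->
       derivable (fun y => partials s f (y, u.2)) u.1 (delta_mx ord0 i)).

Definition CL_map {q : nat} {Z1 Z2 : topologicalType} (k : nat)
    (U : set ('rV[R]_p * Z1)) (f : 'rV[R]_p * Z1 -> 'rV[R]_q * Z2) : Prop :=
  forall u, U u -> exists U' : set ('rV[R]_p * Z1),
    [/\ open U', U' u, U' `<=` U &
        exists (f1 : 'rV[R]_p * Z1 -> 'rV[R]_q) (f2 : Z1 -> Z2),
        [/\ CL_fun k U' f1,
            forall z, (snd @` U') z -> {for z, continuous f2} &
            forall v, U' v -> f v = (f1 v, f2 v.2)]].

Definition leafwise_smooth {q : nat} {Z1 Z2 : topologicalType}
    (U : set ('rV[R]_p * Z1)) (f : 'rV[R]_p * Z1 -> 'rV[R]_q * Z2) : Prop :=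
  forall k, CL_map k U f.

End leafwise_regularity.

Section foliated_spaces.
Context {R : realType}.

(* A homeomorphism [coord] from the open set [dom] onto [base `*` transv],
   with inverse [param]; values outside these sets are irrelevant. *)
Record chart (p : nat) (M Z : topologicalType) := Chart {
  dom : set M ;
  base : set 'rV[R]_p ;
  transv : set Z ;
  coord : M -> 'rV[R]_p * Z ;
  param : 'rV[R]_p * Z -> M ;
  dom_open : open dom ;
  base_open : open base ;
  base_connected : connected base ;
  transv_open : open transv ;
  coord_fun : forall m, dom m -> (base `*` transv) (coord m) ;
  param_fun : forall u, (base `*` transv) u -> dom (param u) ;
  coordK : forall m, dom m -> param (coord m) = m ;
  paramK : forall u, (base `*` transv) u -> coord (param u) = u ;
  coord_continuous : forall m, dom m -> {for m, continuous coord} ;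
  param_continuous : forall u, (base `*` transv) u -> {for u, continuous param}
}.

Definition box p M Z (c : chart p M Z) : set ('rV[R]_p * Z) :=
  base c `*` transv c.

Definition smooth_transition p M Z (c c' : chart p M Z) : Prop :=
  leafwise_smooth (coord c @` (dom c `&` dom c')) (coord c' \o param c).

Definition plaque p M Z (c : chart p M Z) (z : Z) : set M :=
  param c @` (base c `*` [set z]).

Section atlas.
Context {p : nat} {M Z : topologicalType} {I : Type}.
Variable phi : I -> chart p M Z.

Definition foliated_chart (c : chart p M Z) : Prop :=
  forall a, smooth_transition c (phi a) /\ smooth_transition (phi a) c.

(* The plaque with transverse coordinate [z] of the closure of the domain of
   [c], a compact subset of the domain of the larger chart [c']. *)
Definition closed_plaque (c c' : chart p M Z) (z : Z) : set M :=
  closure (dom c) `&` [set m | (coord c' m).2 = z].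

Definition regular_atlas : Prop :=
  (forall m : M, exists2 N : set M, nbhs m N &
     finite_set [set a | dom (phi a) `&` N !=set0]) /\
  exists psi : I -> chart p M Z,
    (forall a, [/\ foliated_chart (psi a),
       compact (closure (dom (phi a))),
       closure (dom (phi a)) `<=` dom (psi a) &
       forall m, dom (phi a) m -> coord (psi a) m = coord (phi a) m]) /\
    (forall a b z z1 z2, transv (phi a) z ->
       plaque (phi a) z `&` closed_plaque (phi b) (psi b) z1 !=set0 ->
       plaque (phi a) z `&` closed_plaque (phi b) (psi b) z2 !=set0 ->
       z1 = z2).

End atlas.

Record foliation (p : nat) (M Z : metricType R) := Foliation {
  index : Type ;
  atlas : index -> chart p M Z ;
  locally_compact_space : locally_compact [set: M] ;
  separable_space : separable M ;
  locally_compact_model : locally_compact [set: Z] ;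
  separable_model : separable Z ;
  atlas_cover : forall m, exists a, dom (atlas a) m ;
  atlas_smooth : forall a b, smooth_transition (atlas a) (atlas b) ;
  atlas_regular : regular_atlas atlas
}.

Context {p : nat} {M Z : metricType R}.
Implicit Type F : foliation p M Z.

Definition is_plaque F (P : set M) : Prop :=
  exists (a : index F) (z : Z),
    transv (atlas a) z /\ P = plaque (atlas a) z.

Definition leaf F (m : M) : set M := [set x |
  exists (n : nat) (P : nat -> set M),
    [/\ forall i, (i <= n)%N -> is_plaque F (P i),
        P 0%N m, P n x &
        forall i, (i < n)%N -> P i `&` P i.+1 !=set0]].

(* A tangent vector to the leaf at [m] is given by its components in all the
   charts around [m], subject to the usual transformation rule. *)
Record vector_field (k : nat) F := VectorField {
  comp : index F -> M -> 'rV[R]_p ;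
  comp_change : forall a b m, dom (atlas a) m -> dom (atlas b) m ->
    comp b m = \sum_(i < p) comp a m ord0 i *:
      partial i (fst \o coord (atlas b) \o param (atlas a))
                (coord (atlas a) m) ;
  comp_CL : forall a, CL_fun k (box (atlas a)) (comp a \o param (atlas a))
}.

Definition leafwise_function F (k : nat) (f : M -> R) : Prop :=
  forall a : index F, CL_fun k (box (atlas a)) (f \o param (atlas a)).

Definition chart_at F (m : M) : index F := projT1 (cid (atlas_cover F m)).

(* The value does not depend on the chart, by [comp_change]. *)
Definition vf_apply F k (V : vector_field k F) (f : M -> R) (m : M) : R :=
  let a := chart_at F m in
  \sum_(i < p) comp V a m ord0 i *
    partial i (f \o param (atlas a)) (coord (atlas a) m).

End foliated_spaces.
Arguments leafwise_function {R p M Z} F k f.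

Section time.
Context {R : realType} (T : {posnum R}).

Definition time_set : set R := `[0, T%:num]%classic.

Definition simplex_set : set (time_set * time_set) :=
  [set st | \val st.1 <= \val st.2].

Lemma to_time_subproof (r : R) : Num.max 0 (Num.min r T%:num) \in time_set.
Proof.
by rewrite inE /time_set /= in_itv/= le_max lexx/= ge_max ge_min lexx orbT/= andbT.
Qed.

(* The nearest point of [0, T]. *)
Definition to_time (r : R) : time_set := SigSub (to_time_subproof r).

End time.

Arguments simplex_set {R} T.

Notation time T := (set_type (time_set T)).
Notation simplex T := (set_type (simplex_set T)).

Section simplex.
Context {R : realType} {T : {posnum R}}.
Definition src (c : simplex T) : time T := (\val c).1.
Definition tgt (c : simplex T) : time T := (\val c).2.
Definition len (c : simplex T) : R := \val (tgt c) - \val (src c).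
End simplex.


Section continuous_paths.
Context {R : realType} (T : {posnum R}) (d : nat).

Definition C0_set : set {uniform time T -> 'rV[R]_d} :=
  [set w | continuous (w : time T -> 'rV[R]_d) /\ w (to_time T 0) = 0].

(* With the topology of uniform convergence. *)
Definition C0 : Type := set_type C0_set.

HB.instance Definition _ := Uniform.copy C0 (set_type C0_set).

Let C0_point : (fun=> 0) \in C0_set.
Proof. by apply/mem_set; split; [exact: cst_continuous|]. Qed.

HB.instance Definition _ := isPointed.Build C0 (SigSub C0_point).

Definition C0_path (w : C0) : time T -> 'rV[R]_d := \val w.

End continuous_paths.

Coercion C0_path : C0 >-> Funclass.

Section leafwise_paths.
Context {R : realType} {p : nat} {M : pmetricType R} {Z : metricType R}.
Variables (T : {posnum R}) (F : foliation p M Z).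

Definition CL_path_set : set {uniform time T -> M} :=
  [set x | continuous (x : time T -> M) /\ exists m, forall t, leaf F m (x t)].

(* With the topology of uniform convergence; for compact [M] this topology does
   not depend on the metric of [M]. *)
Definition CL_paths : Type := set_type CL_path_set.

HB.instance Definition _ := Uniform.copy CL_paths (set_type CL_path_set).

Let CL_paths_point : (fun=> point) \in CL_path_set.
Proof.
apply/mem_set; split; first exact: cst_continuous.
have [a am] := atlas_cover F point.
exists point => t; exists 0%N.
exists (fun=> plaque (atlas a) (coord (atlas a) point).2).
have [b1 b2] := coord_fun am.
have P0 : plaque (atlas a) (coord (atlas a) point).2 point.
  by exists (coord (atlas a) point); [split|exact: coordK].
by split=> // i _; exists a, (coord (atlas a) point).2.
Qed.

HB.instance Definition _ := isPointed.Build CL_paths (SigSub CL_paths_point).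

Definition CL_path (x : CL_paths) : time T -> M := \val x.

End leafwise_paths.

Coercion CL_path : CL_paths >-> Funclass.

Section rough_paths.
Context {R : realType} (alpha : R) (T : {posnum R}) (d : nat).

(* Pairs of maps from the simplex to the two levels R^d and R^d (x) R^d; the
   tensor a (x) b is the matrix with entries a_j b_k. *)
Definition two_level : Type :=
  ((simplex T -> 'rV[R]_d) * (simplex T -> 'M[R]_d))%type.

(* The norm is the maximum of the absolute values of the entries. *)
Definition holder_norm (V : normedModType R) (beta : R) (f : simplex T -> V) :
    \bar R :=
  ereal_sup [set (`|f c| / len c `^ beta)%:E | c in [set c | 0 < len c]].

Definition holder_dist (w v : two_level) : \bar R :=
  Order.max (holder_norm alpha (w.1 \- v.1))
            (holder_norm (2 * alpha) (w.2 \- v.2)).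

(* [a], [b] and [c] stand for (s, u), (u, t) and (s, t). *)
Definition chen (w : two_level) : Prop :=
  forall a b c : simplex T, src a = src c -> tgt a = src b -> tgt b = tgt c ->
    w.1 c = w.1 a + w.1 b /\
    w.2 c = w.2 a + w.2 b + (w.1 a)^T *m w.1 b.

Definition rough_path : set two_level := [set w |
  [/\ continuous w.1, continuous w.2, chen w,
      (holder_norm alpha w.1 < +oo)%E &
      (holder_norm (2 * alpha) w.2 < +oo)%E]].

(* [v] is the Riemann-Stieltjes integral of [f] against [g] on [a, b]: the limit
   of tagged Riemann sums as the mesh of the partition tends to 0. *)
Definition is_RS_integral (f g : R -> R) (a b v : R) : Prop :=
  forall eps : R, 0 < eps -> exists2 delta : R, 0 < delta &
    forall (s : seq R) (xi : nat -> R), itv_partition a b s ->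
      (forall i, (i < size s)%N ->
         nth b s i - nth b (a :: s) i < delta /\
         nth b (a :: s) i <= xi i <= nth b s i) ->
      `|\sum_(i < size s) f (xi i) * (g (nth b s i) - g (nth b (a :: s) i)) - v|
        < eps.

Definition RS_integral (f g : R -> R) (a b : R) : R :=
  xget 0 [set v | is_RS_integral f g a b v].

Definition natural_lift (w : time T -> 'rV[R]_d) : two_level :=
  (fun c => w (tgt c) - w (src c),
   fun c => \matrix_(j, k)
     RS_integral (fun u => (w (to_time T u) - w (src c)) ord0 j)
                 (fun u => w (to_time T u) ord0 k)
                 (\val (src c)) (\val (tgt c))).

Definition lipschitz_path (w : time T -> 'rV[R]_d) : Prop :=
  exists K : R, forall s t, `|w t - w s| <= K * `|\val t - \val s|.

Definition geometric_rough_path : set two_level := [set w |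
  rough_path w /\
  forall eps : R, 0 < eps -> exists v : time T -> 'rV[R]_d,
    [/\ lipschitz_path v, v (to_time T 0) = 0 &
        (holder_dist w (natural_lift v) < eps%:E)%E]].

Definition GOmega : Type := set_type geometric_rough_path.

(* The piecewise linear approximation of [w] along {j T / 2^l}. *)
Definition dyadic_approx (w : time T -> 'rV[R]_d) (l : nat) :
    time T -> 'rV[R]_d := fun t =>
  let h := T%:num / 2 ^+ l in
  let j := Num.truncn (\val t / h) in
  let w0 := w (to_time T (j%:R * h)) in
  let w1 := w (to_time T (j.+1%:R * h)) in
  w0 + ((\val t - j%:R * h) / h) *: (w1 - w0).

Definition lifts_cauchy (w : time T -> 'rV[R]_d) : Prop :=
  forall eps : R, 0 < eps -> exists N : nat, forall k l,
    (N <= k)%N -> (N <= l)%N ->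
    (holder_dist (natural_lift (dyadic_approx w k))
                 (natural_lift (dyadic_approx w l)) < eps%:E)%E.

(* In the Cauchy case the limit exists and is unique, [GOmega] being complete
   for [holder_dist]; the default value of [xget] is then not used. *)
Definition brownian_rough_path (w0 : GOmega) (w : C0 T d) : GOmega :=
  if `[< lifts_cauchy w >] then
    xget w0 [set W : GOmega |
      (fun l => holder_dist (natural_lift (dyadic_approx w l)) (\val W))
        @ \oo --> 0%E]
  else w0.

(* The increments over disjoint intervals are independent, with independent
   centred Gaussian components whose variance is the length of the interval;
   this determines the finite-dimensional distributions. *)
Definition wiener_measure (mu : probability (borel (C0 T d)) R) : Prop :=
  forall (n : nat) (t : nat -> time T) (A : nat -> 'I_d -> set R),
    t 0%N = to_time T 0 ->
    (forall i, (i < n)%N -> \val (t i) < \val (t i.+1)) ->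
    (forall i k, measurable (A i k)) ->
    mu [set w : C0 T d | forall i, (i < n)%N ->
          forall k, A i k ((w (t i.+1) - w (t i)) ord0 k)] =
    (\prod_(i < n) \prod_(k < d)
       normal_prob 0 (Num.sqrt (\val (t i.+1) - \val (t i))) (A i k))%E.

End rough_paths.

Section lyons_ito.
Context {R : realType} {p : nat} {M : pmetricType R} {Z : metricType R}.
Context {F : foliation p M Z} {d : nat} (alpha : R) (T : {posnum R}).

(* [V ord0] is the drift V_0, and [V (lift ord0 i)] is the vector field driven
   by the [i]-th component. *)
Definition rde_solution (V : 'I_d.+1 -> vector_field 3 F) (m : M)
    (w : two_level T d) (x : time T -> M) : Prop :=
  [/\ continuous x, x (to_time T 0) = m &
    forall f : M -> R, leafwise_function F 3 f ->
      exists C : R, forall c : simplex T,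
      let s := src c in let t := tgt c in
      `|f (x t) - f (x s)
        - \sum_(i < d) vf_apply (V (lift ord0 i)) f (x s) * w.1 c ord0 i
        - \sum_(j < d) \sum_(k < d)
            vf_apply (V (lift ord0 j)) (vf_apply (V (lift ord0 k)) f) (x s)
            * w.2 c j k
        - vf_apply (V ord0) f (x s) * len c|
      <= C * len c `^ (3 * alpha)].

Definition lyons_ito_map (V : 'I_d.+1 -> vector_field 3 F)
    (Phi : M -> GOmega alpha T d -> CL_paths T F) : Prop :=
  forall m w,
    rde_solution V m (\val w) (Phi m w) /\
    forall x, rde_solution V m (\val w) x -> x = Phi m w.

End lyons_ito.

(* Main.v *)
Require Import Defs.
From HB Require Import structures.
From mathcomp Require Import all_boot all_order all_algebra.
From mathcomp Require Import all_classical all_reals all_analysis.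
From mathcomp Require Import measurable_realfun.
From mathcomp Require Import ring lra zify.

Set Implicit Arguments.
Unset Strict Implicit.
Unset Printing Implicit Defensive.

Import Order.TTheory GRing.Theory Num.Theory.
Import numFieldNormedType.Exports.

Local Open Scope classical_set_scope.
Local Open Scope ring_scope.


(* Fix finitely many compact pieces of charts whose cores cover M, and a countable dense grid
   of the simplex. Call a path N-controlled by a rough path w if over every interval of length
   at most 1/(N+1) it stays in a plaque of one of the cores, is alpha-Hoelder there with
   constant N+1, and satisfies Davie's second-order expansion with constant N+1 over the
   intervals of the grid. Testing the RDE against cut-off coordinates shows that every solution
   is N-controlled for some N; conversely Taylor's formula and w^{2,jk} + w^{2,kj} =
   w^{1,j} w^{1,k} show that an N-controlled path is a solution, so that no a priori estimate
   is needed. For fixed N the property passes to limits along ultrafilters, which exist by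
   compactness and are uniform by equicontinuity. By uniqueness of solutions, for C closed the
   set of (m, w) such that Phi(m, W) is N-controlled and lies in C is therefore sequentially
   closed for the topology induced by countably many measurable functions: the distances of m
   to a dense sequence and the values of W on the grid. Such a set is measurable, and the
   preimage of C is the union of these sets over N. *)

(** * Taylor expansions *)

(** Continuity of the Lyons-Itô map in the rough path distance would call for stability estimates
    across charts. Measurability can do with less: on each set where the constants are bounded by
    one N, uniqueness of solutions yields a closed graph. Only Davie's expansion involves the
    driving path, so it alone is restricted to the grid; the plaque and Hölder conditions are kept
    on all short intervals, because the equicontinuity of approximating paths rests on them. The
    expansion returns on all intervals since its defect, for a test function, is continuous in the
    interval. The Hölder norms of the driving paths are not part of the control: the limiting driver
    is itself a given rough path, and its own norms are used. The exponent enters through 3 alpha >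
    1, which forces the transverse coordinate of a solution to be constant while it stays in a core,
    and through 2 alpha < 1, which lets the time drift count among the second-order terms.
    Sequential closedness gives measurability because countably many real functions induce a second
    countable topology. *)

Lemma is_derive_line {R : realType} {V W : normedModType R} (g : V -> W)
    (y v : V) (t : R) : derivable g (y + t *: v) v ->
  is_derive t (1 : R) (fun s : R => g (y + s *: v)) ('D_v g (y + t *: v)).
Proof.
have E : (fun h : R => g (h *: v + (y + t *: v))) =
         (fun h : R => g (y + ((h *: (1 : R) : R) + t) *: v)).
  apply/funext => h; congr g.
  by rewrite (mulr1 h : h *: (1 : R) = h) scalerDl addrCA.
move=> dg; apply: DeriveDef.
  by apply/derivable1P; rewrite -E; move/derivable1P : dg.
rewrite /derive; set F := (X in lim (X @ _)); set G := (X in _ = lim (X @ _)).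
suff -> : F = G by [].
apply/funext => h; rewrite /F /G; congr (_ *: (_ - _)).
by have := congr1 (@^~ h) E; rewrite /= => ->.
Qed.

(** The increment [a] will be a difference of coordinates of either sign, hence the interval between
    [Num.min 0 a] and [Num.max 0 a]. *)
Lemma mvt_line {R : realType} {V : normedModType R} (g : V -> R) (y v : V)
    (a : R) :
  (forall t, Num.min 0 a <= t <= Num.max 0 a -> derivable g (y + t *: v) v) ->
  exists2 t, Num.min 0 a <= t <= Num.max 0 a &
    g (y + a *: v) - g y = a * 'D_v g (y + t *: v).
Proof.
move=> dg; pose phi (s : R) := g (y + s *: v).
have dphi t : Num.min 0 a <= t <= Num.max 0 a ->
    is_derive t 1 phi ('D_v g (y + t *: v)).
  by move=> /dg; exact: is_derive_line.
have cphi : {within `[Num.min 0 a, Num.max 0 a], continuous phi}.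
  apply: derivable_within_continuous => t; rewrite in_itv/= => /dphi[].
  by [].
have [||//|t] := @MVT_segment _ phi (fun t => 'D_v g (y + t *: v)) (Num.min 0 a) (Num.max 0 a).
- by rewrite ge_min le_max lexx.
- move=> t /[!in_itv]/= /andP[t1 t2]; apply: dphi; rewrite !ltW//.
rewrite in_itv/= => ta; have g0 : g y = phi 0 by rewrite /phi scale0r addr0.
case: (leP 0 a) ta => a0 ta.
  by rewrite subr0 => E; exists t; rewrite // g0 E mulrC.
move=> E; exists t; rewrite // g0.
by rewrite -[LHS]opprB -/(phi a) E; rewrite sub0r mulrN opprK mulrC.
Qed.

Section box_calculus.
Context {R : realType} {p : nat}.
Implicit Types (g : 'rV[R]_p -> R) (y z : 'rV[R]_p).
Local Notation e i := (delta_mx ord0 i : 'rV[R]_p).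

(** The coordinate box with opposite corners [y] and [z]. Class C_L^k provides derivatives along the
    axes only, and a path from [y] to [z] parallel to the axes stays in this box. *)
Definition in_box y z (x : 'rV[R]_p) := forall k : 'I_p,
  Num.min (y ord0 k) (z ord0 k) <= x ord0 k <= Num.max (y ord0 k) (z ord0 k).

Lemma in_box_dist y z x : in_box y z x -> `|x - y| <= `|z - y|.
Proof.
move=> xb; rewrite [leLHS]/Num.norm/= mx_normrE.
apply: bigmax_le => [|[i k] _ /=]; first exact: normr_ge0.
rewrite ord1 !mxE; have := xb k.
have : `|(z - y) ord0 k| <= `|z - y|.
  rewrite [leRHS]/Num.norm/= mx_normrE.
  exact: (le_bigmax _ (fun ij : 'I_1 * 'I_p => `|(z - y) ij.1 ij.2|) (ord0, k)).
rewrite !mxE => h1 h2; apply: le_trans h1; move: h2.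
case: (leP (y ord0 k)) => yz /andP[h1 h2].
  by rewrite !ger0_norm ?subr_ge0// lerB.
by rewrite !ler0_norm ?subr_le0// ?lerN2 ?lerB// ltW.
Qed.

(** The coordinates are changed one at a time, and the one-variable mean value theorem is applied on
    each edge. No total derivative is involved, at the price of a different intermediate point for
    each direction. *)
Lemma mvt_box g y z :
  (forall x, in_box y z x -> forall k, derivable g x (e k)) ->
  exists2 xi : 'I_p -> 'rV[R]_p, (forall k, in_box y z (xi k)) &
    g z - g y = \sum_(k < p) (z ord0 k - y ord0 k) * 'D_(e k) g (xi k).
Proof.
(* [x_ n] carries the first n coordinates of [z] and the remaining ones of [y], so the increments of
   [g] telescope from [x_ 0] to [x_ p]. *)
move=> dg; pose x_ n : 'rV[R]_p := \row_k (if (k < n)%N then z ord0 k else y ord0 k).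
have xS (k : 'I_p) : x_ k.+1 = x_ k + (z ord0 k - y ord0 k) *: e k.
  apply/rowP => l; rewrite !mxE eqxx/=.
  have [->|lk] := eqVneq l k; first by rewrite ltnn leqnn mulr1 addrC subrK.
  by rewrite mulr0 addr0 ltnS leq_eqVlt (negbTE lk : (nat_of_ord l == k) = false).
have xi (k : 'I_p) : exists2 x, in_box y z x &
    g (x_ k.+1) - g (x_ k) = (z ord0 k - y ord0 k) * 'D_(e k) g x.
  have bx t : Num.min 0 (z ord0 k - y ord0 k) <= t <= Num.max 0 (z ord0 k - y ord0 k) ->
      in_box y z (x_ k + t *: e k).
    move=> ht l; rewrite !mxE eqxx/=; have [->|lk] := eqVneq l k.
      rewrite ltnn mulr1; move: ht; case: (leP 0) => h1; case: (leP (y _ _)); lra.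
    rewrite mulr0 addr0; case: ifP => _; rewrite ge_min le_max lexx ?orbT//.
  have [t ht E] := @mvt_line _ _ g (x_ k) (e k) (z ord0 k - y ord0 k)
    (fun t ht => dg _ (bx t ht) k).
  by exists (x_ k + t *: e k); [exact: bx|rewrite xS].
have [f fP] := choice (fun k => let: ex_intro2 x h1 h2 := xi k in
  ex_intro (fun x => in_box y z x /\ _ ) x (conj h1 h2)).
exists f => [k|]; first by have [] := fP k.
transitivity (g (x_ p) - g (x_ 0%N)).
  by congr (g _ - g _); apply/rowP => l; rewrite !mxE ?ltn_ord.
rewrite -(telescope_sumr (fun n => g (x_ n)) (leq0n p)) big_mkord.
by apply: eq_bigr => k _; have [] := fP k.
Qed.

End box_calculus.

Section box_calculus2.
Context {R : realType} {p : nat}.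
Implicit Types (g : 'rV[R]_p -> R) (y z : 'rV[R]_p).
Local Notation e i := (delta_mx ord0 i : 'rV[R]_p).

Lemma in_boxl y z : in_box y z y.
Proof. by move=> k; rewrite ge_min le_max lexx. Qed.

(** The increment of [g] is expanded by [mvt_box]. The intermediate points are at most as far from
    [f x] as [f (h *: u + x)] is, so they tend to [f x], and continuity of the partial derivatives
    there gives the limit of the quotient. *)
Lemma is_derive_comp_rV {V : normedModType R} g (f : V -> 'rV[R]_p) x u
    (df : 'rV[R]_p) :
  (\forall y \near f x, forall k, derivable g y (e k)) ->
  (forall k, {for f x, continuous ('D_(e k) g)}) ->
  is_derive x u f df ->
  is_derive x u (g \o f) (\sum_(k < p) df ord0 k * 'D_(e k) g (f x)).
Proof.
move=> /nbhs_normP[/= r r0 dg] cg [fx fdf].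
pose F (h : R) := h^-1 *: (f (h *: u + x) - f x).
have Fdf : F h @[h --> 0^'] --> df.
  by rewrite -fdf; exact: fx.
have fc : f (h *: u + x) @[h --> 0^'] --> f x.
  have : h *: F h + f x @[h --> 0^'] --> 0 *: df + f x.
    by apply: cvgD; [apply: cvgZ => //; exact: nbhs_dnbhs|exact: cvg_cst].
  rewrite scale0r add0r; apply: cvg_trans; apply: near_eq_cvg.
  near=> h; rewrite /F scalerA divff ?scale1r ?subrK//.
  near: h; exact: nbhs_dnbhs_neq.
have /choice[xi xiP] (h : R) : exists xi : 'I_p -> 'rV[R]_p,
    (forall k, in_box (f x) (f (h *: u + x)) (xi k)) /\
    (`|f (h *: u + x) - f x| < r -> g (f (h *: u + x)) - g (f x) =
      \sum_(k < p) (f (h *: u + x) ord0 k - f x ord0 k) * 'D_(e k) g (xi k)).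
  have [hr|hr] := ltP (`|f (h *: u + x) - f x|) r; last first.
    by exists (fun=> f x); split => // k; exact: in_boxl.
  have [y /in_box_dist/le_lt_trans /(_ hr) yr k|xi xi1 xi2] := @mvt_box _ _ g (f x) (f (h *: u + x)).
    by apply: dg => /=; rewrite -normrN opprB.
  by exists xi.
have xic k : xi h k @[h --> 0^'] --> f x.
  apply/cvgrPdist_lt => eps e0.
  have /cvgrPdist_lt/(_ _ e0) := fc; apply: filterS => h.
  rewrite !(distrC (f x)); apply: le_lt_trans.
  by apply: in_box_dist; have [] := xiP h.
have G : h^-1 *: ((g \o f) (h *: u + x) - (g \o f) x) @[h --> 0^'] -->
    \sum_(k < p) df ord0 k * 'D_(e k) g (f x).
  have : \sum_(k < p) (F h ord0 k * 'D_(e k) g (xi h k)) @[h --> 0^'] -->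
    \sum_(k < p) df ord0 k * 'D_(e k) g (f x).
    apply: cvg_big => [|k _]; [exact: add_continuous|]; apply: cvgM.
      exact: (cvg_comp _ _ Fdf (@coord_continuous R 1 p ord0 k df)).
    exact: (cvg_comp _ _ (xic k) (cg k)).
  apply: cvg_trans; apply: near_eq_cvg; near=> h => /=.
  have [_ ->] := xiP h; last first.
    near: h; have /cvgrPdist_lt/(_ _ r0) := fc.
    by apply: filterS => h; rewrite distrC.
  rewrite scaler_sumr; apply: eq_bigr => k _.
  by rewrite /F !mxE scalerAl.
apply: DeriveDef; first exact: (cvgP _ G).
exact: (cvg_lim _ G).
Unshelve. all: end_near. Qed.

End box_calculus2.

Section matrix_norm.
Context {R : realType} {m n : nat}.
Implicit Type A : 'M[R]_(m, n).

Lemma le_entry_norm A i j : `|A i j| <= `|A|.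
Proof.
rewrite [leRHS]/Num.norm/= mx_normrE.
exact: (le_bigmax _ (fun ij : 'I_m * 'I_n => `|A ij.1 ij.2|) (i, j)).
Qed.

Lemma le_norm_entry A (B : R) : 0 <= B -> (forall i j, `|A i j| <= B) -> `|A| <= B.
Proof.
move=> B0 AB; rewrite [leLHS]/Num.norm/= mx_normrE.
by apply: bigmax_le => // -[i j] _ /=.
Qed.

Lemma cvg_entries {J : Type} (G : set_system J) {FG : Filter G} (f : J -> 'M[R]_(m, n)) A :
  (forall i j, f x i j @[x --> G] --> A i j) -> f @ G --> A.
Proof.
move=> H; apply/cvgrPdist_le => e e0.
have : \forall x \near G, forall ij : 'I_m * 'I_n, `|A ij.1 ij.2 - f x ij.1 ij.2| <= e.
  by apply: filter_forall => -[i j]; move/cvgrPdist_le : (H i j); exact.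
apply: filterS => x xP; apply: le_norm_entry; first exact: ltW.
by move=> i j; rewrite !mxE; exact: (xP (i, j)).
Qed.

Lemma cvg_entry {J : Type} (G : set_system J) {FG : Filter G} (f : J -> 'M[R]_(m, n)) A i j :
  f @ G --> A -> f x i j @[x --> G] --> A i j.
Proof.
move=> /cvgrPdist_le H; apply/cvgrPdist_le => e /H; apply: filterS => x; apply: le_trans.
by have := le_entry_norm (A - f x) i j; rewrite !mxE.
Qed.

End matrix_norm.

Section taylor.
Context {R : realType} {p : nat}.
Implicit Types (g : 'rV[R]_p -> R) (x y z : 'rV[R]_p).
Local Notation e i := (delta_mx ord0 i : 'rV[R]_p).

Lemma le_coord_norm x k : `|x ord0 k| <= `|x|.
Proof. exact: le_entry_norm. Qed.

Lemma le_norm_coord x (B : R) : 0 <= B -> (forall k, `|x ord0 k| <= B) -> `|x| <= B.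
Proof. by move=> B0 xB; apply: le_norm_entry => // i k; rewrite ord1. Qed.

Lemma in_box_trans y z x w : in_box y z x -> in_box y x w -> in_box y z w.
Proof.
move=> h1 h2 k; have := h1 k; have := h2 k.
case: (leP (y ord0 k) (z ord0 k)); case: (leP (y ord0 k) (x ord0 k)); lra.
Qed.

Lemma in_box_seg y z (t : R) : 0 <= t <= 1 -> in_box y z (y + t *: (z - y)).
Proof.
move=> t01 k; rewrite !mxE; case: (leP (y ord0 k) (z ord0 k)); nra.
Qed.

Lemma taylor1 g y z (B : R) :
  (forall x, in_box y z x -> forall k, derivable g x (e k)) ->
  (forall x, in_box y z x -> forall k, `|'D_(e k) g x| <= B) ->
  `|g z - g y| <= p%:R * B * `|z - y|.
Proof.
move=> dg Bg; have [xi xiP ->] := mvt_box dg.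
apply: (le_trans (ler_norm_sum _ _ _)).
have -> : p%:R * B * `|z - y| = \sum_(k < p) B * `|z - y|.
  by rewrite sumr_const card_ord -[RHS]mulr_natl mulrA.
apply: ler_sum => k _; rewrite normrM mulrC ler_pM//; first exact: Bg.
by have := le_coord_norm (z - y) k; rewrite !mxE.
Qed.

(** After [mvt_box], each partial derivative is compared with its value at [y] by [taylor1]. The
    constant is crude (no factor 1/2), which is harmless for a remainder. *)
Lemma taylor2 g y z (B : R) :
  (forall x, in_box y z x -> forall k, derivable g x (e k)) ->
  (forall x, in_box y z x -> forall k l, derivable ('D_(e k) g) x (e l)) ->
  (forall x, in_box y z x -> forall k l, `|'D_(e l) ('D_(e k) g) x| <= B) ->
  `|g z - g y - \sum_(k < p) (z ord0 k - y ord0 k) * 'D_(e k) g y| <=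
    p%:R ^+ 2 * B * `|z - y| ^+ 2.
Proof.
move=> dg ddg Bg; have [xi xiP ->] := mvt_box dg; rewrite -sumrB.
apply: (le_trans (ler_norm_sum _ _ _)).
have -> : p%:R ^+ 2 * B * `|z - y| ^+ 2 = \sum_(k < p) `|z - y| * (p%:R * B * `|z - y|).
  by rewrite sumr_const card_ord -[RHS]mulr_natl; ring.
apply: ler_sum => k _; rewrite -mulrBr normrM ler_pM//.
  by have := le_coord_norm (z - y) k; rewrite !mxE.
have sub x : in_box y (xi k) x -> in_box y z x by apply: in_box_trans.
have T : `|'D_(e k) g (xi k) - 'D_(e k) g y| <= p%:R * B * `|xi k - y|.
  by apply: (@taylor1 ('D_(e k) g) y (xi k) B) => x xb l;
    [exact: (ddg x (sub x xb) k l)|exact: (Bg x (sub x xb) k l)].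
apply: (le_trans T).
have B0 : 0 <= B := le_trans (normr_ge0 _) (Bg y (in_boxl y z) k k).
by rewrite ler_wpM2l ?mulr_ge0//; exact: in_box_dist.
Qed.

(** Here the factor 1/2 of the Hessian term must be exact, since that term is later matched with the
    symmetric part of the second level. So the polynomial is subtracted along the segment from [y]
    to [z]: the derivative of the difference [phi] is a combination of first-order remainders of the
    partial derivatives, bounded by [taylor2], and the mean value theorem on [0, 1] concludes. *)
Lemma taylor3 g y z (B : R) :
  (forall x, in_box y z x -> \forall x' \near x, forall k, derivable g x' (e k)) ->
  (forall x, in_box y z x -> forall k, {for x, continuous ('D_(e k) g)}) ->
  (forall x, in_box y z x -> forall k l, derivable ('D_(e k) g) x (e l)) ->
  (forall x, in_box y z x -> forall k l m,
     derivable ('D_(e l) ('D_(e k) g)) x (e m)) ->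
  (forall x, in_box y z x -> forall k l m,
     `|'D_(e m) ('D_(e l) ('D_(e k) g)) x| <= B) ->
  `|g z - g y - \sum_(k < p) (z ord0 k - y ord0 k) * 'D_(e k) g y
     - 2^-1 * \sum_(k < p) \sum_(l < p)
         (z ord0 k - y ord0 k) * (z ord0 l - y ord0 l) * 'D_(e l) ('D_(e k) g) y|
  <= p%:R ^+ 3 * B * `|z - y| ^+ 3.
Proof.
move=> dg cg ddg dddg Bg.
pose v : 'rV[R]_p := z - y.
have vE k : z ord0 k - y ord0 k = v ord0 k by rewrite !mxE.
under eq_bigr do rewrite vE.
under [X in _ - _ * X]eq_bigr do under eq_bigr do rewrite !vE.
set S1 := \sum_(k < p) _; set S2 := (X in 2^-1 * X).
pose phi (t : R) := g (y + t *: v) - t * S1 - 2^-1 * t ^+ 2 * S2.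
pose dphi (t : R) := \sum_(k < p) v ord0 k * 'D_(e k) g (y + t *: v) - S1 - t * S2.
have dph (t : R) : 0 <= t <= 1 -> is_derive t (1 : R) phi (dphi t).
  move=> t01; have tb := in_box_seg y z t01.
  have dl : is_derive t (1 : R) (fun s : R => y + s *: v) v.
    have : derivable (id : 'rV[R]_p -> 'rV[R]_p) (y + t *: v) v by exact: derivable_id.
    by move/is_derive_line; rewrite derive_id.
  have := @is_derive_comp_rV _ _ _ g (fun s : R => y + s *: v) t 1 v (dg _ tb) (cg _ tb) dl.
  move=> d1.
  have d2 : is_derive t (1 : R) (fun t : R => t * S1 + 2^-1 * t ^+ 2 * S2) (S1 + t * S2).
    by apply: is_derive_eq; rewrite /GRing.scale/= !(mulr0, mulr1, addr0, add0r, mulr1n); field.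
  rewrite /phi /dphi.
  have -> : (fun t0 : R => g (y + t0 *: v) - t0 * S1 - 2^-1 * t0 ^+ 2 * S2) =
     (g \o (fun s => y + s *: v)) \- (fun t : R => t * S1 + 2^-1 * t ^+ 2 * S2).
    by apply/funext => s /=; rewrite opprD addrA.
  by rewrite -addrA -opprD; exact: is_deriveB.
have bnd (t : R) : 0 <= t <= 1 -> `|dphi t| <= p%:R ^+ 3 * B * `|v| ^+ 3.
  move=> t01; have tb := in_box_seg y z t01.
  have -> : dphi t = \sum_(k < p) v ord0 k * ('D_(e k) g (y + t *: v) - 'D_(e k) g y
      - \sum_(l < p) ((y + t *: v) ord0 l - y ord0 l) * 'D_(e l) ('D_(e k) g) y).
    rewrite /dphi /S1 /S2 mulr_sumr -!sumrB; apply: eq_bigr => k _.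
    rewrite !mulrBr; congr (_ - _); rewrite !mulr_sumr; apply: eq_bigr => l _.
    by rewrite !mxE; ring.
  apply: (le_trans (ler_norm_sum _ _ _)).
  have -> : p%:R ^+ 3 * B * `|v| ^+ 3 = \sum_(k < p) `|v| * (p%:R ^+ 2 * B * `|v| ^+ 2).
    by rewrite sumr_const card_ord -[RHS]mulr_natl; ring.
  apply: ler_sum => k _; rewrite normrM ler_pM//; first exact: le_coord_norm.
  have sub x : in_box y (y + t *: v) x -> in_box y z x by apply: in_box_trans.
  have B0 : 0 <= B := le_trans (normr_ge0 _) (Bg y (in_boxl y z) k k k).
  apply: (@le_trans _ _ (p%:R ^+ 2 * B * `|y + t *: v - y| ^+ 2)).
    apply: (@taylor2 ('D_(e k) g) y (y + t *: v) B) => x xb l; first exact: (ddg x (sub x xb) k l).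
      by move=> m; exact: (dddg x (sub x xb) k l m).
    by move=> m; exact: (Bg x (sub x xb) k l m).
  rewrite ler_wpM2l ?mulr_ge0 ?exprn_ge0// lerXn2r ?nnegrE//.
  exact: in_box_dist.
have [|||t] := @MVT_segment _ phi dphi 0 1.
- by [].
- by move=> t /[!in_itv]/= /andP[t0 t1]; apply: dph; rewrite !ltW.
- apply: derivable_within_continuous => t; rewrite in_itv/= => /dph[].
  by [].
rewrite in_itv/= => /bnd + E; rewrite subr0 mulr1 in E; rewrite -E.
rewrite /phi scale1r scale0r addr0 /v (addrC y) subrK.
by apply: le_trans; rewrite le_eqVlt; apply/orP; left; apply/eqP; congr (`| _ |); ring.
Qed.

End taylor.

Lemma dist_le_half {R : realFieldType} (A B C eps : R) :
  `|A - C| < eps / 2 -> `|B - C| < eps / 2 -> `|A - B| <= eps.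
Proof.
by move=> h1 h2; have := ler_distD C A B; rewrite (distrC C) => h3; lra.
Qed.

Lemma is_derive_shiftl {R : realType} {V W : normedModType R} (g : V -> W)
    (c x v : V) : derivable g (x + c) v ->
  is_derive x v (fun x => g (x + c)) ('D_v g (x + c)).
Proof.
have E : (fun h : R => h^-1 *: (g (h *: v + x + c) - g (x + c))) =
         (fun h : R => h^-1 *: (g (h *: v + (x + c)) - g (x + c))).
  by apply/funext => h; rewrite addrA.
move=> dg; apply: DeriveDef.
  by rewrite /derivable/=; have := dg; rewrite /derivable/= -E.
by rewrite /derive/= -E.
Qed.

(** * Symmetry of second derivatives *)

Section schwarz.
Context {R : realType} {p : nat}.
Variables (g : 'rV[R]_p -> R) (y : 'rV[R]_p).
Local Notation e i := (delta_mx ord0 i : 'rV[R]_p).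

Let norm_delta (k : 'I_p) : `|e k| <= 1.
Proof.
apply: le_norm_coord => // l; rewrite !mxE.
by case: (_ && _); rewrite ?normr1 ?normr0.
Qed.

(** The mean value theorem is applied in direction k to the increment [phi] in direction l, then in
    direction l to the k-th partial derivative. The left side is symmetric in k and l and the right
    side is not; [schwarz] exploits this by letting [a] be small. *)
Lemma second_difference (r a : R) (k l : 'I_p) : 0 < a -> 2 * a < r ->
  (forall x, `|x - y| < r -> forall k, derivable g x (e k)) ->
  (forall x, `|x - y| < r -> forall k l, derivable ('D_(e k) g) x (e l)) ->
  exists2 x, `|x - y| <= 2 * a &
    g (y + a *: e k + a *: e l) - g (y + a *: e k) - g (y + a *: e l) + g y
      = a ^+ 2 * 'D_(e l) ('D_(e k) g) x.
Proof.
move=> a0 ar dg ddg.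
have near_y s t : 0 <= s <= a -> 0 <= t <= a -> `|(y + s *: e k + t *: e l) - y| <= 2 * a.
  move=> /andP[s0 sa] /andP[t0 ta].
  rewrite (_ : _ - y = s *: e k + t *: e l); last by rewrite addrC -addrA addKr.
  apply: (le_trans (ler_normD _ _)); rewrite !normrZ !ger0_norm//.
  rewrite mulr_natl mulr2n lerD// -[a]mulr1 ler_pM//; exact: norm_delta.
have lt_r s t : 0 <= s <= a -> 0 <= t <= a -> `|(y + s *: e k + t *: e l) - y| < r.
  by move=> hs ht; apply: le_lt_trans ar; exact: near_y.
have aa : 0 <= a <= a by rewrite lexx ltW.
have oa : 0 <= (0 : R) <= a by rewrite lexx ltW.
pose phi x := g (x + a *: e l) - g x.
have dphi t : 0 <= t <= a -> is_derive (y + t *: e k) (e k) phi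
    ('D_(e k) g (y + t *: e k + a *: e l) - 'D_(e k) g (y + t *: e k)).
  move=> ta; apply: is_deriveB.
    by apply: is_derive_shiftl; apply: dg; exact: lt_r.
  apply/derivableP/dg; have := lt_r t 0 ta oa.
  by rewrite scale0r addr0.
have [t|t] := @mvt_line _ _ phi y (e k) a.
  by rewrite (min_l (ltW a0)) (max_r (ltW a0)) => /dphi[].
rewrite (min_l (ltW a0)) (max_r (ltW a0)) => ta E1.
have [s|s] := @mvt_line _ _ ('D_(e k) g) (y + t *: e k) (e l) a.
  rewrite (min_l (ltW a0)) (max_r (ltW a0)) => sa; apply: ddg; exact: lt_r.
rewrite (min_l (ltW a0)) (max_r (ltW a0)) => sa E2.
exists (y + t *: e k + s *: e l); first exact: near_y.
have [_ d] := dphi _ ta; rewrite d E2 /phi in E1.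
rewrite expr2 -mulrA -E1; ring.
Qed.

Lemma schwarz (k l : 'I_p) :
  (\forall x \near y, forall k, derivable g x (e k)) ->
  (\forall x \near y, forall k l, derivable ('D_(e k) g) x (e l)) ->
  (forall k l, {for y, continuous ('D_(e l) ('D_(e k) g))}) ->
  'D_(e l) ('D_(e k) g) y = 'D_(e k) ('D_(e l) g) y.
Proof.
move=> dg ddg cg; apply/eqP; rewrite -subr_eq0 -normr_le0.
apply/ler_addgt0Pl => eps e0; rewrite addr0.
have e20 : 0 < eps / 2 by rewrite divr_gt0.
have /cvgrPdist_lt/(_ _ e20) c1 := cg k l.
have /cvgrPdist_lt/(_ _ e20) c2 := cg l k.
have [r r0 [dg' ddg' c1' c2']] : exists2 r, 0 < r & [/\
  (forall x, `|x - y| < r -> forall k, derivable g x (e k)),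
  (forall x, `|x - y| < r -> forall k l, derivable ('D_(e k) g) x (e l)),
  (forall x, `|x - y| < r -> `|'D_(e l) ('D_(e k) g) y - 'D_(e l) ('D_(e k) g) x| < eps / 2) &
  (forall x, `|x - y| < r -> `|'D_(e k) ('D_(e l) g) y - 'D_(e k) ('D_(e l) g) x| < eps / 2)].
  have [r /= r0 rP] := (@nbhs_normP _ _ _ _).1 (filterI (filterI dg ddg) (filterI c1 c2)).
  have bx x : `|x - y| < r -> ball_ Num.norm y r x by rewrite /ball_/= distrC.
  exists r; first exact: r0.
  split=> x /bx/rP.
  - move=> [[h _] _]; exact: h.
  - move=> [[_ h] _]; exact: h.
  - move=> [_ [h _]]; exact: h.
  - move=> [_ [_ h]]; exact: h.
have [a a0 ar] : exists2 a : R, 0 < a & 2 * a < r.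
  by exists (r / 4); [rewrite divr_gt0|lra].
have [x /le_lt_trans/(_ ar) /c1' xr E1] := second_difference k l a0 ar dg' ddg'.
have [x' /le_lt_trans/(_ ar) /c2' xr' E2] := second_difference l k a0 ar dg' ddg'.
have E : 'D_(e l) ('D_(e k) g) x = 'D_(e k) ('D_(e l) g) x'.
  apply: (@mulfI _ (a ^+ 2)); first by rewrite expf_eq0/= gt_eqF.
  refine (etrans (esym E1) (etrans _ E2)).
  by rewrite (addrAC y (a *: e k)) (addrAC _ (- g (y + a *: e k))).
apply: (dist_le_half _ xr').
exact: (eq_ind _ (fun C => `|_ - C| < _) xr _ E).
Qed.

End schwarz.

(** * Functions of class C_L^k *)

Section CL_calculus.
Context {R : realType} {p : nat} {Z : topologicalType}.
Implicit Types (U : set ('rV[R]_p * Z)) (k : nat).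
Local Notation e i := (delta_mx ord0 i : 'rV[R]_p).

Lemma near_slice U (u : 'rV[R]_p * Z) : open U -> U u -> \forall y \near u.1, U (y, u.2).
Proof.
move=> oU Uu;
have : nbhs (u.1, u.2) U by move: (u) Uu => [y z] Uu; exact: open_nbhs_nbhs.
move=> [[A B] /= [Ay Bz] AB]; apply: filterS Ay => y Ay.
by apply: AB; split => //=; exact: nbhs_singleton.
Qed.

Lemma CL_fun0 {W : normedModType R} U (f : 'rV[R]_p * Z -> W) :
  CL_fun 0 U f <-> forall u, U u -> {for u, continuous f}.
Proof.
split=> [/(_ [::] isT)[]//|cf s]; rewrite leqn0 size_eq0 => /eqP ->.
by split.
Qed.

(** Replaces the quantification over lists of directions by a recursion on k. As [foldr]
    differentiates first along the last entry, lists are peeled from the right. *)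
Lemma CL_funS {W : normedModType R} k U (f : 'rV[R]_p * Z -> W) :
  CL_fun k.+1 U f <-> CL_fun 0 U f /\ forall i,
    (forall u, U u -> derivable (fun y => f (y, u.2)) u.1 (e i)) /\
    CL_fun k U (partial i f).
Proof.
have E s i : partials s (partial i f) = partials (rcons s i) f.
  by rewrite /partials foldr_rcons.
split=> [fk|[/CL_fun0 f0 fk] s].
  split; first by apply/CL_fun0; have [] := fk [::] isT.
  move=> i; split; first by have [_ /(_ isT)] := fk [::] isT; exact.
  by move=> s sk; rewrite E; have := fk (rcons s i); rewrite size_rcons; apply.
case/lastP: s => [_|s i]; first by split=> // _ i; have [] := fk i.
by rewrite size_rcons !ltnS -E; have [_] := fk i; exact.
Qed.

Lemma CL_fun_sub {W : normedModType R} j k U U' (f : 'rV[R]_p * Z -> W) :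
  (j <= k)%N -> U' `<=` U -> CL_fun k U f -> CL_fun j U' f.
Proof.
move=> jk UU fk s sj; have [h1 h2] := fk s (leq_trans sj jk); split=> [u /UU/h1//|].
by move=> sj' i u /UU; apply: h2; exact: leq_trans jk.
Qed.

(** Every condition in [CL_fun] concerns a single point of the set and refers to full neighbourhoods
    of it, so a cover by sets on which the class is known suffices. *)
Lemma CL_fun_local {W : normedModType R} k U (f : 'rV[R]_p * Z -> W) :
  (forall u, U u -> exists U', U' u /\ CL_fun k U' f) -> CL_fun k U f.
Proof.
move=> lf s sk; split=> [u /lf[U' [U'u /(_ s sk)[]]]|sk' i u /lf[U' [U'u /(_ s sk)[_]]]].
  by move=> /(_ _ U'u).
by move=> /(_ sk' i _ U'u).
Qed.

Lemma eq_partial {W : normedModType R} U (f g : 'rV[R]_p * Z -> W) i :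
  open U -> (forall u, U u -> f u = g u) ->
  forall u, U u -> partial i f u = partial i g u.
Proof.
move=> oU fg u Uu; rewrite /partial; apply: near_eq_derive.
by apply: filterS (near_slice oU Uu) => y /fg.
Qed.

Lemma CL_fun_eq {W : normedModType R} k U (f g : 'rV[R]_p * Z -> W) :
  open U -> (forall u, U u -> f u = g u) -> CL_fun k U f -> CL_fun k U g.
Proof.
move=> oU; elim: k f g => [|k IH] f g fg.
  move=> /CL_fun0 cf; apply/CL_fun0 => u Uu; rewrite /prop_for/continuous_at -fg//.
  apply: cvg_trans (cf u Uu); apply: near_eq_cvg.
  by apply: filterS (open_nbhs_nbhs (conj oU Uu)) => v /fg.
move=> /CL_funS[f0 fk]; apply/CL_funS; split.
  move/CL_fun0 : f0 => cf; apply/CL_fun0 => u Uu; rewrite /prop_for/continuous_at -fg//.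
  apply: cvg_trans (cf u Uu); apply: near_eq_cvg.
  by apply: filterS (open_nbhs_nbhs (conj oU Uu)) => v /fg.
move=> i; have [df fki] := fk i; split.
  move=> u Uu; apply: near_eq_derivable (df u Uu).
  by apply: filterS (near_slice oU Uu) => y /fg.
by apply: IH fki => u Uu; exact: (eq_partial i oU fg Uu).
Qed.

Lemma CL_fun_cst {W : normedModType R} k U (c : W) : CL_fun k U (fun=> c).
Proof.
elim: k c => [|k IH] c.
  by apply/CL_fun0 => u _; exact: cst_continuous.
apply/CL_funS; split; first by apply/CL_fun0 => u _; exact: cst_continuous.
move=> i; split=> [u _|]; first exact: derivable_cst.
rewrite (_ : partial i _ = fun=> 0); first exact: IH.
by apply/funext => u; rewrite /partial derive_cst.
Qed.

Lemma CL_fun_add {W : normedModType R} k U (f g : 'rV[R]_p * Z -> W) : open U ->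
  CL_fun k U f -> CL_fun k U g -> CL_fun k U (fun u => f u + g u).
Proof.
move=> oU; elim: k f g => [|k IH] f g.
  move=> /CL_fun0 cf /CL_fun0 cg; apply/CL_fun0 => u Uu.
  exact: (cvgD (cf u Uu) (cg u Uu)).
move=> /CL_funS[/CL_fun0 cf fk] /CL_funS[/CL_fun0 cg gk]; apply/CL_funS; split.
  by apply/CL_fun0 => u Uu; exact: (cvgD (cf u Uu) (cg u Uu)).
move=> i; have [df fki] := fk i; have [dg gki] := gk i; split.
  by move=> u Uu; apply: derivableD; [exact: df|exact: dg].
apply: (CL_fun_eq oU _ (IH _ _ fki gki)) => u Uu.
by rewrite /partial; have := deriveD (df u Uu) (dg u Uu).
Qed.

Lemma CL_fun_sum {W : normedModType R} k U n (f : 'I_n -> 'rV[R]_p * Z -> W) :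
  open U -> (forall j, CL_fun k U (f j)) -> CL_fun k U (fun u => \sum_(j < n) f j u).
Proof.
move=> oU; elim: n f => [|n IH] f fk.
  rewrite (_ : (fun u => _) = fun=> 0); first exact: CL_fun_cst.
  by apply/funext => u; rewrite big_ord0.
rewrite (_ : (fun u => _) = fun u => \sum_(j < n) f (widen_ord (leqnSn n) j) u + f ord_max u).
  by apply: CL_fun_add => //; apply: IH.
by apply/funext => u; rewrite big_ord_recr.
Qed.

Lemma CL_fun_mul k U (f g : 'rV[R]_p * Z -> R) : open U ->
  CL_fun k U f -> CL_fun k U g -> CL_fun k U (fun u => f u * g u).
Proof.
move=> oU; elim: k f g => [|k IH] f g.
  move=> /CL_fun0 cf /CL_fun0 cg; apply/CL_fun0 => u Uu.
  exact: (cvgM (cf u Uu) (cg u Uu)).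
move=> fk1 gk1.
have fk' := CL_fun_sub (leqnSn k) (@subset_refl _ U) fk1.
have gk' := CL_fun_sub (leqnSn k) (@subset_refl _ U) gk1.
move: fk1 gk1 => /CL_funS[/CL_fun0 cf fk] /CL_funS[/CL_fun0 cg gk]; apply/CL_funS; split.
  by apply/CL_fun0 => u Uu; exact: (cvgM (cf u Uu) (cg u Uu)).
move=> i; have [df fki] := fk i; have [dg gki] := gk i; split.
  by move=> u Uu; apply: derivableM; [exact: df|exact: dg].
apply: (CL_fun_eq oU _ (CL_fun_add oU (IH _ _ fk' gki) (IH _ _ gk' fki))) => u Uu.
by rewrite /partial; have := deriveM (df u Uu) (dg u Uu); rewrite -surjective_pairing.
Qed.

Lemma partial_coord q (f : 'rV[R]_p * Z -> 'rV[R]_q) i j u :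
  derivable (fun y => f (y, u.2)) u.1 (e i) ->
  derivable (fun y => f (y, u.2) ord0 j) u.1 (e i) /\
  partial i (fun u => f u ord0 j) u = partial i f u ord0 j.
Proof.
move=> df; split; first by have /derivable_mxP := df; exact.
by rewrite /partial derive_mx// mxE.
Qed.

Lemma CL_fun_coord k U q (f : 'rV[R]_p * Z -> 'rV[R]_q) j : open U ->
  CL_fun k U f -> CL_fun k U (fun u => f u ord0 j).
Proof.
move=> oU.
have c0 f' : CL_fun 0 U f' -> CL_fun 0 U (fun u => (f' u : 'rV[R]_q) ord0 j).
  move=> /CL_fun0 cf; apply/CL_fun0 => u Uu.
  exact: (cvg_comp _ _ (cf u Uu) (@coord_continuous R 1 q ord0 j (f' u))).
elim: k f => [|k IH] f; first exact: c0.
move=> /CL_funS[/c0 f0 fk]; apply/CL_funS; split => // i.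
have [df fki] := fk i; split=> [u Uu|]; first by have [] := partial_coord j (df u Uu).
apply: (CL_fun_eq oU _ (IH _ fki)) => u Uu.
by have [_] := partial_coord j (df u Uu).
Qed.

End CL_calculus.

Lemma continuous_pair {X Y Y' : topologicalType} (f : X -> Y) (g : X -> Y') x :
  {for x, continuous f} -> {for x, continuous g} ->
  {for x, continuous (fun x => (f x, g x))}.
Proof. by move=> cf cg; apply: cvg_pair. Qed.

Lemma pair_cvg {X Y : topologicalType} (x : X) (c : Y) : (y, c) @[y --> x] --> (x, c).
Proof. by apply: cvg_pair; [exact: cvg_id|exact: cvg_cst]. Qed.

(** Reduces a directional derivative to an ordinary derivative at 0, where the one-variable chain
    rule applies. *)
Lemma is_derive_along {R : realType} {V W : normedModType R} (f : V -> W)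
    (x v : V) (d : W) :
  is_derive x v f d <-> is_derive (0 : R) (1 : R) (fun h : R => f (h *: v + x)) d.
Proof.
have E : (fun h : R => h^-1 *: (f ((h *: (1 : R) + 0) *: v + x) - f (0 *: v + x)))
    = (fun h : R => h^-1 *: (f (h *: v + x) - f x)).
  apply/funext => h.
  by rewrite addr0 (mulr1 h : h *: (1 : R) = h) scale0r add0r.
have E1 : derivable (fun h : R => f (h *: v + x)) (0 : R) (1 : R) <-> derivable f x v.
  by rewrite /derivable /= E.
have E2 : 'D_(1 : R) (fun h : R => f (h *: v + x)) (0 : R) = 'D_v f x.
  by rewrite /derive /= E.
split=> [] [h1 h2]; apply: DeriveDef.
- exact/E1.
- by rewrite E2.
- exact/E1.
- by rewrite -E2.
Qed.

Lemma slice_continuous {R : realType} {p : nat} {Z : topologicalType}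
    {W : normedModType R} (f : 'rV[R]_p * Z -> W) u :
  {for u, continuous f} -> {for u.1, continuous (fun y => f (y, u.2))}.
Proof.
move=> cf; rewrite /prop_for/continuous_at -surjective_pairing.
apply: (@cvg_comp _ _ _ (fun y => (y, u.2)) f (nbhs u.1) (nbhs u) _ _ cf).
rewrite {3}[u]surjective_pairing; exact: pair_cvg.
Qed.

Section CL_composition.
Context {R : realType} {p q : nat} {Z Z' : topologicalType}.
Local Notation e i := (delta_mx ord0 i : 'rV[R]_p).


(** As [f2] depends on the transverse variable alone, the composed slice stays in one plaque, and
    only leafwise derivatives of [g] occur in the chain rule. *)
Lemma partial_comp (V : set ('rV[R]_q * Z')) (g : 'rV[R]_q * Z' -> R)
    (f1 : 'rV[R]_p * Z -> 'rV[R]_q) (f2 : Z -> Z') i u :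
  open V -> V (f1 u, f2 u.2) -> CL_fun 1 V g ->
  derivable (fun y => f1 (y, u.2)) u.1 (e i) ->
  is_derive u.1 (e i) (fun y => g (f1 (y, u.2), f2 u.2))
    (\sum_(j < q) partial i f1 u ord0 j * partial j g (f1 u, f2 u.2)).
Proof.
move=> oV Vu /CL_funS[_ gS] /derivableP df.
have := @is_derive_comp_rV R q 'rV[R]_p (fun y => g (y, f2 u.2))
  (fun y => f1 (y, u.2)) u.1 (e i) (partial i f1 u).
rewrite -surjective_pairing; apply => //.
  apply: filterS (near_slice oV Vu) => y Vy k.
  by have [/(_ _ Vy)] := gS k.
move=> k; have [_ /CL_fun0 cg] := gS k.
exact: (slice_continuous (cg _ Vu)).
Qed.

Lemma CL_fun_comp k (U : set ('rV[R]_p * Z)) (V : set ('rV[R]_q * Z'))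
    (g : 'rV[R]_q * Z' -> R) (f1 : 'rV[R]_p * Z -> 'rV[R]_q) (f2 : Z -> Z') :
  open U -> open V -> (forall u, U u -> V (f1 u, f2 u.2)) ->
  CL_fun k U f1 -> (forall u, U u -> {for u.2, continuous f2}) ->
  CL_fun k V g -> CL_fun k U (fun u => g (f1 u, f2 u.2)).
Proof.
move=> oU oV UV + cf2.
have c0 g' : CL_fun 0 U f1 -> CL_fun 0 V g' ->
    CL_fun 0 U (fun u => (g' (f1 u, f2 u.2)) : R).
  move=> /CL_fun0 cf1 /CL_fun0 cg; apply/CL_fun0 => u Uu.
  apply: (@continuous_comp _ _ _ (fun u => (f1 u, f2 u.2)) g' u _ (cg _ (UV _ Uu))).
  apply: continuous_pair; first exact: cf1.
  exact: (@continuous_comp _ _ _ snd f2 u (@cvg_snd _ _ _ _ _) (cf2 _ Uu)).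
elim: k g => [|k IH] g f1k gk; first exact: c0.
have f1k0 := CL_fun_sub (leq0n _) (@subset_refl _ U) f1k.
have gk0 := CL_fun_sub (leq0n _) (@subset_refl _ V) gk.
have gk1 := CL_fun_sub (isT : (1 <= k.+1)%N) (@subset_refl _ V) gk.
have f1k' := CL_fun_sub (leqnSn k) (@subset_refl _ U) f1k.
apply/CL_funS; split; first exact: c0.
move=> i; move: f1k => /CL_funS[_ /(_ i)[df f1ki]].
have D u (Uu : U u) := partial_comp oV (UV _ Uu) gk1 (df _ Uu).
split; first by move=> u /D[].
have S : CL_fun k U (fun u => \sum_(j < q) partial i f1 u ord0 j * partial j g (f1 u, f2 u.2)).
  apply: CL_fun_sum => // j; apply: CL_fun_mul => //.
    exact: CL_fun_coord.
  by apply: IH => //; move: gk => /CL_funS[_ /(_ j)[]].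
by apply: (CL_fun_eq oU _ S) => u /D[_ <-].
Qed.

End CL_composition.

Section CL_examples.
Context {R : realType} {p : nat} {Z : topologicalType}.
Implicit Types (U : set ('rV[R]_p * Z)).
Local Notation e i := (delta_mx ord0 i : 'rV[R]_p).

Lemma partial_fst (i : 'I_p) (u : 'rV[R]_p * Z) :
  is_derive u.1 (e i) (fun y : 'rV[R]_p => y) (e i).
Proof. exact: is_derive_id. Qed.

Lemma CL_fun_fst k U : CL_fun k U (fst : 'rV[R]_p * Z -> 'rV[R]_p).
Proof.
case: k => [|k].
  by apply/CL_fun0 => u _; exact: cvg_fst.
apply/CL_funS; split; first by apply/CL_fun0 => u _; exact: cvg_fst.
move=> i; split=> [u _|]; first by have [] := partial_fst i u.
rewrite (_ : partial i _ = fun=> e i); first exact: CL_fun_cst.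
by apply/funext => u; have [_] := partial_fst i u.
Qed.

Lemma CL_fun_snd k U (chi : Z -> R) : (forall u, U u -> {for u.2, continuous chi}) ->
  CL_fun k U (fun u => chi u.2).
Proof.
move=> cchi; have c0 : CL_fun 0 U (fun u => chi u.2).
  apply/CL_fun0 => u Uu.
  exact: (@continuous_comp _ _ _ snd chi u (@cvg_snd _ _ _ _ _) (cchi _ Uu)).
case: k => [//|k].
apply/CL_funS; split; [exact: c0|move=> i; split=> [u _|]].
  exact: (@derivable_cst R 'rV[R]_p R (chi u.2) u.1 (e i)).
rewrite (_ : partial i _ = fun=> 0); first exact: CL_fun_cst.
by apply/funext => u; exact: (@derive_cst R 'rV[R]_p R (chi u.2) u.1 (e i)).
Qed.

(* Of class C^(n-1), which for n = 4 suffices to build C^3 cutoff functions. *)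
Definition pos_pow n (t : R) := (Num.max t 0) ^+ n.

Lemma pos_pow_continuous n : continuous (pos_pow n).
Proof.
move=> t; apply: (@continuous_comp _ _ _ (fun t : R => Num.max t 0) (fun t => t ^+ n)).
  by apply: (@continuous_max _ _ id (fun=> 0)); [exact: cvg_id|exact: cvg_cst].
exact: exprn_continuous.
Qed.

Lemma is_derive_pos_pow n (t : R) :
  is_derive t (1 : R) (pos_pow n.+2) (n.+2%:R * pos_pow n.+1 t).
Proof.
have [t0|t0|->] := ltgtP t 0.
- have : is_derive t (1 : R) (fun=> 0) (0 : R) by exact: is_derive_cst.
  rewrite /pos_pow (max_r (ltW t0)) expr0n mulr0; apply: near_eq_is_derive.
  near=> s; rewrite max_r ?expr0n//; apply/ltW; near: s; exact: lt_nbhsl.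
- have : is_derive t (1 : R) (fun s : R => s ^+ n.+2) (n.+2%:R * t ^+ n.+1).
    apply: DeriveDef; first exact: exprn_derivable.
    by rewrite exp_derive /GRing.scale/= mulr1 mulr_natl.
  rewrite /pos_pow (max_l (ltW t0)); apply: near_eq_is_derive.
  near=> s; rewrite max_l//; apply/ltW; near: s; exact: lt_nbhsr.
(* At 0 the difference quotient is dominated by [pos_pow n.+1], which is continuous and vanishes
   there. *)
have G : h^-1 *: (pos_pow n.+2 (h *: (1 : R) + 0) - pos_pow n.+2 0) @[h --> 0^'] --> (0 : R).
  rewrite {2}/pos_pow maxxx expr0n; apply/cvgrPdist_lt => eps e0.
  have : pos_pow n.+1 h @[h --> 0^'] --> (0 : R).
    have E : pos_pow n.+1 0 = 0 by rewrite /pos_pow maxxx expr0n.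
    rewrite -{2}E; apply: cvg_within_filter; exact: (@pos_pow_continuous n.+1 0).
  move=> /cvgrPdist_lt/(_ _ e0); apply: filterS => h.
  rewrite !sub0r !normrN subr0 addr0 (mulr1 h : h *: (1 : R) = h); apply: le_lt_trans.
  have [h0|h0] := leP h 0; first by rewrite /pos_pow !max_r// !expr0n scaler0 normr0.
  have hm : Num.max h 0 = h by apply: max_l; exact: ltW.
  by rewrite /pos_pow hm /GRing.scale/= (exprS h n.+1) mulKf// gt_eqF.
rewrite {2}/pos_pow maxxx expr0n mulr0; apply: DeriveDef; first exact: (cvgP _ G).
exact: (cvg_lim _ G).
Unshelve. all: end_near. Qed.

Lemma CL_fun_pos_pow k n U (f : 'rV[R]_p * Z -> R) : open U -> (k <= n)%N ->
  CL_fun k U f -> CL_fun k U (fun u => pos_pow n.+1 (f u)).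
Proof.
move=> oU; have c0 n' : CL_fun 0 U f -> CL_fun 0 U (fun u => pos_pow n' (f u)).
  move=> /CL_fun0 cf; apply/CL_fun0 => u Uu.
  exact: (@continuous_comp _ _ _ f (pos_pow n') u (cf _ Uu) (@pos_pow_continuous n' (f u))).
elim: k n => [|k IH] n kn fk; first exact: c0.
have f0 := CL_fun_sub (leq0n _) (@subset_refl _ U) fk.
have fk' := CL_fun_sub (leqnSn k) (@subset_refl _ U) fk.
apply/CL_funS; split; first exact: c0.
move=> i; case: n kn => [//|n] kn; move: fk => /CL_funS[_ /(_ i)[df fki]].
have D u (Uu : U u) : is_derive u.1 (e i) (fun y => pos_pow n.+2 (f (y, u.2)))
    (n.+2%:R * pos_pow n.+1 (f u) * partial i f u).
  have /is_derive_along d1 := derivableP (df u Uu).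
  apply/is_derive_along.
  have <- : pos_pow n.+2 \o (fun h : R => f (h *: e i + u.1, u.2)) =
      fun h : R => pos_pow n.+2 (f (h *: e i + u.1, u.2)) by [].
  have d2 := is_derive_pos_pow n (f (0 *: e i + u.1, u.2)).
  have -> : f u = f (0 *: e i + u.1, u.2).
    by rewrite scale0r add0r -surjective_pairing.
  exact: (@is_derive1_comp _ (pos_pow n.+2) (fun h : R => f (h *: e i + u.1, u.2)) _ _ _ d2 d1).
split; first by move=> u /D[].
have S : CL_fun k U (fun u => n.+2%:R * pos_pow n.+1 (f u) * partial i f u).
  have c : CL_fun k U (fun=> n.+2%:R : R) by exact: CL_fun_cst.
  have S1 := CL_fun_mul oU c (IH n kn fk').
  exact: (CL_fun_mul oU S1 fki).
by apply: (CL_fun_eq oU _ S) => u /D[_ <-].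
Qed.

End CL_examples.

(* Gives back to [index], [coord] and [comp] their meaning from Defs, shadowed above. *)
Import Defs.

(** * Charts and cutoff functions *)

Lemma open_preimage_within {X Y : topologicalType} (D : set X) (f : X -> Y) (O : set Y) :
  open D -> (forall x, D x -> {for x, continuous f}) -> open O ->
  open (D `&` f @^-1` O).
Proof.
move=> oD cf oO; rewrite openE => x [Dx Ox].
apply: filterI; first exact: open_nbhs_nbhs.
exact: (cf x Dx) (open_nbhs_nbhs (conj oO Ox)).
Qed.

Section charts.
Context {R : realType} {p : nat} {M Z : metricType R} (F : foliation p M Z).
Implicit Types (a b : Defs.index F) (m : M).

Lemma box_open a : open (box (atlas a)).
Proof.
rewrite openE => -[y z] [/= By Tz]; exists (base (atlas a), transv (atlas a)) => //=.
by split; apply: open_nbhs_nbhs; split => //; [exact: base_open|exact: transv_open].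
Qed.

Lemma box_coord a m : dom (atlas a) m -> box (atlas a) (coord (atlas a) m).
Proof. exact: coord_fun. Qed.

Lemma transition k b a m : dom (atlas b) m -> dom (atlas a) m ->
  exists U f1 f2, [/\ open U /\ U (coord (atlas b) m),
    CL_fun k U f1,
    forall u, U u -> {for u.2, continuous f2},
    (forall u, U u -> box (atlas b) u /\ dom (atlas a) (param (atlas b) u)) &
    forall u, U u -> coord (atlas a) (param (atlas b) u) = (f1 u, f2 u.2)].
Proof.
move=> bm am; have [] := @atlas_smooth _ _ _ _ F b a k (coord (atlas b) m).
  by exists m.
move=> U [oU Um Usub [f1 [f2 [f1k cf2 E]]]].
exists U, f1, f2; split => // [u Uu|u /Usub[m' [bm' am'] <-]].
  by apply: cf2; exists u.
by split; [exact: box_coord|rewrite coordK].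
Qed.

Definition chart_extension a (h : 'rV[R]_p * Z -> R) (m : M) : R :=
  if `[< dom (atlas a) m >] then h (coord (atlas a) m) else 0.

Lemma chart_extensionE a h u : box (atlas a) u ->
  chart_extension a h (param (atlas a) u) = h u.
Proof.
move=> bu; rewrite /chart_extension ifT ?paramK//.
by apply/asboolP; exact: param_fun.
Qed.

(** At a point of the domain of [a] the extension is [h] composed with a transition map. Any other
    point has a neighbourhood disjoint from [K], which is closed in the whole space, and the
    extension vanishes on it; so no singularity arises at the boundary of the chart. *)
Lemma chart_extension_leafwise a k (h : 'rV[R]_p * Z -> R) (K : set M) :
  closed K -> K `<=` dom (atlas a) -> CL_fun k (box (atlas a)) h ->
  (forall m, dom (atlas a) m -> ~ K m -> h (coord (atlas a) m) = 0) ->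
  leafwise_function F k (chart_extension a h).
Proof.
move=> cK Ka hk h0 b; apply: CL_fun_local => u bu.
have bm : dom (atlas b) (param (atlas b) u) by exact: param_fun.
have [am|am] := pselect (dom (atlas a) (param (atlas b) u)).
  have [U [f1 [f2 [[oU Uu] f1k cf2 Usub E]]]] := transition k bm am.
  rewrite (paramK bu) in Uu; exists U; split => //.
  have HU v : U v -> box (atlas a) (f1 v, f2 v.2).
    by move=> Uv; rewrite -E//; apply: box_coord; have [] := Usub v Uv.
  have S := CL_fun_comp oU (@box_open a) HU f1k cf2 hk.
  apply: (CL_fun_eq oU _ S) => v Uv /=.
  rewrite /chart_extension ifT; last by apply/asboolP; have [] := Usub v Uv.
  by rewrite E.
pose U := box (atlas b) `&` param (atlas b) @^-1` (~` K).
have oU : open U.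
  apply: open_preimage_within; [exact: box_open|exact: param_continuous|].
  exact: closed_openC.
exists U; split; first by split => // /Ka.
have S : CL_fun k U (fun=> 0 : R) by exact: CL_fun_cst.
apply: (CL_fun_eq oU _ S) => v [bv nK] /=.
by rewrite /chart_extension; case: asboolP => // av; rewrite h0.
Qed.

(** Frees [vf_apply] from the chart picked by [chart_at]: the chain rule for [f] and the rule
    [comp_change] contribute the same Jacobian. Regularity is asked on an arbitrary open [O], so
    that the formula can be used on the plateau of a cutoff function, where test functions have a
    simple expression. *)
Lemma vf_apply_chart k (V : vector_field k F) (f : M -> R) a m (O : set ('rV[R]_p * Z)) :
  dom (atlas a) m -> open O -> O (coord (atlas a) m) ->
  CL_fun 1 O (f \o param (atlas a)) ->
  vf_apply V f m = \sum_(j < p) Defs.comp V a m ord0 j *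
    partial j (f \o param (atlas a)) (coord (atlas a) m).
Proof.
move=> am oO Om fO; rewrite /vf_apply; set b := chart_at F m.
have bm : dom (atlas b) m by rewrite /b /chart_at; case: cid.
have [U [f1 [f2 [[oU Um] f1k cf2 Usub E]]]] := transition 1 bm am.
have Em : (f1 (coord (atlas b) m), f2 (coord (atlas b) m).2) = coord (atlas a) m.
  by rewrite -E// coordK.
have D i : is_derive (coord (atlas b) m).1 (delta_mx ord0 i : 'rV[R]_p)
    (fun y => (f \o param (atlas a)) (f1 (y, (coord (atlas b) m).2), f2 (coord (atlas b) m).2))
    (\sum_(j < p) partial i f1 (coord (atlas b) m) ord0 j *
      partial j (f \o param (atlas a)) (coord (atlas a) m)).
  rewrite -Em; apply: (partial_comp oO) => //; first by rewrite Em.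
  by move: f1k => /CL_funS[_ /(_ i)[+ _]]; exact.
rewrite (comp_change V bm am).
have E1 i : partial i (fst \o coord (atlas a) \o param (atlas b)) (coord (atlas b) m) =
    partial i f1 (coord (atlas b) m).
  by apply: (eq_partial i oU _ Um) => u Uu /=; rewrite E.
have E2 i : partial i (f \o param (atlas b)) (coord (atlas b) m) =
    \sum_(j < p) partial i f1 (coord (atlas b) m) ord0 j *
      partial j (f \o param (atlas a)) (coord (atlas a) m).
  have [_ <-] := D i.
  rewrite (@eq_partial _ _ _ _ U _ (fun u => (f \o param (atlas a)) (f1 u, f2 u.2)) i oU _ _ Um)//.
  by move=> u Uu /=; rewrite -E// coordK//; have [] := Usub u Uu.
under eq_bigr do rewrite E2 mulr_sumr.
rewrite exchange_big/=; apply: eq_bigr => j _.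
rewrite summxE mulr_suml; apply: eq_bigr => i _.
by rewrite !mxE E1 mulrA.
Qed.

End charts.

Lemma norm_dist_continuous {R : realType} {V : normedModType R} (c : V) :
  continuous (fun y : V => `|y - c|).
Proof. by move=> y; apply: cvg_norm; apply: cvgB; [exact: cvg_id|exact: cvg_cst]. Qed.

Section metric_facts.
Context {R : realType} {M : metricType R}.

Lemma nbhs_mdist_lt (x : M) (e : R) : 0 < e -> nbhs x [set y | mdist x y < e].
Proof.
move=> e0; apply/metricType_numDomainType.nbhs_mdistP.
by exists e.
Qed.

Lemma nbhs_mdist_ex (x : M) (A : set M) : nbhs x A ->
  exists2 e : R, 0 < e & forall y, mdist x y < e -> A y.
Proof.
move=> /metricType_numDomainType.nbhs_mdistP[e /= e0 eA].
by exists e => // y; exact: eA.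
Qed.

Lemma mdist_continuous (x : M) : continuous (mdist x : M -> R).
Proof.
move=> y; apply/cvgrPdist_lt => e e0; near=> z.
have yz : mdist y z < e by near: z; exact: nbhs_mdist_lt.
apply: le_lt_trans yz; rewrite ler_norml lerBrDr lerBlDr; apply/andP; split.
  by rewrite addrC lerBlDr; exact: metric_triangle.
by rewrite addrC (metric_sym y) metric_triangle.
Unshelve. all: end_near. Qed.

Lemma closed_mdist_le (x : M) (c : R) : closed [set y | mdist x y <= c].
Proof.
rewrite (_ : [set y | _] = mdist x @^-1` [set t | t <= c])//.
by apply: closed_comp; [move=> y _; exact: mdist_continuous|exact: closed_le].
Qed.

End metric_facts.

Section pieces.
Context {R : realType} {p : nat} {M Z : metricType R} (F : foliation p M Z).

(* The concentric balls of 1, 2 and 3 times the radii [pry] and [prz] bound the core, where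
   paths are located, the plateau, where the cutoff function is 1, and the hull, which
   contains its support. *)
Record piece := Piece {
  pidx : index F;
  pcy : 'rV[R]_p;
  pcz : Z;
  pry : R;
  prz : R;
  pry_gt0 : 0 < pry;
  prz_gt0 : 0 < prz;
  piece_base : forall y, `|y - pcy| <= 3 * pry -> base (atlas pidx) y;
  piece_transv : forall z, mdist pcz z <= 3 * prz -> transv (atlas pidx) z;
  piece_compact : compact [set z | mdist pcz z <= 3 * prz]
}.

Implicit Type P : piece.

Definition piece_box P (c : R) : set ('rV[R]_p * Z) :=
  [set y | `|y - pcy P| <= c * pry P] `*` [set z | mdist (pcz P) z <= c * prz P].

Definition core P : set M := param (atlas (pidx P)) @` piece_box P 1.
Definition hull P : set M := param (atlas (pidx P)) @` piece_box P 3.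

Lemma piece_box_sub P c : c <= 3 -> piece_box P c `<=` box (atlas (pidx P)).
Proof.
move=> c3 [y z] [/= yc zc]; split => /=.
  by apply: piece_base; apply: le_trans yc _; rewrite ler_pM2r// pry_gt0.
by apply: piece_transv; apply: le_trans zc _; rewrite ler_pM2r// prz_gt0.
Qed.

Lemma piece_box_compact P c : c <= 3 -> compact (piece_box P c).
Proof.
move=> c3; apply: compact_setX.
  apply: bounded_closed_compact.
    exists (c * pry P + `|pcy P|); split; first exact: num_real.
    move=> x hx y /= yc; apply: le_trans (ltW hx).
    by rewrite -{1}(subrK (pcy P) y) (le_trans (ler_normD _ _))// lerD2r.
  rewrite (_ : [set y | _] = (fun y => `|y - pcy P|) @^-1` [set t | t <= c * pry P])//.
  apply: closed_comp; last exact: closed_le.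
  by move=> y _; exact: norm_dist_continuous.
have C := @subclosed_compact Z _ _ (@closed_mdist_le R Z (pcz P) (c * prz P)) (@piece_compact P).
by apply: C => z /= /le_trans; apply; rewrite ler_pM2r// prz_gt0.
Qed.

Lemma piece_image_compact P c : c <= 3 ->
  compact (param (atlas (pidx P)) @` piece_box P c).
Proof.
move=> c3; apply: continuous_compact; last exact: piece_box_compact.
apply: continuous_in_subspaceT => u /set_mem/(piece_box_sub c3).
exact: param_continuous.
Qed.

Lemma core_compact P : compact (core P).
Proof. by apply: piece_image_compact; rewrite ler1n. Qed.

Lemma core_closed P : closed (core P).
Proof. exact: (compact_closed (@metric_hausdorff _ M) (@core_compact P)). Qed.

Lemma hull_closed P : closed (hull P).
Proof.
by apply: (compact_closed (@metric_hausdorff _ M)); exact: piece_image_compact.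
Qed.

Lemma hull_dom P : hull P `<=` dom (atlas (pidx P)).
Proof. by move=> _ [u /(piece_box_sub (lexx _)) bu <-]; exact: param_fun. Qed.

Lemma core_dom P : core P `<=` dom (atlas (pidx P)).
Proof.
have h : (1 : R) <= 3 by rewrite ler1n.
by move=> _ [u /(piece_box_sub h) bu <-]; exact: param_fun.
Qed.

Lemma core_coord P m : core P m -> piece_box P 1 (coord (atlas (pidx P)) m).
Proof.
have h : (1 : R) <= 3 by rewrite ler1n.
by move=> [u bu <-]; rewrite paramK//; exact: piece_box_sub bu.
Qed.

Lemma piece_exists (m : M) : exists P, nbhs m (core P).
Proof.
have [a am] := atlas_cover F m.
have [by_ tz] := box_coord am.
set y0 := (coord (atlas a) m).1 in by_; set z0 := (coord (atlas a) m).2 in tz.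
have [r r0 rB] : exists2 r : R, 0 < r & forall y, `|y - y0| <= 3 * r -> base (atlas a) y.
  have /nbhs_normP[e /= e0 eB] : nbhs y0 (base (atlas a)).
    by apply: open_nbhs_nbhs; split => //; exact: base_open.
  exists (e / 4); first by rewrite divr_gt0.
  by move=> y yr; apply: eB => /=; rewrite distrC (le_lt_trans yr)//; lra.
have [q q0 [qT qC]] : exists2 q : R, 0 < q &
    (forall z, mdist z0 z <= 3 * q -> transv (atlas a) z) /\
    compact [set z | mdist z0 z <= 3 * q].
  have /(_ z0 I) := locally_compact_model F.
  move=> [U zU [cU _]].
  have nU : nbhs z0 (U `&` transv (atlas a)).
    apply: filterI.
      exact: (@filterS _ (nbhs z0) _ (fun z => setT z -> U z) U (fun z h => h I) zU).
    by apply: open_nbhs_nbhs; split => //; exact: transv_open.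
  have [e e0 eU] := nbhs_mdist_ex nU.
  exists (e / 4); first by rewrite divr_gt0.
  have sub z : mdist z0 z <= 3 * (e / 4) -> U z /\ transv (atlas a) z.
    by move=> ze; apply: eU; apply: le_lt_trans ze _; lra.
  split=> [z /sub[]//|].
  have C := @subclosed_compact Z _ _ (@closed_mdist_le R Z z0 (3 * (e / 4))) cU.
  by apply: C => z /= /sub[].
pose P := @Piece a y0 z0 r q r0 q0 rB qT qC.
exists P.
have nc := coord_continuous am.
have n1 : nbhs y0 [set y | `|y - y0| <= r].
  apply: filterS (nbhsx_ballx y0 r r0) => y.
  by rewrite -ball_normE /= distrC => /ltW.
have : nbhs (coord (atlas a) m) (piece_box P 1).
  rewrite [coord _ _]surjective_pairing.
  exists ([set y | `|y - y0| <= 1 * r], [set z | mdist z0 z <= 1 * q]) => //=.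
  rewrite !mul1r; split; first exact: n1.
  by apply: filterS (nbhs_mdist_lt z0 q0) => z /= /ltW.
move=> /nc; have : nbhs m (dom (atlas a)).
  by apply: open_nbhs_nbhs; split => //; exact: dom_open.
apply: filterS2 => m' am' bm'; exists (coord (atlas a) m') => //.
exact: coordK.
Qed.

End pieces.

Section vdir.
Context {R : realType} {p : nat} {M Z : metricType R} (F : foliation p M Z).
Local Notation e i := (delta_mx ord0 i : 'rV[R]_p).

Definition vcomp k (V : vector_field k F) a (u : 'rV[R]_p * Z) : 'rV[R]_p :=
  comp V a (param (atlas a) u).

(* The derivative of [g] along [V], in the coordinates of the chart [a]. *)
Definition vdir k (V : vector_field k F) a (g : 'rV[R]_p * Z -> R)
    (u : 'rV[R]_p * Z) : R :=
  \sum_(j < p) vcomp V a u ord0 j * partial j g u.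

Lemma vcomp_CL k (V : vector_field k F) a l (O : set ('rV[R]_p * Z)) :
  O `<=` box (atlas a) -> CL_fun k O (fun u => vcomp V a u ord0 l).
Proof.
move=> Ob; apply: (CL_fun_sub (leqnn k) Ob).
apply: CL_fun_coord; [exact: box_open|exact: comp_CL].
Qed.

Lemma vdir_CL k n (V : vector_field k F) a (g : 'rV[R]_p * Z -> R) O :
  open O -> O `<=` box (atlas a) -> (n <= k)%N -> CL_fun n.+1 O g ->
  CL_fun n O (vdir V a g).
Proof.
move=> oO Ob nk /CL_funS[_ gn].
have H j : CL_fun n O (fun u => vcomp V a u ord0 j * partial j g u).
  apply: (CL_fun_mul oO); last by have [] := gn j.
  exact: (CL_fun_sub nk (@subset_refl _ O) (vcomp_CL V j Ob)).
exact: (CL_fun_sum oO H).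
Qed.

Lemma vf_apply_vdir k (V : vector_field k F) a (f : M -> R) (g : 'rV[R]_p * Z -> R) O :
  open O -> O `<=` box (atlas a) -> (forall u, O u -> f (param (atlas a) u) = g u) ->
  CL_fun 1 O g -> forall u, O u -> vf_apply V f (param (atlas a) u) = vdir V a g u.
Proof.
move=> oO Ob fg g1 u Ou; have bu := Ob _ Ou.
have am : dom (atlas a) (param (atlas a) u) by exact: param_fun.
have f1 : CL_fun 1 O (f \o param (atlas a)).
  by apply: (CL_fun_eq oO _ g1) => v /fg.
rewrite (vf_apply_chart V am oO _ f1) paramK//.
apply: eq_bigr => j _; congr (_ * _).
exact: (eq_partial j oO fg Ou).
Qed.

Lemma vf_apply_vdir2 k (V W : vector_field k F) a (f : M -> R)
    (g : 'rV[R]_p * Z -> R) O : (0 < k)%N ->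
  open O -> O `<=` box (atlas a) -> (forall u, O u -> f (param (atlas a) u) = g u) ->
  CL_fun 2 O g -> forall u, O u ->
  vf_apply V (vf_apply W f) (param (atlas a) u) = vdir V a (vdir W a g) u.
Proof.
move=> k0 oO Ob fg g2 u Ou.
have g1 := CL_fun_sub (isT : (1 <= 2)%N) (@subset_refl _ O) g2.
apply: (vf_apply_vdir _ oO Ob _ _ Ou); last exact: vdir_CL.
exact: (vf_apply_vdir _ oO Ob fg g1).
Qed.

Lemma vdir_coord k (V : vector_field k F) a i u :
  vdir V a (fun u => u.1 ord0 i) u = vcomp V a u ord0 i.
Proof.
have pE j : partial j (fun u : 'rV[R]_p * Z => u.1 ord0 i) u = (i == j)%:R.
  have [d E] := partial_fst j u.
  have [_ ->] := @partial_coord R p Z p fst j i u d.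
  by rewrite (E : partial j fst u = _) mxE eqxx.
rewrite /vdir (bigD1 i)//= pE eqxx mulr1 big1 ?addr0// => j /negbTE ji.
by rewrite pE eq_sym ji mulr0.
Qed.

(** Leafwise fields annihilate functions of the transverse coordinate; this is what will keep
    solutions in a plaque. *)
Lemma vdir_snd k (V : vector_field k F) a (g : Z -> R) u : vdir V a (fun u => g u.2) u = 0.
Proof.
rewrite /vdir big1// => j _.
by rewrite (_ : partial j _ u = 0) ?mulr0//; exact: (@derive_cst R 'rV[R]_p R (g u.2) u.1 (e j)).
Qed.

Lemma vdir_vdir k (V W : vector_field k F) a (g : 'rV[R]_p * Z -> R) O :
  (0 < k)%N -> open O -> O `<=` box (atlas a) -> CL_fun 2 O g -> forall u, O u ->
  vdir V a (vdir W a g) u = \sum_(i < p) vcomp V a u ord0 i *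
    \sum_(l < p) (partial i (fun u => vcomp W a u ord0 l) u * partial l g u +
                  vcomp W a u ord0 l * partial i (partial l g) u).
Proof.
move=> k0 oO Ob g2 u Ou; apply: eq_bigr => i _; congr (_ * _).
have dW l : derivable (fun y => vcomp W a (y, u.2) ord0 l) u.1 (e i).
  have := CL_fun_sub k0 (@subset_refl _ O) (vcomp_CL W l Ob).
  by move=> /CL_funS[_ /(_ i)[+ _]]; exact.
have dg l : derivable (fun y => partial l g (y, u.2)) u.1 (e i).
  move: g2 => /CL_funS[_ /(_ l)[_]] /CL_funS[_ /(_ i)[+ _]]; exact.
have D : is_derive u.1 (e i)
   (\sum_(l < p) (fun y => vcomp W a (y, u.2) ord0 l) * (fun y => partial l g (y, u.2)))
   (\sum_(l < p) (partial i (fun u => vcomp W a u ord0 l) u * partial l g u +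
                  vcomp W a u ord0 l * partial i (partial l g) u)).
  apply: is_derive_sum => l.
  apply: is_derive_eq (is_deriveM (derivableP (dW l)) (derivableP (dg l))) _.
  by rewrite /= -surjective_pairing addrC mulrC.
have [_ <-] := D; rewrite /partial; congr ('D_(_) _ _).
by apply/funext => y; rewrite fct_sumE.
Qed.

End vdir.

Section cutoffs.
Context {R : realType} {p : nat} {M Z : metricType R} (F : foliation p M Z).
Implicit Types (P : piece F) (u : 'rV[R]_p * Z).

(** A C^3 substitute for the distance to the centre in the sup norm, which is not smooth: it is 0
    within two radii and at least 1 once some coordinate is three radii away. *)
Definition excess P (y : 'rV[R]_p) : R :=
  \sum_(i < p) (pos_pow 4 ((y ord0 i - pcy P ord0 i) / pry P - 2) +
                pos_pow 4 ((pcy P ord0 i - y ord0 i) / pry P - 2)).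

(** Transversally only continuity is required, so a piecewise linear profile of the distance is
    enough: 1 up to two radii, 0 beyond three. *)
Definition tent P (z : Z) : R := Num.min 1 (Num.max 0 (3 - mdist (pcz P) z / prz P)).

Definition cutoff P u : R := pos_pow 4 (1 - excess P u.1) * tent P u.2.

Definition plateau P : set ('rV[R]_p * Z) :=
  [set y | `|y - pcy P| < 2 * pry P] `*` [set z | mdist (pcz P) z < 2 * prz P].

Lemma pos_pow_ge0 n (t : R) : 0 <= pos_pow n t.
Proof. by rewrite exprn_ge0// le_max lexx orbT. Qed.

Lemma excess_term P (c d y : R) : 0 < d -> `|y - c| <= 2 * d ->
  pos_pow 4 ((y - c) / d - 2) + pos_pow 4 ((c - y) / d - 2) = 0.
Proof.
rewrite ler_norml => d0 /andP[h1 h2].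
by rewrite /pos_pow !max_r ?expr0n ?addr0// subr_le0 ler_pdivrMr//; lra.
Qed.

Lemma cutoff1 P u : plateau P u -> cutoff P u = 1.
Proof.
move=> [/= yr zr]; rewrite /cutoff.
have -> : excess P u.1 = 0.
  apply: big1 => i _; apply: excess_term => //; first exact: pry_gt0.
  have := le_coord_norm (u.1 - pcy P) i; rewrite !mxE => /le_trans; apply.
  exact: ltW.
have -> : tent P u.2 = 1.
  apply/min_idPl; rewrite le_max; apply/orP; right.
  by rewrite lerBrDr -lerBrDl ler_pdivrMr ?prz_gt0//; move: zr; lra.
by rewrite subr0 /pos_pow max_l ?ler01// expr1n mulr1.
Qed.

Lemma excess_ge1 P (y : 'rV[R]_p) (i : 'I_p) : 3 * pry P <= `|y ord0 i - pcy P ord0 i| ->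
  1 <= excess P y.
Proof.
move=> h; rewrite /excess (bigD1 i)//=; apply: ler_wpDr.
  by apply: sumr_ge0 => j _; rewrite addr_ge0 ?pos_pow_ge0.
have r0 := pry_gt0 P.
have big t : 3 * pry P <= t -> 1 <= pos_pow 4 (t / pry P - 2).
  move=> tr; have t1 : 1 <= t / pry P - 2.
    by rewrite lerBrDr ler_pdivlMr//; move: tr; lra.
  by rewrite /pos_pow max_l ?exprn_ege1// (le_trans _ t1).
case: (leP 0 (y ord0 i - pcy P ord0 i)) => s0.
  by rewrite ger0_norm// in h; rewrite ler_wpDr ?pos_pow_ge0// big.
by rewrite ltr0_norm// opprB in h; rewrite ler_wpDl ?pos_pow_ge0// big.
Qed.

Lemma cutoff0 P u : ~ piece_box P 3 u -> cutoff P u = 0.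
Proof.
rewrite /piece_box => /not_andP[] /= /negP; rewrite -ltNge => h; last first.
  rewrite /cutoff [tent _ _](_ : _ = 0) ?mulr0// /tent max_l.
    by rewrite min_r.
  by rewrite subr_le0 ler_pdivlMr ?prz_gt0// ltW.
have [i hi] : exists i : 'I_p, 3 * pry P < `|u.1 ord0 i - pcy P ord0 i|.
  apply: contrapT => /forallNP hn; move: h; apply/negP; rewrite -leNgt.
  apply: le_norm_coord => [|i]; first by rewrite mulr_ge0// ltW// pry_gt0.
  by rewrite !mxE leNgt; apply/negP; exact: hn.
rewrite /cutoff /pos_pow max_r ?expr0n ?mul0r// subr_le0.
exact: (excess_ge1 (ltW hi)).
Qed.

Lemma cutoff_CL P (O : set ('rV[R]_p * Z)) : open O -> CL_fun 3 O (cutoff P).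
Proof.
move=> oO; have cst c : CL_fun 3 O (fun=> c : R) by exact: CL_fun_cst.
have y i : CL_fun 3 O (fun u => u.1 ord0 i).
  by apply: CL_fun_coord => //; exact: CL_fun_fst.
have ex : CL_fun 3 O (fun u => excess P u.1).
  rewrite /excess; apply: (CL_fun_sum oO) => i; apply: (CL_fun_add oO).
    apply: (CL_fun_pos_pow oO) => //; apply: (CL_fun_add oO) => //.
    by apply: (CL_fun_mul oO) => //; apply: (CL_fun_add oO).
  apply: (CL_fun_pos_pow oO) => //; apply: (CL_fun_add oO) => //.
  apply: (CL_fun_mul oO) => //; apply: (CL_fun_add oO) => //.
  apply: (CL_fun_eq oO _ (CL_fun_mul oO (cst (-1)) (y i))) => u _.
  by rewrite mulN1r.
apply: (CL_fun_mul oO).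
  have e1 := CL_fun_add oO (cst 1) (CL_fun_mul oO (cst (-1)) ex).
  apply: (CL_fun_eq oO _ (CL_fun_pos_pow oO (leqnn 3) e1)) => u _.
  by rewrite mulN1r.
apply: CL_fun_snd => u _.
have c3 : {for u.2, continuous (fun z => 3 - mdist (pcz P) z / prz P)}.
  apply: cvgB; first exact: cvg_cst.
  by apply: cvgM; [exact: mdist_continuous|exact: cvg_cst].
rewrite /tent; apply: (@continuous_min _ _ (fun=> 1) (fun z => Num.max 0 (3 - mdist (pcz P) z / prz P))).
  exact: cst_continuous.
by apply: (@continuous_max _ _ (fun=> 0)) => //; exact: cst_continuous.
Qed.

Lemma plateau_open P : open (plateau P).
Proof.
rewrite openE => -[y z] [/= yr zr].
exists ([set y | `|y - pcy P| < 2 * pry P], [set z | mdist (pcz P) z < 2 * prz P]) => //=.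
split.
  exact: (@norm_dist_continuous R 'rV[R]_p (pcy P) y _ (lt_nbhsl yr)).
exact: (@mdist_continuous R Z (pcz P) z _ (lt_nbhsl zr)).
Qed.

Lemma plateau_sub P : plateau P `<=` box (atlas (pidx P)).
Proof.
apply: subset_trans (@piece_box_sub _ _ _ _ _ P 2 _); last by rewrite ler_nat.
by move=> u [/ltW h1 /ltW h2].
Qed.

Lemma core_plateau P : piece_box P 1 `<=` plateau P.
Proof.
move=> u [h1 h2]; split; [apply: (le_lt_trans h1)|apply: (le_lt_trans h2)].
  by rewrite ltr_pM2r ?pry_gt0// ltr1n.
by rewrite ltr_pM2r ?prz_gt0// ltr1n.
Qed.

(** The equation is tested against functions on all of [M]; this makes such a function out of an
    expression in coordinates, without altering it over the plateau. *)
Definition localize P (g : 'rV[R]_p * Z -> R) : M -> R :=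
  chart_extension (pidx P) (fun u => cutoff P u * g u).

Lemma localize_leafwise P (g : 'rV[R]_p * Z -> R) : CL_fun 3 (box (atlas (pidx P))) g ->
  leafwise_function F 3 (localize P g).
Proof.
move=> g3; apply: (chart_extension_leafwise (@hull_closed _ _ _ _ _ P) (@hull_dom _ _ _ _ _ P)).
  have oB := @box_open _ _ _ _ F (pidx P).
  exact: (CL_fun_mul oB (cutoff_CL P oB) g3).
move=> m am nK; rewrite cutoff0 ?mul0r// => cm; apply: nK.
by exists (coord (atlas (pidx P)) m) => //; exact: coordK.
Qed.

Lemma localizeE P g u : plateau P u -> localize P g (param (atlas (pidx P)) u) = g u.
Proof.
by move=> Pu; rewrite /localize chart_extensionE ?cutoff1 ?mul1r//; exact: plateau_sub.
Qed.

End cutoffs.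

(** * The second-order expansion in a chart *)

Lemma powR0E {R : realType} (b : R) : 0 `^ b = (b == 0)%:R.
Proof. by rewrite /powR eqxx. Qed.

Section order_of_magnitude.
Context {R : realType} {I : Type} (S : set I) (tau : I -> R) (T0 : R).
Hypothesis tau_ge0 : forall c, S c -> 0 <= tau c.
Hypothesis tau_le : forall c, S c -> tau c <= T0.

(** At [tau c = 0] the power is 0 for b different from 0, and 1 for b = 0. So a nonzero order forces
    [f] to vanish on degenerate intervals, and the rules below treat this case apart. *)
Definition bigO (b : R) (f : I -> R) :=
  exists C : R, forall c, S c -> `|f c| <= C * tau c `^ b.

Lemma eq_bigO b f g : (forall c, S c -> f c = g c) -> bigO b f -> bigO b g.
Proof. by move=> fg [C Cf]; exists C => c Sc; rewrite -fg// Cf. Qed.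

Lemma bigO_add b f g : bigO b f -> bigO b g -> bigO b (fun c => f c + g c).
Proof.
move=> [C Cf] [D Dg]; exists (C + D) => c Sc.
by rewrite mulrDl (le_trans (ler_normD _ _))// lerD ?Cf ?Dg.
Qed.

Lemma bigO_opp b f : bigO b f -> bigO b (fun c => - f c).
Proof. by move=> [C Cf]; exists C => c Sc; rewrite normrN Cf. Qed.

Lemma bigO_sub b f g : bigO b f -> bigO b g -> bigO b (fun c => f c - g c).
Proof. by move=> hf /bigO_opp; exact: bigO_add. Qed.

Lemma bigO_mul b b' f g : 0 <= b -> 0 <= b' ->
  bigO b f -> bigO b' g -> bigO (b + b') (fun c => f c * g c).
Proof.
move=> b0 b'0 [C Cf] [D Dg]; exists (C * D) => c Sc.
have -> : tau c `^ (b + b') = tau c `^ b * tau c `^ b'.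
  have [t0|t0] := eqVneq (tau c) 0; last by rewrite powRD// t0 implybT.
  by rewrite t0 !powR0E paddr_eq0// -natrM mulnb.
rewrite normrM mulrACA ler_pM//; [exact: Cf|exact: Dg].
Qed.

Lemma bigO_cst (k : R) : bigO 0 (fun=> k).
Proof. by exists `|k| => c Sc; rewrite powRr0 mulr1. Qed.

Lemma bigO_le b b' f : 0 <= b' -> b' <= b -> bigO b f -> bigO b' f.
Proof.
move=> b'0 bb' [C Cf]; exists (`|C| * `|T0| `^ (b - b')) => c Sc.
apply: le_trans (Cf c Sc) _.
have t0 := tau_ge0 Sc; have tT : tau c <= `|T0| by rewrite (le_trans (tau_le Sc))// ler_norm.
have [tc0|tc0] := eqVneq (tau c) 0.
  rewrite tc0 !powR0E; have [b0|b0] := eqVneq b 0.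
    have b'E : b' = 0 by apply/eqP; rewrite eq_le b'0 -b0 bb'.
    by rewrite b'E b0 eqxx subr0 powRr0 !mulr1 ler_norm.
  by rewrite mulr0 mulr_ge0// mulr_ge0// powR_ge0.
have -> : tau c `^ b = tau c `^ (b - b') * tau c `^ b'.
  by rewrite -powRD ?subrK// tc0 implybT.
rewrite mulrA ler_wpM2r ?powR_ge0//.
apply: (le_trans (ler_wpM2r (powR_ge0 _ _) (ler_norm C))).
by rewrite ler_wpM2l// ge0_ler_powR ?nnegrE// subr_ge0.
Qed.

Lemma bigO_sum b n (f : 'I_n -> I -> R) :
  (forall j, bigO b (f j)) -> bigO b (fun c => \sum_(j < n) f j c).
Proof.
move=> /choice[C Cf]; exists (\sum_(j < n) C j) => c Sc.
by rewrite mulr_suml (le_trans (ler_norm_sum _ _ _))// ler_sum// => j _; exact: Cf.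
Qed.

Lemma bigO_coef b f g : 0 <= b -> bigO 0 f -> bigO b g -> bigO b (fun c => f c * g c).
Proof. by move=> b0 f0 gb; have := bigO_mul (lexx 0) b0 f0 gb; rewrite add0r. Qed.

End order_of_magnitude.

(** The algebra behind the chain rule without Itô correction. Here [h1] and [H] stand for gradient
    and Hessian of a test function, [b] and [b0] for the components of the fields, and [db k i l]
    for the l-th derivative of the i-th component of the k-th field. The left side is the Taylor
    polynomial with Davie's increment inserted, of which only the first-level part is kept in the
    quadratic term; the right side is the expansion demanded by the equation. *)
Lemma ito_identity {R : realType} (p d : nat) (h1 : 'I_p -> R) (H : 'I_p -> 'I_p -> R)
    (b : 'I_d -> 'I_p -> R) (db : 'I_d -> 'I_p -> 'I_p -> R) (b0 : 'I_p -> R)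
    (w1 : 'I_d -> R) (w2 : 'I_d -> 'I_d -> R) (t : R) :
  (forall i l, H i l = H l i) ->
  (forall j k, w2 j k + w2 k j = w1 j * w1 k) ->
  \sum_(i < p) h1 i * (\sum_(j < d) b j i * w1 j +
     \sum_(j < d) \sum_(k < d) (\sum_(l < p) b j l * db k i l) * w2 j k + b0 i * t)
  + 2^-1 * \sum_(i < p) \sum_(l < p) H i l *
      ((\sum_(j < d) b j i * w1 j) * (\sum_(k < d) b k l * w1 k))
  = \sum_(j < d) (\sum_(i < p) b j i * h1 i) * w1 j
  + \sum_(j < d) \sum_(k < d) (\sum_(i < p) b j i *
       \sum_(l < p) (db k l i * h1 l + b k l * H l i)) * w2 j k
  + (\sum_(i < p) b0 i * h1 i) * t.
Proof.
move=> Hs ws.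
have E1 : \sum_(i < p) h1 i * (\sum_(j < d) b j i * w1 j) =
    \sum_(j < d) (\sum_(i < p) b j i * h1 i) * w1 j.
  under eq_bigr do rewrite mulr_sumr; rewrite exchange_big/=.
  apply: eq_bigr => j _; rewrite mulr_suml; apply: eq_bigr => i _; ring.
have E0 : \sum_(i < p) h1 i * (b0 i * t) = (\sum_(i < p) b0 i * h1 i) * t.
  by rewrite mulr_suml; apply: eq_bigr => i _; ring.
have E2 : \sum_(i < p) h1 i * (\sum_(j < d) \sum_(k < d) (\sum_(l < p) b j l * db k i l) * w2 j k) =
   \sum_(j < d) \sum_(k < d) (\sum_(i < p) b j i * \sum_(l < p) (db k l i * h1 l)) * w2 j k.
  under eq_bigr do rewrite mulr_sumr; rewrite exchange_big/=; apply: eq_bigr => j _.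
  under eq_bigr do rewrite mulr_sumr; rewrite exchange_big/=; apply: eq_bigr => k _.
  under eq_bigr do rewrite mulrA; rewrite -mulr_suml; congr (_ * _).
  under eq_bigr do rewrite mulr_sumr; rewrite exchange_big/=; apply: eq_bigr => i _.
  by rewrite mulr_sumr; apply: eq_bigr => l _; ring.
(* [Q] is symmetric by symmetry of the Hessian, so it sees only the symmetric part of [w2], which is
   half of the product of the first levels. *)
pose Q j k := \sum_(i < p) \sum_(l < p) b j i * (b k l * H l i).
have Qs j k : Q j k = Q k j.
  rewrite /Q exchange_big/=; apply: eq_bigr => i _; apply: eq_bigr => l _.
  by rewrite (Hs l); ring.
have E3 : \sum_(i < p) \sum_(l < p) H i l *
      ((\sum_(j < d) b j i * w1 j) * (\sum_(k < d) b k l * w1 k)) =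
    \sum_(j < d) \sum_(k < d) Q j k * (w1 j * w1 k).
  transitivity (\sum_(i < p) \sum_(l < p) \sum_(j < d) \sum_(k < d)
      (b j i * (b k l * H l i)) * (w1 j * w1 k)).
    apply: eq_bigr => i _; apply: eq_bigr => l _.
    rewrite mulr_suml mulr_sumr; apply: eq_bigr => j _.
    rewrite mulr_sumr mulr_sumr; apply: eq_bigr => k _; rewrite (Hs i); ring.
  under eq_bigr do rewrite exchange_big/=; rewrite exchange_big/=; apply: eq_bigr => j _.
  under eq_bigr do rewrite exchange_big/=; rewrite exchange_big/=; apply: eq_bigr => k _.
  by rewrite /Q mulr_suml; apply: eq_bigr => i _; rewrite mulr_suml.
have E4 : 2^-1 * (\sum_(j < d) \sum_(k < d) Q j k * (w1 j * w1 k)) =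
    \sum_(j < d) \sum_(k < d) Q j k * w2 j k.
  have : \sum_(j < d) \sum_(k < d) Q j k * (w1 j * w1 k) =
    \sum_(j < d) \sum_(k < d) Q j k * w2 j k + \sum_(j < d) \sum_(k < d) Q j k * w2 j k.
    rewrite [X in _ = _ + X]exchange_big/= -big_split/=; apply: eq_bigr => j _.
    rewrite -big_split/=; apply: eq_bigr => k _; rewrite -ws (Qs k j); ring.
  by move=> ->; field.
under eq_bigr do rewrite !mulrDr; rewrite !big_split/= E0 E1 E2 E3 E4.
rewrite -!addrA; congr (_ + _); rewrite [in LHS](addrC (_ * t)) addrA; congr (_ + _).
rewrite -big_split/=; apply: eq_bigr => j _; rewrite -big_split/=; apply: eq_bigr => k _.
rewrite -mulrDl; congr (_ * _); rewrite /Q -big_split/=; apply: eq_bigr => i _.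
rewrite -mulr_sumr -mulrDr; congr (_ * _).
by rewrite big_split.
Qed.

Section ito_formula.
Context {R : realType} {p : nat} {M Z : metricType R} (F : foliation p M Z).
Context {d : nat} (V : 'I_d.+1 -> vector_field 3 F) (P : piece F).
Local Notation e i := (delta_mx ord0 i : 'rV[R]_p).
Local Notation a := (pidx P).
Local Notation W j := (V (lift ord0 j)).

(* The leading terms of Davie's expansion of the [i]-th coordinate of a solution. *)
Definition coord_drift (u : 'rV[R]_p * Z) (w1 : 'rV[R]_d) (w2 : 'M[R]_d) (t : R) (i : 'I_p) : R :=
  \sum_(j < d) vcomp (W j) a u ord0 i * w1 ord0 j +
  \sum_(j < d) \sum_(k < d) vdir (W j) a (fun u => vcomp (W k) a u ord0 i) u * w2 j k +
  vcomp (V ord0) a u ord0 i * t.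

Lemma piece_box1_sub : piece_box P 1 `<=` box (atlas a).
Proof. by apply: piece_box_sub; rewrite ler1n. Qed.

Lemma bounded_on_piece (g : 'rV[R]_p * Z -> R) : CL_fun 0 (box (atlas a)) g ->
  exists B : R, forall u, piece_box P 1 u -> `|g u| <= B.
Proof.
move=> /CL_fun0 cg.
have cpt : compact (g @` piece_box P 1).
  apply: continuous_compact; last by apply: piece_box_compact; rewrite ler1n.
  by apply: continuous_in_subspaceT => u /set_mem/piece_box1_sub; exact: cg.
have [B [_ HB]] := compact_bounded cpt.
exists (B + 1) => u Pu; apply: (HB (B + 1)); first by rewrite ltrDl.
by exists u.
Qed.

(** A ball of the sup norm is itself a coordinate box, so it contains the box spanned by any two of
    its points; intermediate points of Taylor's formula therefore remain over the core. *)
Lemma in_box_piece (u v : 'rV[R]_p * Z) (x : 'rV[R]_p) : u.2 = v.2 ->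
  piece_box P 1 u -> piece_box P 1 v -> in_box u.1 v.1 x -> piece_box P 1 (x, u.2).
Proof.
move=> uv [/= yu zu] [/= yv zv] xb; split => //=.
apply: le_norm_coord => [|k]; first by rewrite mul1r ltW// pry_gt0.
have := le_coord_norm (u.1 - pcy P) k; have := le_coord_norm (v.1 - pcy P) k.
rewrite !mxE => /le_trans/(_ yv) + /le_trans/(_ yu); rewrite !ler_norml.
move: (xb k); case: (leP (u.1 ord0 k) (v.1 ord0 k)); rewrite ?min_l ?max_r//; lra.
Qed.

Lemma taylor_piece (h : 'rV[R]_p * Z -> R) : CL_fun 3 (box (atlas a)) h ->
  exists B : R, forall u v, u.2 = v.2 -> piece_box P 1 u -> piece_box P 1 v ->
  `|h v - h u - \sum_(k < p) (v.1 ord0 k - u.1 ord0 k) * partial k h u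
     - 2^-1 * \sum_(k < p) \sum_(l < p)
         (v.1 ord0 k - u.1 ord0 k) * (v.1 ord0 l - u.1 ord0 l) *
         partial l (partial k h) u|
  <= B * `|v.1 - u.1| ^+ 3.
Proof.
move=> h3; have oB := @box_open _ _ _ _ F a.
have h1 k : CL_fun 2 (box (atlas a)) (partial k h).
  by move: h3 => /CL_funS[_ /(_ k)[]].
have h2 k l : CL_fun 1 (box (atlas a)) (partial l (partial k h)).
  by move: (h1 k) => /CL_funS[_ /(_ l)[]].
have h3' k l m : CL_fun 0 (box (atlas a)) (partial m (partial l (partial k h))).
  by move: (h2 k l) => /CL_funS[_ /(_ m)[]].
have /choice[B BP] : forall klm : 'I_p * 'I_p * 'I_p, exists B : R, forall u,
    piece_box P 1 u -> `|partial klm.2 (partial klm.1.2 (partial klm.1.1 h)) u| <= B.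
  by move=> klm; apply: bounded_on_piece; exact: h3'.
pose B' := \sum_klm `|B klm|.
have B'P k l m u : piece_box P 1 u -> `|partial m (partial l (partial k h)) u| <= B'.
  move=> Pu; rewrite /B' (bigD1 (k, l, m))//=.
  apply: (le_trans (BP (k, l, m) u Pu)); rewrite (le_trans (ler_norm _))// lerDl.
  exact: sumr_ge0.
exists (p%:R ^+ 3 * B') => -[y z] [y' z'] /= zz Pu; rewrite -{}zz => Pv.
have pz x : in_box y y' x -> piece_box P 1 (x, z).
  exact: (@in_box_piece (y, z) (y', z)).
have bx x : in_box y y' x -> box (atlas a) (x, z).
  by move=> /pz; exact: piece_box1_sub.
apply: (@taylor3 R p (fun x => h (x, z)) y y' B').
- move=> x /bx bxu; apply: filterS (near_slice oB bxu) => y1 by_ k.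
  by move: h3 => /CL_funS[_ /(_ k)[/(_ _ by_)]].
- move=> x /bx bxu k; have /CL_fun0 c := CL_fun_sub (leq0n _) (@subset_refl _ _) (h1 k).
  exact: (slice_continuous (c _ bxu)).
- move=> x /bx bxu k l; by move: (h1 k) => /CL_funS[_ /(_ l)[/(_ _ bxu)]].
- move=> x /bx bxu k l m; by move: (h2 k l) => /CL_funS[_ /(_ m)[/(_ _ bxu)]].
- move=> x /pz xb k l m; exact: (B'P k l m (x, z)).
Qed.

Lemma partial_sym (h : 'rV[R]_p * Z -> R) k l u : CL_fun 2 (box (atlas a)) h ->
  box (atlas a) u -> partial l (partial k h) u = partial k (partial l h) u.
Proof.
move=> h2 bu; have oB := @box_open _ _ _ _ F a.
have h1 i : CL_fun 1 (box (atlas a)) (partial i h).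
  by move: h2 => /CL_funS[_ /(_ i)[]].
have h0 i j : CL_fun 0 (box (atlas a)) (partial j (partial i h)).
  by move: (h1 i) => /CL_funS[_ /(_ j)[]].
apply: (@schwarz R p (fun y => h (y, u.2)) u.1 k l).
- apply: filterS (near_slice oB bu) => y by_ j.
  by move: h2 => /CL_funS[_ /(_ j)[/(_ _ by_)]].
- apply: filterS (near_slice oB bu) => y by_ i j.
  by move: (h1 i) => /CL_funS[_ /(_ j)[/(_ _ by_)]].
- move=> i j; move: (h0 i j) => /CL_fun0 c; exact: (slice_continuous (c _ bu)).
Qed.

End ito_formula.

Section ito_on_piece.
Context {R : realType} {p : nat} {M Z : metricType R} (F : foliation p M Z).
Context {d : nat} (V : 'I_d.+1 -> vector_field 3 F) (P : piece F).
Local Notation a := (pidx P).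
Local Notation W j := (V (lift ord0 j)).
Variables (alpha : R) (I : Type) (S : set I) (tau : I -> R) (T0 : R).
Variables (u v : I -> 'rV[R]_p * Z) (w1 : I -> 'rV[R]_d) (w2 : I -> 'M[R]_d).
Hypothesis alpha_gt : 1 / 3 < alpha.
Hypothesis alpha_lt : alpha < 1 / 2.
Hypothesis tau_ge0 : forall c, S c -> 0 <= tau c.
Hypothesis tau_le : forall c, S c -> tau c <= T0.
Hypothesis Su : forall c, S c -> piece_box P 1 (u c).
Hypothesis Sv : forall c, S c -> piece_box P 1 (v c).
Hypothesis Suv : forall c, S c -> (u c).2 = (v c).2.
Hypothesis w1O : forall j, bigO S tau alpha (fun c => w1 c ord0 j).
Hypothesis w2O : forall j k, bigO S tau (2 * alpha) (fun c => w2 c j k).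
Hypothesis w12 : forall c, S c -> forall j k,
  w2 c j k + w2 c k j = w1 c ord0 j * w1 c ord0 k.
Hypothesis dyO : bigO S tau alpha (fun c => `|(v c).1 - (u c).1|).
Hypothesis davie : forall i, bigO S tau (3 * alpha) (fun c =>
  (v c).1 ord0 i - (u c).1 ord0 i -
  coord_drift V P (u c) (w1 c) (w2 c) (tau c) i).

Let a0 : 0 <= alpha. Proof. by move: alpha_gt; lra. Qed.

Let O_le b b' f : 0 <= b' -> b' <= b -> bigO S tau b f -> bigO S tau b' f.
Proof. by move=> h1 h2; exact: (bigO_le tau_ge0 tau_le h1 h2). Qed.

Let coefO (g : 'rV[R]_p * Z -> R) : CL_fun 0 (box (atlas a)) g ->
  bigO S tau 0 (fun c => g (u c)).
Proof.
move=> /bounded_on_piece[B BP]; exists B => c Sc.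
by rewrite powRr0 mulr1; apply: BP; exact: Su.
Qed.

Let tauO b : 0 <= b -> b <= 1 -> bigO S tau b tau.
Proof.
move=> b0 b1; apply: (O_le b0 b1); exists 1 => c Sc.
by rewrite powRr1 ?ger0_norm ?tau_ge0// mul1r.
Qed.

Let vcompO k (X : vector_field k F) i : bigO S tau 0 (fun c => vcomp X a (u c) ord0 i).
Proof.
apply: (coefO (g := fun u => vcomp X a u ord0 i)).
exact: (CL_fun_sub (leq0n _) (@subset_refl _ _) (vcomp_CL X i (@subset_refl _ _))).
Qed.

Let dcoefO j k i : bigO S tau 0
  (fun c => vdir (W j) a (fun u => vcomp (W k) a u ord0 i) (u c)).
Proof.
apply: (coefO (g := vdir (W j) a (fun u => vcomp (W k) a u ord0 i))).
apply: (@vdir_CL _ _ _ _ _ 3 0) => //; first exact: box_open.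
exact: (CL_fun_sub (isT : (1 <= 3)%N) (@subset_refl _ _) (vcomp_CL (W k) i (@subset_refl _ _))).
Qed.

Let dyiO i : bigO S tau alpha (fun c => (v c).1 ord0 i - (u c).1 ord0 i).
Proof.
have [C CP] := dyO; exists C => c Sc; apply: le_trans (CP c Sc).
have := le_coord_norm ((v c).1 - (u c).1) i; rewrite !mxE normr_id.
exact.
Qed.

Let B i c := \sum_(j < d) vcomp (W j) a (u c) ord0 i * w1 c ord0 j.

Let BO i : bigO S tau alpha (B i).
Proof. by apply: bigO_sum => j; apply: bigO_coef. Qed.

(** Beyond [B], the terms of [coord_drift] have order 2 alpha; for the time drift this uses 2 alpha
    <= 1. *)
Let dyBO i : bigO S tau (2 * alpha) (fun c => (v c).1 ord0 i - (u c).1 ord0 i - B i c).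
Proof.
have a20 : 0 <= 2 * alpha by rewrite mulr_ge0.
have H1 : bigO S tau (2 * alpha) (fun c => \sum_(j < d) \sum_(k < d)
    vdir (W j) a (fun u => vcomp (W k) a u ord0 i) (u c) * w2 c j k).
  by apply: bigO_sum => j; apply: bigO_sum => k; apply: bigO_coef.
have H2 : bigO S tau (2 * alpha) (fun c => vcomp (V ord0) a (u c) ord0 i * tau c).
  by apply: bigO_coef => //; apply: tauO => //; move: alpha_lt; lra.
have H3 : bigO S tau (2 * alpha) (fun c =>
  (v c).1 ord0 i - (u c).1 ord0 i - coord_drift V P (u c) (w1 c) (w2 c) (tau c) i).
  by apply: O_le (davie i) => //; move: a0; lra.
apply: eq_bigO (bigO_add H3 (bigO_add H1 H2)) => c _.
rewrite /coord_drift /B; ring.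
Qed.

(** Three errors of order 3 alpha add up: the cubic Taylor remainder [T1], Davie's remainder
    inserted in the linear term ([T2]), and the replacement of increments by [B] in the quadratic
    term ([T3]), where a factor of order 2 alpha meets one of order alpha. What is left cancels by
    [ito_identity]. *)
Lemma ito_on_piece (f : M -> R) : leafwise_function F 3 f ->
  bigO S tau (3 * alpha) (fun c =>
    f (param (atlas a) (v c)) - f (param (atlas a) (u c))
    - \sum_(j < d) vf_apply (W j) f (param (atlas a) (u c)) * w1 c ord0 j
    - \sum_(j < d) \sum_(k < d)
        vf_apply (W j) (vf_apply (W k) f) (param (atlas a) (u c)) * w2 c j k
    - vf_apply (V ord0) f (param (atlas a) (u c)) * tau c).
Proof.
move=> f3; set h := f \o param (atlas a); have h3 : CL_fun 3 (box (atlas a)) h by exact: f3.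
have oB := @box_open _ _ _ _ F a.
have bu c : S c -> box (atlas a) (u c) by move=> Sc; apply: piece_box1_sub; exact: Su.
have h1 : CL_fun 1 (box (atlas a)) h := CL_fun_sub (isT : (1 <= 3)%N) (@subset_refl _ _) h3.
have h2 : CL_fun 2 (box (atlas a)) h := CL_fun_sub (isT : (2 <= 3)%N) (@subset_refl _ _) h3.
have p1 k : CL_fun 1 (box (atlas a)) (partial k h).
  by move: h2 => /CL_funS[_ /(_ k)[]].
have p10 k : CL_fun 0 (box (atlas a)) (partial k h).
  exact: (CL_fun_sub (leq0n _) (@subset_refl _ _) (p1 k)).
have p2 k l : CL_fun 0 (box (atlas a)) (partial l (partial k h)).
  by move: (p1 k) => /CL_funS[_ /(_ l)[]].
have a30 : 0 <= 3 * alpha by rewrite mulr_ge0.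
have a20 : 0 <= 2 * alpha by rewrite mulr_ge0.
pose dy i c := (v c).1 ord0 i - (u c).1 ord0 i.
have T1 : bigO S tau (3 * alpha) (fun c => h (v c) - h (u c)
     - \sum_(k < p) dy k c * partial k h (u c)
     - 2^-1 * \sum_(k < p) \sum_(l < p) dy k c * dy l c * partial l (partial k h) (u c)).
  have [B0 B0P] := taylor_piece h3; have [C CP] := dyO.
  exists (`|B0| * C ^+ 3) => c Sc.
  apply: le_trans (B0P _ _ (Suv Sc) (Su Sc) (Sv Sc)) _.
  apply: (le_trans (ler_wpM2r (exprn_ge0 _ (normr_ge0 _)) (ler_norm B0))).
  rewrite -mulrA ler_wpM2l//.
  have -> : C ^+ 3 * tau c `^ (3 * alpha) = (C * tau c `^ alpha) ^+ 3.
    by rewrite exprMn mulrC (mulrC 3) powRrM powR_mulrn ?powR_ge0// mulrC.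
  have q := CP c Sc; rewrite normr_id in q.
  by rewrite lerXn2r ?nnegrE// (le_trans _ q).
have T2 : bigO S tau (3 * alpha) (fun c => \sum_(i < p) partial i h (u c) *
    (dy i c - coord_drift V P (u c) (w1 c) (w2 c) (tau c) i)).
  by apply: bigO_sum => i; apply: bigO_coef; [exact: a30|exact: (coefO (p10 i))|exact: davie].
have T3 : bigO S tau (3 * alpha) (fun c => 2^-1 * \sum_(k < p) \sum_(l < p)
    partial l (partial k h) (u c) * (dy k c * dy l c - B k c * B l c)).
  apply: bigO_coef => //; first exact: bigO_cst.
  apply: bigO_sum => k; apply: bigO_sum => l; apply: bigO_coef => //; first exact: (coefO (p2 k l)).
  have E : 3 * alpha = 2 * alpha + alpha by ring.
  have D1 : bigO S tau (3 * alpha) (fun c => (dy k c - B k c) * dy l c).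
    by rewrite E; apply: bigO_mul; [exact: a20|exact: a0|exact: (dyBO k)|exact: (dyiO l)].
  have D2 : bigO S tau (3 * alpha) (fun c => (dy l c - B l c) * B k c).
    by rewrite E; apply: bigO_mul; [exact: a20|exact: a0|exact: (dyBO l)|exact: (BO k)].
  by apply: eq_bigO (bigO_add D1 D2) => c _; ring.
apply: eq_bigO (bigO_add T1 (bigO_add T2 T3)) => c Sc.
rewrite -[f (param _ (v c))]/(h (v c)) -[f (param _ (u c))]/(h (u c)).
have G1 X : vf_apply X f (param (atlas a) (u c)) = vdir X a h (u c).
  exact: (vf_apply_vdir X oB (@subset_refl _ _) (fun _ _ => erefl) h1 (bu c Sc)).
rewrite G1.
have -> : \sum_(j < d) vf_apply (W j) f (param (atlas a) (u c)) * w1 c ord0 j =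
    \sum_(j < d) vdir (W j) a h (u c) * w1 c ord0 j.
  by apply: eq_bigr => j _; rewrite G1.
have -> : \sum_(j < d) \sum_(k < d)
     vf_apply (W j) (vf_apply (W k) f) (param (atlas a) (u c)) * w2 c j k =
   \sum_(j < d) \sum_(k < d) (\sum_(i < p) vcomp (W j) a (u c) ord0 i *
    \sum_(l < p) (partial i (fun u => vcomp (W k) a u ord0 l) (u c) * partial l h (u c) +
                  vcomp (W k) a (u c) ord0 l * partial i (partial l h) (u c))) * w2 c j k.
  apply: eq_bigr => j _; apply: eq_bigr => k _; congr (_ * _).
  rewrite (vf_apply_vdir2 (W j) (W k) (isT : (0 < 3)%N) oB (@subset_refl _ _)
    (fun _ _ => erefl) h2 (bu c Sc)).
  exact: (vdir_vdir (W j) (W k) (isT : (0 < 3)%N) oB (@subset_refl _ _) h2 (bu c Sc)).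
have E := @ito_identity R p d (fun i => partial i h (u c))
  (fun i l => partial l (partial i h) (u c))
  (fun j i => vcomp (W j) a (u c) ord0 i)
  (fun k i l => partial l (fun u => vcomp (W k) a u ord0 i) (u c))
  (fun i => vcomp (V ord0) a (u c) ord0 i) (fun j => w1 c ord0 j) (fun j k => w2 c j k)
  (tau c) (fun i l => partial_sym i l h2 (bu c Sc)) (w12 Sc).
have E2 : \sum_(i < p) partial i h (u c) *
    (dy i c - coord_drift V P (u c) (w1 c) (w2 c) (tau c) i) =
    \sum_(k < p) dy k c * partial k h (u c) -
    \sum_(i < p) partial i h (u c) * coord_drift V P (u c) (w1 c) (w2 c) (tau c) i.
  by rewrite -sumrB; apply: eq_bigr => i _; ring.
have E3 : \sum_(k < p) \sum_(l < p)
    partial l (partial k h) (u c) * (dy k c * dy l c - B k c * B l c) =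
    \sum_(k < p) \sum_(l < p) dy k c * dy l c * partial l (partial k h) (u c) -
    \sum_(k < p) \sum_(l < p) partial l (partial k h) (u c) * (B k c * B l c).
  rewrite -sumrB; apply: eq_bigr => i _; rewrite -sumrB; apply: eq_bigr => l _; ring.
rewrite E2 E3.
rewrite /vdir -/(B _ _) in E *.
move: E; rewrite /coord_drift /vdir.
set x1 := \sum_(i < p) partial i h (u c) * _; set x2 := \sum_(i < p) \sum_(l < p) _.
set y1 := \sum_(j < d) _ * _; set y2 := \sum_(j < d) \sum_(k < d) _; set y0 := _ * tau c.
move=> {}E; rewrite -!addrA; congr (_ + (_ + _)).
rewrite [RHS](_ : _ = - (y1 + y2 + y0)); last by ring.
by rewrite -E; ring.
Qed.

End ito_on_piece.

(** * Controlled paths *)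

Lemma ultra_fmap {X Y : Type} (f : X -> Y) (U : set_system X) :
  UltraFilter U -> UltraFilter (f @ U).
Proof.
move=> UU; split; first exact: fmap_proper_filter.
move=> G GG UG; apply/seteqP; split; last exact: UG.
move=> A GA; have [//|UA] := in_ultra_setVsetC (f @^-1` A) UU.
by have [y [Ay]] := filter_ex (filterI GA (UG (~` A) UA)).
Qed.

Section time_topology.
Context {R : realType} {T : {posnum R}}.
Implicit Types (s t : time T) (c : simplex T).

Lemma val_continuous {X : topologicalType} (A : set X) : continuous (\val : set_type A -> X).
Proof. exact: initial_continuous. Qed.

Lemma cvg_set_type {X : topologicalType} (A : set X) {J : Type} (G : set_system J)
    {FG : Filter G} (f : J -> set_type A) (x : set_type A) :
  \val (f j) @[j --> G] --> \val x -> f @ G --> x.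
Proof.
move=> h B [D [[Q oQ <-] Qx DB]]; apply: (filterS DB).
exact: (h _ (open_nbhs_nbhs (conj oQ Qx))).
Qed.

Lemma cvg_simplex {J : Type} (G : set_system J) {FG : Filter G} (f : J -> simplex T) c :
  \val (src (f j)) @[j --> G] --> \val (src c) ->
  \val (tgt (f j)) @[j --> G] --> \val (tgt c) -> f @ G --> c.
Proof.
move=> h1 h2; apply: cvg_set_type; rewrite [\val c]surjective_pairing.
have -> : (fun j => \val (f j)) = fun j => (src (f j), tgt (f j)).
  by apply/funext => j; rewrite -surjective_pairing.
have h1' : src (f j) @[j --> G] --> src c by exact: cvg_set_type.
have h2' : tgt (f j) @[j --> G] --> tgt c by exact: cvg_set_type.
exact: (cvg_pair h1' h2').
Qed.

Lemma time_ge0 t : 0 <= \val t.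
Proof. by have := set_valP t; rewrite /time_set/= in_itv/= => /andP[]. Qed.

Lemma time_le t : \val t <= T%:num.
Proof. by have := set_valP t; rewrite /time_set/= in_itv/= => /andP[]. Qed.

Lemma to_timeK (r : R) : 0 <= r <= T%:num -> \val (to_time T r) = r.
Proof. by move=> /andP[h1 h2]; rewrite /= (min_l h2) (max_r h1). Qed.

Lemma val_to_time t : to_time T (\val t) = t.
Proof. by apply: val_inj; rewrite to_timeK// time_ge0 time_le. Qed.

Definition mksimplex s t (st : \val s <= \val t) : simplex T :=
  SigSub (mem_set (st : simplex_set T (s, t))).

Lemma simplex_le c : \val (src c) <= \val (tgt c).
Proof. exact: (set_valP c). Qed.

Lemma len_ge0 c : 0 <= len c.
Proof. by rewrite subr_ge0 simplex_le. Qed.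

Lemma len_le c : len c <= T%:num.
Proof. by rewrite lerBlDr (le_trans (time_le _))// lerDl time_ge0. Qed.

Lemma time_compact : compact [set: time T].
Proof.
rewrite compact_ultra => U UU _.
have := @segment_compact R 0 T%:num; rewrite compact_ultra.
move=> /(_ ((\val : time T -> R) @ U) (ultra_fmap _ UU))[|r [rT Ur]].
  apply: (@filterS _ U _ setT); last exact: filterT.
  by move=> t _; exact: (set_valP t).
exists (to_time T r); split => //; apply: (@cvg_set_type _ _ _ U _ id).
have E : \val (to_time T r) = r by apply: to_timeK; move: rT; rewrite /= in_itv.
by move: Ur; rewrite -{1}E.
Qed.

End time_topology.

(** Bisecting an interval turns the constant C into C q with q = 2^(1-g) < 1, because two halves
    each contribute a factor 2^(-g). After k bisections the bound is C q^k, which tends to 0. *)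
Lemma superlinear_increments_cst {R : realType} (phi : R -> R) (a b C g : R) : 1 < g ->
  (forall u v, a <= u -> u <= v -> v <= b -> `|phi v - phi u| <= C * (v - u) `^ g) ->
  a <= b -> phi b = phi a.
Proof.
move=> g1 H ab; pose q : R := 2 * 2^-1 `^ g.
have q0 : 0 <= q by rewrite mulr_ge0// powR_ge0.
have q1 : q < 1.
  have : 2^-1 `^ g < 2^-1 :> R.
    have h : (0 : R) < 2^-1 by rewrite invr_gt0.
    rewrite -[ltRHS](powRr1 (ltW h)) /powR gt_eqF// ltr_expR ltr_nM2r// ln_lt0// h/=.
    by rewrite invf_lt1// ltr1n.
  by move=> h; rewrite /q -ltr_pdivlMl// mulr1.
have Hk k : forall u v, a <= u -> u <= v -> v <= b ->
    `|phi v - phi u| <= C * q ^+ k * (v - u) `^ g.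
  elim: k => [|k IH] u v au uv vb; first by rewrite expr0 mulr1; exact: H.
  pose m := (u + v) / 2.
  have um : u <= m by rewrite ler_pdivlMr//; lra.
  have mv : m <= v by rewrite ler_pdivrMr//; lra.
  have h1 := IH _ _ au um (le_trans mv vb).
  have h2 := IH _ _ (le_trans au um) mv vb.
  have E1 : (m - u) `^ g = 2^-1 `^ g * (v - u) `^ g.
    by rewrite -powRM ?subr_ge0//; congr (_ `^ _); rewrite /m; field.
  have E2 : (v - m) `^ g = 2^-1 `^ g * (v - u) `^ g.
    by rewrite -powRM ?subr_ge0//; congr (_ `^ _); rewrite /m; field.
  rewrite E1 in h1; rewrite E2 in h2.
  apply: (le_trans (ler_distD (phi m) _ _)); apply: (le_trans (lerD h2 h1)).
  by rewrite le_eqVlt; apply/orP; left; apply/eqP; rewrite exprSr /q; ring.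
apply/eqP; rewrite -subr_eq0 -normr_le0.
have : C * q ^+ k * (b - a) `^ g @[k --> \oo] --> C * 0 * (b - a) `^ g.
  apply: cvgMl; apply: cvgMr; apply: cvg_expr.
  by rewrite ger0_norm.
rewrite mulr0 mul0r => /cvgr_to_ge; apply.
by near=> k; exact: Hk.
Unshelve. all: end_near. Qed.

Section localization.
Context {R : realType} {T : {posnum R}}.

Lemma nbhs_time_ex (s : time T) (A : set (time T)) : nbhs s A ->
  exists2 e : R, 0 < e & forall t : time T, `|\val t - \val s| < e -> A t.
Proof.
move=> [D [[Q oQ <-] Qs DA]].
have /nbhs_ballP[e /= e0 eQ] := open_nbhs_nbhs (conj oQ Qs).
exists e => // t ts; apply: DA; apply: eQ.
by rewrite -ball_normE /= distrC.
Qed.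

(** Along such a filter every sequence in a compact space converges. Limits at all times of [0, T]
    are thus obtained at once, in place of extracting subsequences. *)
Lemma ultra_nat_exists : exists2 U : set_system nat, UltraFilter U & \oo `<=` U.
Proof. by have [U [UU H]] := ultraFilterLemma (@eventually_filter); exists U. Qed.

(** A Lebesgue number argument: intervals of vanishing length that fit in no [A k] would have left
    ends converging along an ultrafilter to some [s], and a neighbourhood of [s] inside one [A k]
    would contain one of these intervals. *)
Lemma uniform_localization (K : nat) (A : 'I_K -> set (time T)) :
  (forall s : time T, exists k, nbhs s (A k)) ->
  exists N : nat, forall c : simplex T, len c <= N.+1%:R^-1 ->
    exists k, forall u : time T, \val (src c) <= \val u <= \val (tgt c) -> A k u.
Proof.
move=> cov; apply: contrapT => /forallNP H.
have /choice[c cP] : forall N : nat, exists c : simplex T, len c <= N.+1%:R^-1 /\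
    forall k, ~ forall u : time T, \val (src c) <= \val u <= \val (tgt c) -> A k u.
  move=> N; have /existsNP[c /not_implyP[c1 c2]] := H N; exists c; split => // k ck.
  by apply: c2; exists k.
have [U UU oU] := ultra_nat_exists.
have := @time_compact R T; rewrite compact_ultra.
move=> /(_ _ (ultra_fmap (fun n => src (c n)) UU) (@filterT _ U _))[s [_ Us]].
have [k /nbhs_time_ex[e e0 eA]] := cov s.
have e20 : 0 < e / 2 by rewrite divr_gt0.
have U1 : U [set n | `|\val (src (c n)) - \val s| < e / 2].
  have : nbhs s [set t : time T | `|\val t - \val s| < e / 2].
    have := @val_continuous _ (time_set T) s.
    move=> /cvgrPdist_lt/(_ _ e20); apply: filterS => t.
    by rewrite distrC.
  by move=> /Us.
have U2 : U [set n | n.+1%:R^-1 < e / 2].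
  by apply: oU; near=> n; near: n; exact: near_infty_natSinv_lt (PosNum e20).
have [n [n1 n2]] := filter_ex (filterI U1 U2).
have [c1 c2] := cP n; apply: (c2 k) => u /andP[u1 u2]; apply: eA.
move: c1 n1 n2; rewrite /len /= => c1 n1 n2.
rewrite (le_lt_trans (ler_distD (\val (src (c n))) _ _))// (splitr e) ltrD//.
rewrite ger0_norm ?subr_ge0//; apply: le_lt_trans n2; apply: le_trans c1.
by rewrite lerB.
Unshelve. all: end_near. Qed.

End localization.

Section finite_cover.
Context {R : realType} {p : nat} {M : pmetricType R} {Z : metricType R}.
Context (F : foliation p M Z).

Lemma finite_pieces : compact [set: M] ->
  exists K (Ps : 'I_K -> piece F), forall m : M, exists k, nbhs m (core (Ps k)).
Proof.
have /choice[P PP] := piece_exists F.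
rewrite compact_cover => /(_ M setT (fun m => interior (core (P m)))) [].
- by move=> m _; exact: open_interior.
- by move=> m _; exists m => //; exact: PP.
move=> D _ cD; pose s := finmap.enum_fset D; exists (size s), (fun k => P (tnth (in_tuple s) k)) => m.
have [m' m'D mm'] := cD m I.
have /tnthP[k E] : m' \in in_tuple s by exact: m'D.
by exists k; rewrite -E.
Qed.

End finite_cover.

Section drift_bound.
Context {R : realType} {p : nat} {M Z : metricType R} (F : foliation p M Z).
Context {d : nat} (V : 'I_d.+1 -> vector_field 3 F) (P : piece F).

Lemma coord_drift_bigO (alpha : R) (I : Type) (S : set I) (tau : I -> R) (T0 : R)
    (u : I -> 'rV[R]_p * Z) (w1 : I -> 'rV[R]_d) (w2 : I -> 'M[R]_d) :
  0 <= alpha -> alpha < 1 / 2 ->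
  (forall c, S c -> 0 <= tau c) -> (forall c, S c -> tau c <= T0) ->
  (forall c, S c -> piece_box P 1 (u c)) ->
  (forall j, bigO S tau alpha (fun c => w1 c ord0 j)) ->
  (forall j k, bigO S tau (2 * alpha) (fun c => w2 c j k)) ->
  forall i, bigO S tau alpha (fun c => coord_drift V P (u c) (w1 c) (w2 c) (tau c) i).
Proof.
move=> a0 a1 t0 tT Su w1O w2O i.
have coefO g : CL_fun 0 (box (atlas (pidx P))) g -> bigO S tau 0 (fun c => g (u c)).
  move=> /bounded_on_piece[B BP]; exists B => c Sc.
  by rewrite powRr0 mulr1; apply: BP; exact: Su.
have vO k (X : vector_field k F) : bigO S tau 0 (fun c => vcomp X (pidx P) (u c) ord0 i).
  have X0 := CL_fun_sub (leq0n k) (@subset_refl _ (box (atlas (pidx P))))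
    (vcomp_CL X i (@subset_refl _ (box (atlas (pidx P))))).
  exact: (coefO (fun u => vcomp X (pidx P) u ord0 i) X0).
have dO j k : bigO S tau 0 (fun c =>
    vdir (V (lift ord0 j)) (pidx P) (fun u => vcomp (V (lift ord0 k)) (pidx P) u ord0 i) (u c)).
  apply: (coefO (vdir (V (lift ord0 j)) (pidx P)
    (fun u => vcomp (V (lift ord0 k)) (pidx P) u ord0 i))).
  apply: (@vdir_CL _ _ _ _ _ 3 0) => //; first exact: box_open.
  exact: (CL_fun_sub (isT : (1 <= 3)%N) (@subset_refl _ _)
    (vcomp_CL (V (lift ord0 k)) i (@subset_refl _ _))).
have w2O' j k : bigO S tau alpha (fun c => w2 c j k).
  by apply: (bigO_le t0 tT a0 _ (w2O j k)); lra.
have tO : bigO S tau alpha tau.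
  apply: (@bigO_le _ _ _ _ T0 t0 tT 1) => //; first by lra.
  by exists 1 => c Sc; rewrite powRr1 ?ger0_norm ?t0// mul1r.
apply: bigO_add; last exact: (bigO_coef a0 (vO _ (V ord0)) tO).
apply: bigO_add; apply: bigO_sum => j.
  exact: (bigO_coef a0 (vO _ (V (lift ord0 j))) (w1O j)).
by apply: bigO_sum => k; exact: (bigO_coef a0 (dO j k) (w2O' j k)).
Qed.

End drift_bound.

Lemma bigO_sub_set {R : realType} {I : Type} (S S' : set I) (tau : I -> R) b f :
  S' `<=` S -> bigO S tau b f -> bigO S' tau b f.
Proof. by move=> SS [C Cf]; exists C => c /SS; exact: Cf. Qed.

(** * Solutions are controlled *)

Section controlled_paths.
Context {R : realType} {p : nat} {M : pmetricType R} {Z : metricType R}.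
Context {F : foliation p M Z} {d : nat} (alpha : R) {T : {posnum R}}.
Variable V : 'I_d.+1 -> vector_field 3 F.
Context {K : nat} (Ps : 'I_K -> piece F).
Hypothesis alpha_gt : 1 / 3 < alpha.
Hypothesis alpha_lt : alpha < 1 / 2.
Local Notation W j := (V (lift ord0 j)).
Local Notation cc k := (coord (atlas (pidx (Ps k)))).

Variable grid : set (simplex T).

(* Davie's expansion is required on [grid] only, so that countably many values of [w] decide
   whether a path is controlled by [w]. *)
Definition controlled (N : nat) (w : two_level T d) (x : time T -> M) : Prop :=
  forall c : simplex T, len c <= N.+1%:R^-1 -> exists k : 'I_K,
    [/\ forall u : time T, \val (src c) <= \val u <= \val (tgt c) -> core (Ps k) (x u),
        forall u : time T, \val (src c) <= \val u <= \val (tgt c) ->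
          (cc k (x u)).2 = (cc k (x (src c))).2,
        `|(cc k (x (tgt c))).1 - (cc k (x (src c))).1| <= N.+1%:R * len c `^ alpha &
        grid c -> forall i : 'I_p,
          `|(cc k (x (tgt c))).1 ord0 i - (cc k (x (src c))).1 ord0 i
            - coord_drift V (Ps k) (cc k (x (src c))) (w.1 c) (w.2 c) (len c) i|
          <= N.+1%:R * len c `^ (3 * alpha)].

(** The entrywise form of finite Hölder norms, degenerate intervals included, as the calculus of
    [bigO] wants it; [chen_boundsP] links it to [holder_norm]. *)
Definition rough_bounds (w : two_level T d) : Prop :=
  (forall j, bigO setT (@len R T) alpha (fun c => w.1 c ord0 j)) /\
  (forall j k, bigO setT (@len R T) (2 * alpha) (fun c => w.2 c j k)).

Let a0 : 0 <= alpha. Proof. by move: alpha_gt; lra. Qed.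

Let three : (1 : R) < 3 * alpha. Proof. by move: alpha_gt; lra. Qed.

Section solution.
Variables (w : two_level T d) (m : M) (x : time T -> M).
Hypothesis xP : rde_solution alpha V m w x.
Hypothesis wb : rough_bounds w.
Hypothesis cover : forall m : M, exists k, nbhs m (core (Ps k)).

Let rde (f : M -> R) : leafwise_function F 3 f ->
  exists C : R, forall c : simplex T,
      `|f (x (tgt c)) - f (x (src c))
        - \sum_(i < d) vf_apply (W i) f (x (src c)) * w.1 c ord0 i
        - \sum_(j < d) \sum_(k < d)
            vf_apply (W j) (vf_apply (W k) f) (x (src c)) * w.2 c j k
        - vf_apply (V ord0) f (x (src c)) * len c|
      <= C * len c `^ (3 * alpha).
Proof. by case: xP => _ _ h /h. Qed.

Lemma solution_pieces : exists N : nat, forall c : simplex T, len c <= N.+1%:R^-1 ->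
  exists k, forall u : time T, \val (src c) <= \val u <= \val (tgt c) -> core (Ps k) (x u).
Proof.
case: xP => cx _ _; apply: (uniform_localization (A := fun k => x @^-1` core (Ps k))).
by move=> s; have [k nk] := cover (x s); exists k; exact: (cx s _ nk).
Qed.

(** The cutoff function is 1 on the plateau, an open set around the core in coordinates, so
    derivatives along the fields at points of the core do not see it. *)
Lemma core_vf_localize k (g : 'rV[R]_p * Z -> R) (X Y : vector_field 3 F) m' :
  CL_fun 3 (box (atlas (pidx (Ps k)))) g -> core (Ps k) m' ->
  [/\ localize (Ps k) g m' = g (cc k m'),
      vf_apply X (localize (Ps k) g) m' = vdir X (pidx (Ps k)) g (cc k m') &
      vf_apply X (vf_apply Y (localize (Ps k) g)) m' =
        vdir X (pidx (Ps k)) (vdir Y (pidx (Ps k)) g) (cc k m')].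
Proof.
move=> g3 m'k; have bm := core_coord m'k; have pm := core_plateau bm.
have am := core_dom m'k.
have g2 := CL_fun_sub (isT : (2 <= 3)%N) (@plateau_sub _ _ _ _ _ (Ps k)) g3.
have g1 := CL_fun_sub (isT : (1 <= 3)%N) (@plateau_sub _ _ _ _ _ (Ps k)) g3.
have oP := @plateau_open _ _ _ _ _ (Ps k).
have E u : plateau (Ps k) u -> localize (Ps k) g (param (atlas (pidx (Ps k))) u) = g u.
  exact: localizeE.
rewrite -{1 3 5}(coordK am); split.
- exact: E.
- exact: (vf_apply_vdir X oP (@plateau_sub _ _ _ _ _ (Ps k)) E g1 pm).
- exact: (vf_apply_vdir2 X Y (isT : (0 < 3)%N) oP (@plateau_sub _ _ _ _ _ (Ps k)) E g2 pm).
Qed.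

(** The test function is the distance to the transverse coordinate at the start of the interval. All
    fields annihilate it, so the equation bounds its increments by C times the length to the power 3
    alpha > 1; it is then constant, and it starts at 0. *)
Lemma solution_transverse k (c : simplex T) :
  (forall u : time T, \val (src c) <= \val u <= \val (tgt c) -> core (Ps k) (x u)) ->
  forall u : time T, \val (src c) <= \val u <= \val (tgt c) ->
    (cc k (x u)).2 = (cc k (x (src c))).2.
Proof.
move=> ck u0 /andP[u01 u02]; set z1 := (cc k (x (src c))).2.
pose g := fun u : 'rV[R]_p * Z => mdist z1 u.2.
have g3 : CL_fun 3 (box (atlas (pidx (Ps k)))) g.
  by apply: CL_fun_snd => u _; exact: mdist_continuous.
have [C CP] := rde (localize_leafwise g3).
pose phi (r : R) := mdist z1 (cc k (x (to_time T r))).2.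
have := @superlinear_increments_cst R phi (\val (src c)) (\val u0) C (3 * alpha) three.
move=> /(_ _ u01) E; apply/esym/mdist_positivity.
have -> : 0 = phi (\val (src c)) by rewrite /phi val_to_time mdistxx.
rewrite -E ?/phi ?val_to_time// => r s cr rs su.
have rT : 0 <= r <= T%:num.
  by rewrite (le_trans (time_ge0 _) cr)/= (le_trans _ (time_le u0))// (le_trans rs).
have sT : 0 <= s <= T%:num.
  by rewrite (le_trans _ rs) ?(andP rT).1//= (le_trans su)// time_le.
have rsT : \val (to_time T r) <= \val (to_time T s) by rewrite !to_timeK.
have kr : core (Ps k) (x (to_time T r)).
  by apply: ck; rewrite to_timeK// cr (le_trans rs)// (le_trans su).
have ks : core (Ps k) (x (to_time T s)).
  by apply: ck; rewrite to_timeK// (le_trans cr rs) (le_trans su).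
have vs0 (X : vector_field 3 F) : vdir X (pidx (Ps k)) g = fun=> 0.
  by apply/funext => u; exact: (@vdir_snd R p M Z F 3 X (pidx (Ps k)) (mdist z1) u).
have vs00 (X Y : vector_field 3 F) : vdir X (pidx (Ps k)) (vdir Y (pidx (Ps k)) g) = fun=> 0.
  by apply/funext => u; rewrite vs0; exact: (@vdir_snd R p M Z F 3 X (pidx (Ps k)) (fun=> 0) u).
have := CP (mksimplex rsT).
have -> : src (mksimplex rsT) = to_time T r by [].
have -> : tgt (mksimplex rsT) = to_time T s by [].
have -> : len (mksimplex rsT) = s - r by rewrite /len !to_timeK.
have [-> _ _] := core_vf_localize (V ord0) (V ord0) g3 ks.
have [-> -> _] := core_vf_localize (V ord0) (V ord0) g3 kr.
rewrite vs0 mul0r subr0.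
rewrite big1 ?subr0 => [|j _]; last first.
  by have [_ -> _] := core_vf_localize (W j) (V ord0) g3 kr; rewrite vs0 mul0r.
rewrite big1 ?subr0// => j _; apply: big1 => j' _.
by have [_ _ ->] := core_vf_localize (W j) (W j') g3 kr; rewrite vs00 mul0r.
Qed.

(** The test function is the i-th leafwise coordinate: a field applied to it returns its i-th
    component, and the equation becomes Davie's expansion. *)
Lemma solution_davie k i : bigO
  [set c : simplex T | core (Ps k) (x (src c)) /\ core (Ps k) (x (tgt c))]
  (@len R T) (3 * alpha) (fun c =>
    (cc k (x (tgt c))).1 ord0 i - (cc k (x (src c))).1 ord0 i
            - coord_drift V (Ps k) (cc k (x (src c))) (w.1 c) (w.2 c) (len c) i).
Proof.
pose g := fun u : 'rV[R]_p * Z => u.1 ord0 i.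
have g3 : CL_fun 3 (box (atlas (pidx (Ps k)))) g.
  apply: CL_fun_coord; [exact: box_open|exact: CL_fun_fst].
have [C CP] := rde (localize_leafwise g3); exists C => c [ks kt].
have vs (X : vector_field 3 F) : vdir X (pidx (Ps k)) g = fun u => vcomp X (pidx (Ps k)) u ord0 i.
  by apply/funext => u; exact: vdir_coord.
have := CP c.
have [-> _ _] := core_vf_localize (V ord0) (V ord0) g3 kt.
have [-> -> _] := core_vf_localize (V ord0) (V ord0) g3 ks.
rewrite vs; have -> : \sum_(j < d) vf_apply (W j) (localize (Ps k) g) (x (src c)) * w.1 c ord0 j =
    \sum_(j < d) vcomp (W j) (pidx (Ps k)) (cc k (x (src c))) ord0 i * w.1 c ord0 j.
  apply: eq_bigr => j _.
  by have [_ -> _] := core_vf_localize (W j) (V ord0) g3 ks; rewrite vs.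
have -> : \sum_(j < d) \sum_(k0 < d)
     vf_apply (W j) (vf_apply (W k0) (localize (Ps k) g)) (x (src c)) * w.2 c j k0 =
   \sum_(j < d) \sum_(k0 < d) vdir (W j) (pidx (Ps k))
     (fun u => vcomp (W k0) (pidx (Ps k)) u ord0 i) (cc k (x (src c))) * w.2 c j k0.
  apply: eq_bigr => j _; apply: eq_bigr => k0 _.
  by have [_ _ ->] := core_vf_localize (W j) (W k0) g3 ks; rewrite vs.
rewrite /coord_drift /g; apply: le_trans; rewrite le_eqVlt; apply/orP; left; apply/eqP.
by congr (`| _ |); ring.
Qed.

(** The leading terms of Davie's expansion are of order alpha, since the coefficients are bounded
    over a piece, and the remainder is of higher order. *)
Lemma solution_holder k i : bigO
  [set c : simplex T | core (Ps k) (x (src c)) /\ core (Ps k) (x (tgt c))]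
  (@len R T) alpha (fun c => (cc k (x (tgt c))).1 ord0 i - (cc k (x (src c))).1 ord0 i).
Proof.
case: wb => w1b w2b; set S := [set c | _].
have l0 c : S c -> 0 <= @len R T c by move=> _; exact: len_ge0.
have lT c : S c -> @len R T c <= T%:num by move=> _; exact: len_le.
have D : bigO S (@len R T) alpha (fun c =>
    coord_drift V (Ps k) (cc k (x (src c))) (w.1 c) (w.2 c) (len c) i).
  apply: (coord_drift_bigO V a0 alpha_lt l0 lT).
  - by move=> c [ks _]; exact: core_coord.
  - by move=> j; apply: bigO_sub_set (w1b j).
  - by move=> j j'; apply: bigO_sub_set (w2b j j').
have E : bigO S (@len R T) alpha (fun c =>
    (cc k (x (tgt c))).1 ord0 i - (cc k (x (src c))).1 ord0 i
            - coord_drift V (Ps k) (cc k (x (src c))) (w.1 c) (w.2 c) (len c) i).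
  by apply: (bigO_le l0 lT a0 _ (solution_davie k i)); move: a0; lra.
by apply: eq_bigO (bigO_add E D) => c _; rewrite subrK.
Qed.

Lemma solution_controlled : exists N, controlled N w x.
Proof.
have [N0 N0P] := solution_pieces.
pose C1 k := projT1 (choice (solution_davie k)).
pose C2 k := projT1 (choice (solution_holder k)).
have C1P k := projT2 (choice (solution_davie k)).
have C2P k := projT2 (choice (solution_holder k)).
pose A1 := \sum_(k < K) \sum_(i < p) `|C1 k i|.
pose A2 := \sum_(k < K) \sum_(i < p) `|C2 k i|.
have bound (C : 'I_K -> 'I_p -> R) k i : C k i <= \sum_(k < K) \sum_(i < p) `|C k i|.
  rewrite (bigD1 k)//= (bigD1 i)//= -addrA (le_trans (ler_norm _))// lerDl.
  by rewrite addr_ge0 ?sumr_ge0// => j _; rewrite sumr_ge0.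
have A0 (C : 'I_K -> 'I_p -> R) : 0 <= \sum_(k < K) \sum_(i < p) `|C k i|.
  by apply: sumr_ge0 => j _; rewrite sumr_ge0.
have ex_nat (A : R) : 0 <= A -> exists n : nat, A <= n%:R.
  by move=> A_ge0; exists (Num.bound A); exact/ltW/archi_boundP.
have [n1 n1P] := ex_nat A1 (A0 C1); have [n2 n2P] := ex_nat A2 (A0 C2).
(* The same integer limits the length of the intervals and bounds both constants, so it has to
   exceed all three requirements. *)
pose N := (N0 + n1 + n2)%N.
have NA1 : A1 <= N.+1%:R by apply: le_trans n1P _; rewrite ler_nat /N; lia.
have NA2 : A2 <= N.+1%:R by apply: le_trans n2P _; rewrite ler_nat /N; lia.
exists N => c cN; have [|k ck] := N0P c.
  by apply: le_trans cN _; rewrite lef_pV2 ?posrE// ler_nat /N; lia.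
have ks : core (Ps k) (x (src c)) by apply: ck; rewrite lexx simplex_le.
have kt : core (Ps k) (x (tgt c)) by apply: ck; rewrite lexx simplex_le.
exists k; split => //; first exact: solution_transverse.
- apply: le_norm_coord => [|i]; first by rewrite mulr_ge0// powR_ge0.
  rewrite !mxE; apply: (le_trans (C2P k i c (conj ks kt))).
  by rewrite ler_wpM2r ?powR_ge0// (le_trans (bound C2 k i) NA2).
- move=> _ i; apply: (le_trans (C1P k i c (conj ks kt))).
  by rewrite ler_wpM2r ?powR_ge0// (le_trans (bound C1 k i) NA1).
Qed.

End solution.
End controlled_paths.

Lemma continuous_at_mul {R : realType} {X : topologicalType} (f g : X -> R) x :
  {for x, continuous f} -> {for x, continuous g} ->
  {for x, continuous (fun y => f y * g y)}.
Proof. by move=> cf cg; exact: cvgM. Qed.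

Lemma continuous_at_sub {R : realType} {X : topologicalType} (f g : X -> R) x :
  {for x, continuous f} -> {for x, continuous g} ->
  {for x, continuous (fun y => f y - g y)}.
Proof. by move=> cf cg; exact: cvgB. Qed.

Lemma continuous_at_sum {R : realType} {X : topologicalType} n (g : 'I_n -> X -> R) x :
  (forall i, {for x, continuous (g i)}) ->
  {for x, continuous (fun y => \sum_(i < n) g i y)}.
Proof. by move=> cg; apply: cvg_big => [|i _]; [exact: add_continuous|exact: cg]. Qed.

Section leafwise_continuity.
Context {R : realType} {p : nat} {M Z : metricType R} (F : foliation p M Z).

Lemma leafwise_continuous (f : M -> R) : leafwise_function F 0 f -> continuous f.
Proof.
move=> f0 m; have [a am] := atlas_cover F m.
have /CL_fun0/(_ _ (box_coord am)) cf := f0 a.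
have c : {for m, continuous ((f \o param (atlas a)) \o coord (atlas a))}.
  by apply: continuous_comp => //; exact: coord_continuous.
rewrite /prop_for /continuous_at /= coordK// in c.
apply: cvg_trans c; apply: near_eq_cvg.
have : nbhs m (dom (atlas a)) by apply: open_nbhs_nbhs; split => //; exact: dom_open.
by apply: filterS => m' am' /=; rewrite coordK.
Qed.

Lemma leafwise_vf_apply k n (X : vector_field k F) (f : M -> R) : (n <= k)%N ->
  leafwise_function F n.+1 f -> leafwise_function F n (vf_apply X f).
Proof.
move=> nk fn a; have oB := @box_open _ _ _ _ F a.
have := vdir_CL X oB (@subset_refl _ _) nk (fn a).
apply: (CL_fun_eq oB) => u bu; apply/esym.
have f1 : CL_fun 1 (box (atlas a)) (f \o param (atlas a)).
  exact: (CL_fun_sub (isT : (1 <= n.+1)%N) (@subset_refl _ _) (fn a)).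
exact: (vf_apply_vdir X oB (@subset_refl _ _) (fun _ _ => erefl) f1 bu).
Qed.

Lemma leafwise_sub k n (f : M -> R) : (n <= k)%N ->
  leafwise_function F k f -> leafwise_function F n f.
Proof. by move=> nk fk a; exact: (CL_fun_sub nk (@subset_refl _ _) (fk a)). Qed.

Lemma compact_continuous_bounded (f : M -> R) : compact [set: M] -> continuous f ->
  exists B : R, forall m, `|f m| <= B.
Proof.
move=> cM cf; have cpt : compact (f @` [set: M]).
  by apply: continuous_compact => //; exact: continuous_subspaceT.
have [B [_ HB]] := compact_bounded cpt.
by exists (B + 1) => m; apply: (HB (B + 1)); [rewrite ltrDl|exists m].
Qed.

End leafwise_continuity.

(** * Controlled paths solve the equation *)

Section controlled_solves.
Context {R : realType} {p : nat} {M : pmetricType R} {Z : metricType R}.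
Context {F : foliation p M Z} {d : nat} (alpha : R) {T : {posnum R}}.
Variable V : 'I_d.+1 -> vector_field 3 F.
Context {K : nat} (Ps : 'I_K -> piece F).
Hypothesis alpha_gt : 1 / 3 < alpha.
Hypothesis alpha_lt : alpha < 1 / 2.
Hypothesis cM : compact [set: M].
Local Notation W j := (V (lift ord0 j)).
Local Notation cc k := (coord (atlas (pidx (Ps k)))).

Variable grid : set (simplex T).
Hypothesis grid_dense : forall c : simplex T, exists g : nat -> simplex T,
  (forall n, grid (g n)) /\ g @ \oo --> c.

Variables (w : two_level T d) (x : time T -> M) (N : nat).
Hypothesis cx : continuous x.
Hypothesis cw1 : continuous w.1.
Hypothesis cw2 : continuous w.2.
Hypothesis wb : rough_bounds alpha w.
Hypothesis w12 : forall c j k, w.2 c j k + w.2 c k j = w.1 c ord0 j * w.1 c ord0 k.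
Hypothesis xN : controlled alpha V Ps grid N w x.

Variable f : M -> R.
Hypothesis f3 : leafwise_function F 3 f.

Let err (c : simplex T) : R :=
  f (x (tgt c)) - f (x (src c))
  - \sum_(i < d) vf_apply (W i) f (x (src c)) * w.1 c ord0 i
  - \sum_(j < d) \sum_(k < d)
      vf_apply (W j) (vf_apply (W k) f) (x (src c)) * w.2 c j k
  - vf_apply (V ord0) f (x (src c)) * len c.

Let a0 : 0 <= alpha. Proof. by move: alpha_gt; lra. Qed.
Let a30 : 0 < 3 * alpha. Proof. by move: alpha_gt; lra. Qed.
Let l0 (S : set (simplex T)) c : S c -> 0 <= @len R T c. Proof. by move=> _; exact: len_ge0. Qed.
Let lT (S : set (simplex T)) c : S c -> @len R T c <= T%:num. Proof. by move=> _; exact: len_le. Qed.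

(** For each k, [ito_on_piece] is applied to the set [S k] of all intervals on which the piece k
    witnesses the control; the finitely many resulting constants are added. *)
Lemma controlled_err_grid : exists C : R, forall c, grid c -> len c <= N.+1%:R^-1 ->
  `|err c| <= C * len c `^ (3 * alpha).
Proof.
pose S k := [set c : simplex T | [/\ core (Ps k) (x (src c)), core (Ps k) (x (tgt c)),
  (cc k (x (tgt c))).2 = (cc k (x (src c))).2,
  `|(cc k (x (tgt c))).1 - (cc k (x (src c))).1| <= N.+1%:R * len c `^ alpha &
   forall i : 'I_p,
          `|(cc k (x (tgt c))).1 ord0 i - (cc k (x (src c))).1 ord0 i
            - coord_drift V (Ps k) (cc k (x (src c))) (w.1 c) (w.2 c) (len c) i|
          <= N.+1%:R * len c `^ (3 * alpha)]].
have SO k : bigO (S k) (@len R T) (3 * alpha) err.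
  case: wb => w1b w2b.
  apply: eq_bigO (ito_on_piece (V := V) (P := Ps k) (u := fun c => cc k (x (src c)))
    (v := fun c => cc k (x (tgt c))) (w1 := w.1) (w2 := w.2) alpha_gt alpha_lt (@l0 (S k)) (@lT (S k))
    _ _ _ _ _ _ _ _ f3).
  - by move=> c [ks kt _ _ _]; rewrite !coordK//; exact: core_dom.
  - by move=> c [ks kt _ _ _]; exact: core_coord.
  - by move=> c [ks kt _ _ _]; exact: core_coord.
  - by move=> c [ks kt -> _ _].
  - by move=> j; apply: bigO_sub_set (w1b j).
  - by move=> j j'; apply: bigO_sub_set (w2b j j').
  - by move=> c _; exact: w12.
  - by exists N.+1%:R => c [_ _ _ + _]; rewrite normr_id.
  - by move=> i; exists N.+1%:R => c [_ _ _ _]; exact.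
pose C k := projT1 (cid (SO k)).
have CP k := projT2 (cid (SO k)).
exists (\sum_k `|C k|) => c gc cN; have [k [h1 h2 h3 h4]] := xN cN.
apply: (le_trans (CP k c _)).
  have hs : \val (src c) <= \val (src c) <= \val (tgt c) by rewrite lexx simplex_le.
  have ht : \val (src c) <= \val (tgt c) <= \val (tgt c) by rewrite lexx simplex_le.
  by split; [exact: h1|exact: h1|exact: h2|exact: h3|exact: h4].
rewrite ler_wpM2r ?powR_ge0// (bigD1 k)//= (le_trans (ler_norm _))// lerDl.
exact: sumr_ge0.
Qed.

Lemma src_continuous : continuous (src : simplex T -> time T).
Proof.
move=> c; apply: (@continuous_comp _ _ _ (\val : simplex T -> _) fst).
  exact: val_continuous.
exact: cvg_fst.
Qed.

Lemma tgt_continuous : continuous (tgt : simplex T -> time T).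
Proof.
move=> c; apply: (@continuous_comp _ _ _ (\val : simplex T -> _) snd).
  exact: val_continuous.
exact: cvg_snd.
Qed.

Lemma len_continuous : continuous (@len R T).
Proof.
move=> c.
have ht : {for c, continuous (fun c : simplex T => \val (tgt c))}.
  exact: (@continuous_comp _ _ _ (@tgt R T) (\val : time T -> R) c
    (@tgt_continuous c) (@val_continuous _ _ _)).
have hs : {for c, continuous (fun c : simplex T => \val (src c))}.
  exact: (@continuous_comp _ _ _ (@src R T) (\val : time T -> R) c
    (@src_continuous c) (@val_continuous _ _ _)).
exact: (cvgB ht hs).
Qed.

Let fW X : leafwise_function F 2 (vf_apply (X : vector_field 3 F) f).
Proof. exact: leafwise_vf_apply f3. Qed.

Let fWW X Y : leafwise_function F 1
  (vf_apply (X : vector_field 3 F) (vf_apply (Y : vector_field 3 F) f)).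
Proof. exact: leafwise_vf_apply (fW Y). Qed.

Let comp_src (g : M -> R) : continuous g -> continuous (fun c : simplex T => g (x (src c))).
Proof.
move=> cg c; apply: (@continuous_comp _ _ _ (fun c : simplex T => x (src c)) g); last exact: cg.
by apply: (@continuous_comp _ _ _ (@src R T) x); [exact: src_continuous|exact: cx].
Qed.

Lemma err_continuous : continuous err.
Proof.
have cf := leafwise_continuous (leafwise_sub (leq0n 3) f3).
have cW X := leafwise_continuous (leafwise_sub (leq0n 2) (fW X)).
have cWW X Y := leafwise_continuous (leafwise_sub (leq0n 1) (fWW X Y)).
move=> c.
have h1 : {for c, continuous (fun c => f (x (tgt c)))}.
  apply: (@continuous_comp _ _ _ (fun c : simplex T => x (tgt c)) f); last exact: cf.
  by apply: (@continuous_comp _ _ _ (@tgt R T) x); [exact: tgt_continuous|exact: cx].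
have h2 : {for c, continuous (fun c => f (x (src c)))} by exact: comp_src.
have cw1c i : {for c, continuous (fun c => w.1 c ord0 i)}.
  apply: (@continuous_comp _ _ _ w.1 (fun v : 'rV[R]_d => v ord0 i)); first exact: cw1.
  exact: matrix_normedtype.coord_continuous.
have cw2c i j : {for c, continuous (fun c => w.2 c i j)}.
  apply: (@continuous_comp _ _ _ w.2 (fun v : 'M[R]_d => v i j)); first exact: cw2.
  exact: matrix_normedtype.coord_continuous.
have h3 : {for c, continuous (fun c => \sum_(i < d) vf_apply (W i) f (x (src c)) * w.1 c ord0 i)}.
  apply: continuous_at_sum => i.
  apply: continuous_at_mul; [exact: (comp_src (cW (W i)))|exact: cw1c].
have h4 : {for c, continuous (fun c => \sum_(j < d) \sum_(k < d)
      vf_apply (W j) (vf_apply (W k) f) (x (src c)) * w.2 c j k)}.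
  apply: continuous_at_sum => i; apply: continuous_at_sum => j.
  apply: continuous_at_mul; [exact: (comp_src (cWW (W i) (W j)))|exact: cw2c].
have h5 : {for c, continuous (fun c => vf_apply (V ord0) f (x (src c)) * len c)}.
  apply: continuous_at_mul; [exact: (comp_src (cW (V ord0)))|exact: len_continuous].
exact: (continuous_at_sub (continuous_at_sub (continuous_at_sub (continuous_at_sub h1 h2) h3) h4) h5).
Qed.

Lemma err_bounded : exists B : R, forall c, `|err c| <= B.
Proof.
have bd (g : M -> R) n : leafwise_function F n g -> bigO setT (@len R T) 0 (fun c => g (x (src c))).
  move=> gn; have [B BP] := compact_continuous_bounded cM
    (leafwise_continuous (leafwise_sub (leq0n n) gn)).
  by exists B => c _; rewrite powRr0 mulr1.
have [w1b w2b] := wb.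
have w1b' j : bigO setT (@len R T) 0 (fun c => w.1 c ord0 j).
  exact: (bigO_le (@l0 setT) (@lT setT) (lexx 0) a0 (w1b j)).
have w2b' j k : bigO setT (@len R T) 0 (fun c => w.2 c j k).
  by apply: (bigO_le (@l0 setT) (@lT setT) (lexx 0) _ (w2b j k)); rewrite mulr_ge0.
have : bigO setT (@len R T) 0 err.
  apply: bigO_sub; [apply: bigO_sub; [apply: bigO_sub; [apply: bigO_sub|]|]|].
  - have [B BP] := compact_continuous_bounded cM (leafwise_continuous (leafwise_sub (leq0n 3) f3)).
    by exists B => c _; rewrite powRr0 mulr1.
  - exact: bd f3.
  - by apply: bigO_sum => j; apply: (bigO_coef (lexx 0)); [exact: bd (fW _)|exact: w1b'].
  - apply: bigO_sum => j; apply: bigO_sum => k.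
    by apply: (bigO_coef (lexx 0)); [exact: bd (fWW _ _)|exact: w2b'].
  - apply: (bigO_coef (lexx 0)); first exact: bd (fW _).
    by exists T%:num => c _; rewrite powRr0 mulr1 ger0_norm ?len_ge0 ?len_le.
by move=> [B BP]; exists B => c; have := BP c I; rewrite powRr0 mulr1.
Qed.

Lemma powR_continuous_pos (b t : R) : 0 < t -> {for t, continuous (fun t => t `^ b)}.
Proof.
move=> t0.
have : {for t, continuous (fun t => expR (b * ln t))}.
  apply: (@continuous_comp _ _ _ (fun t => b * ln t) expR); last exact: continuous_expR.
  by apply: cvgM; [exact: cvg_cst|exact: continuous_ln].
move=> h; have E : expR (b * ln t) = t `^ b by rewrite /powR gt_eqF.
rewrite /prop_for /continuous_at -E; apply: cvg_trans h; apply: near_eq_cvg.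
by near=> s; rewrite /powR gt_eqF//; near: s; exact: lt_nbhsr.
Unshelve. all: end_near. Qed.

(** Long intervals are covered by boundedness of the defect, with [D] chosen so that the bound holds
    at length 1/(N+1). Shorter ones are limits of grid intervals, which are eventually short too
    because the inequality on the length is strict, and the defect is continuous. *)
Lemma controlled_err : exists C : R, forall c, `|err c| <= C * len c `^ (3 * alpha).
Proof.
have [C CP] := controlled_err_grid; have [B BP] := err_bounded.
have n0 : (0 : R) < N.+1%:R^-1 by rewrite invr_gt0.
pose D := `|B| / (N.+1%:R^-1 `^ (3 * alpha)).
exists (`|C| + D) => c.
have D0 : 0 <= D by rewrite divr_ge0// powR_ge0.
have [cN|cN] := leP N.+1%:R^-1 (len c).
  apply: (@le_trans _ _ (D * len c `^ (3 * alpha))); last first.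
    by rewrite ler_wpM2r ?powR_ge0// lerDr.
  apply: (le_trans (BP c)); apply: (le_trans (ler_norm B)).
  rewrite /D mulrAC ler_pdivlMr ?powR_gt0// ler_wpM2l// ge0_ler_powR ?nnegrE ?len_ge0// ltW//.
apply: (@le_trans _ _ (`|C| * len c `^ (3 * alpha))); last first.
  by rewrite ler_wpM2r ?powR_ge0// lerDl.
(* Degenerate intervals are set apart because continuity of the power function was shown at positive
   arguments; on them both levels of [w] vanish, and so does the defect. *)
have [c0|c0] := eqVneq (len c) 0.
  have [w1b w2b] := wb.
  have z (b : R) (g : simplex T -> R) : 0 < b -> bigO setT (@len R T) b g -> g c = 0.
    move=> b0 [G GP]; apply/eqP; rewrite -normr_le0; apply: le_trans (GP c I) _.
    by rewrite c0 powR0 ?mulr0// gt_eqF.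
  have st : src c = tgt c.
    by apply: val_inj; apply/eqP; rewrite eq_sym -subr_eq0; apply/eqP.
  rewrite (_ : err c = 0) ?normr0 ?mulr_ge0 ?powR_ge0//.
  rewrite /err c0 mulr0 st subrr big1 ?subr0 => [|j _].
    rewrite big1 ?subr0// => j _; rewrite big1// => k _.
    by rewrite (z (2 * alpha) (fun c => w.2 c j k)) ?mulr0//; move: a30; lra.
  by rewrite (z alpha (fun c => w.1 c ord0 j)) ?mulr0//; move: a30; lra.
have cpos : 0 < len c by rewrite lt_def c0 len_ge0.
have [g [gg gc]] := grid_dense c.
have h1 : `|err (g n)| @[n --> \oo] --> `|err c|.
  by apply: cvg_norm; apply: (cvg_comp g err gc); exact: err_continuous.
have h2 : `|C| * len (g n) `^ (3 * alpha) @[n --> \oo] --> `|C| * len c `^ (3 * alpha).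
  apply: cvgM; first exact: cvg_cst.
  have hl : len (g n) @[n --> \oo] --> len c.
    by apply: (cvg_comp g _ gc); exact: len_continuous.
  exact: (cvg_comp _ _ hl (powR_continuous_pos cpos)).
apply: (ler_cvg_to h1 h2); near=> n.
apply: (@le_trans _ _ (C * len (g n) `^ (3 * alpha))).
  apply: CP => //; near: n.
  have hl : len (g n) @[n --> \oo] --> len c.
    by apply: (cvg_comp g _ gc); exact: len_continuous.
  exact: (hl _ (lt_le_nbhsl cN)).
by rewrite ler_wpM2r ?powR_ge0// ler_norm.
Unshelve. all: end_near. Qed.

End controlled_solves.

Lemma ultra_pigeonhole {J : Type} (U : set_system J) {UU : UltraFilter U} K
    (P : 'I_K -> set J) : (forall n, exists k, P k n) -> exists k, U (P k).
Proof.
move=> H; apply: contrapT => /forallNP nU.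
have : U [set n | forall k, ~ P k n].
  apply: filter_forall => k; have [/nU//|] := in_ultra_setVsetC (P k) UU; exact.
by move=> /filter_ex[n nP]; have [k /nP] := H n.
Qed.

(** * Limits of controlled paths along an ultrafilter *)

Section limit_path.
Context {R : realType} {p : nat} {M : pmetricType R} {Z : metricType R}.
Context {F : foliation p M Z} {d : nat} (alpha : R) {T : {posnum R}}.
Variable V : 'I_d.+1 -> vector_field 3 F.
Context {K : nat} (Ps : 'I_K -> piece F).
Hypothesis alpha_gt0 : 0 < alpha.
Local Notation W j := (V (lift ord0 j)).
Local Notation cc k := (coord (atlas (pidx (Ps k)))).

Variable grid : set (simplex T).
Variables (U : set_system nat) (N : nat).
Context {UU : UltraFilter U}.
Variables (w_ : nat -> two_level T d) (x_ : nat -> time T -> M) (y : time T -> M).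
Hypothesis x_N : forall n, controlled alpha V Ps grid N (w_ n) (x_ n).
Hypothesis x_y : forall t, x_ n t @[n --> U] --> y t.

Lemma limit_core k t : U [set n | core (Ps k) (x_ n t)] -> core (Ps k) (y t).
Proof.
move=> Uk; exact: (@closed_cvg _ M U _ (fun n => x_ n t) (core (Ps k))
  (@core_closed _ _ _ _ _ (Ps k)) Uk (y t) (@x_y t)).
Qed.

Lemma limit_coord k t : core (Ps k) (y t) -> cc k (x_ n t) @[n --> U] --> cc k (y t).
Proof.
by move=> /core_dom yk; apply: (cvg_comp _ _ (@x_y t)); exact: coord_continuous.
Qed.

Lemma limit_drift k (w : two_level T d) c i :
  (forall j, (w_ n).1 c ord0 j @[n --> U] --> w.1 c ord0 j) ->
  (forall j j', (w_ n).2 c j j' @[n --> U] --> w.2 c j j') ->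
  core (Ps k) (y (src c)) ->
  coord_drift V (Ps k) (cc k (x_ n (src c))) ((w_ n).1 c) ((w_ n).2 c) (len c) i @[n --> U]
  --> coord_drift V (Ps k) (cc k (y (src c))) (w.1 c) (w.2 c) (len c) i.
Proof.
move=> w1 w2 ys; have uc := limit_coord ys.
have bu := box_coord (core_dom ys).
have gc g : CL_fun 0 (box (atlas (pidx (Ps k)))) g ->
    g (cc k (x_ n (src c))) @[n --> U] --> (g (cc k (y (src c))) : R).
  by move=> /CL_fun0/(_ _ bu) cg; exact: (cvg_comp _ _ uc cg).
have vc (X : vector_field 3 F) : vcomp X (pidx (Ps k)) (cc k (x_ n (src c))) ord0 i @[n --> U]
    --> vcomp X (pidx (Ps k)) (cc k (y (src c))) ord0 i.
  have X0 := CL_fun_sub (leq0n 3) (@subset_refl _ (box (atlas (pidx (Ps k)))))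
    (vcomp_CL X i (@subset_refl _ (box (atlas (pidx (Ps k)))))).
  exact: (gc (fun u => vcomp X (pidx (Ps k)) u ord0 i) X0).
have dc (X Y : vector_field 3 F) :
    vdir X (pidx (Ps k)) (fun u => vcomp Y (pidx (Ps k)) u ord0 i) (cc k (x_ n (src c))) @[n --> U]
    --> vdir X (pidx (Ps k)) (fun u => vcomp Y (pidx (Ps k)) u ord0 i) (cc k (y (src c))).
  apply: (gc (vdir X (pidx (Ps k)) (fun u => vcomp Y (pidx (Ps k)) u ord0 i))).
  apply: (@vdir_CL _ _ _ _ _ 3 0) => //; first exact: box_open.
  exact: (CL_fun_sub (isT : (1 <= 3)%N) (@subset_refl _ _)
    (vcomp_CL Y i (@subset_refl _ _))).
apply: cvgD; [apply: cvgD|].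
- apply: cvg_big => [|j _]; first exact: add_continuous.
  by apply: cvgM; [exact: vc|exact: w1].
- apply: cvg_big => [|j _]; first exact: add_continuous.
  apply: cvg_big => [|j' _]; first exact: add_continuous.
  by apply: cvgM; [exact: dc|exact: w2].
- by apply: cvgM; [exact: vc|exact: cvg_cst].
Qed.

Lemma limit_controlled (w : two_level T d) :
  (forall c j, grid c -> (w_ n).1 c ord0 j @[n --> U] --> w.1 c ord0 j) ->
  (forall c j j', grid c -> (w_ n).2 c j j' @[n --> U] --> w.2 c j j') ->
  controlled alpha V Ps grid N w y.
Proof.
move=> w1 w2 c cN.
(* The piece may vary with n, but there are finitely many, so a single one works for almost all n in
   the sense of [U]. The remaining conditions are closed and pass to the limit. *)
have [k Uk] := ultra_pigeonhole (fun n => @x_N n c cN).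
have hs : \val (src c) <= \val (src c) <= \val (tgt c) by rewrite lexx simplex_le.
have ht : \val (src c) <= \val (tgt c) <= \val (tgt c) by rewrite lexx simplex_le.
have yk u : \val (src c) <= \val u <= \val (tgt c) -> core (Ps k) (y u).
  by move=> cu; apply: limit_core; apply: filterS Uk => n [/(_ _ cu)].
have Y1 u : \val (src c) <= \val u <= \val (tgt c) ->
    (cc k (x_ n u)).1 @[n --> U] --> (cc k (y u)).1.
  by move=> /yk/limit_coord h; apply: (cvg_comp _ _ h); exact: cvg_fst.
have Y2 u : \val (src c) <= \val u <= \val (tgt c) ->
    (cc k (x_ n u)).2 @[n --> U] --> (cc k (y u)).2.
  by move=> /yk/limit_coord h; apply: (cvg_comp _ _ h); exact: cvg_snd.
exists k; split => //.
- move=> u cu; apply: (cvg_unique (@metric_hausdorff _ Z) (Y2 _ cu)).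
  apply: cvg_trans (Y2 _ hs); apply: near_eq_cvg.
  by apply: filterS Uk => n [_ /(_ _ cu) ->].
- have h : `|(cc k (x_ n (tgt c))).1 - (cc k (x_ n (src c))).1| @[n --> U] -->
      `|(cc k (y (tgt c))).1 - (cc k (y (src c))).1|.
    by apply: cvg_norm; exact: (cvgB (Y1 _ ht) (Y1 _ hs)).
  by apply: (cvgr_to_le h); apply: filterS Uk => n [].
- move=> gc i.
  have Yi u : \val (src c) <= \val u <= \val (tgt c) ->
      (cc k (x_ n u)).1 ord0 i @[n --> U] --> (cc k (y u)).1 ord0 i.
    by move=> /Y1 h; exact: (cvg_comp (fun n => (cc k (x_ n u)).1)
      (fun v : 'rV[R]_p => v ord0 i) h (@matrix_normedtype.coord_continuous R 1 p ord0 i _)).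
  have D := @limit_drift k w c i (fun j => w1 c j gc) (fun j j' => w2 c j j' gc) (yk _ hs).
  have h : `|(cc k (x_ n (tgt c))).1 ord0 i - (cc k (x_ n (src c))).1 ord0 i
      - coord_drift V (Ps k) (cc k (x_ n (src c))) ((w_ n).1 c) ((w_ n).2 c) (len c) i| @[n --> U]
      --> `|(cc k (y (tgt c))).1 ord0 i - (cc k (y (src c))).1 ord0 i
      - coord_drift V (Ps k) (cc k (y (src c))) (w.1 c) (w.2 c) (len c) i|.
    by apply: cvg_norm; exact: (cvgB (cvgB (Yi _ ht) (Yi _ hs)) D).
  by apply: (cvgr_to_le h); apply: filterS Uk => n [_ _ _ /(_ gc i)].
Qed.

(** What control says about two times in either order, so that [t] may lie on both sides of [s]
    below. *)
Let linked k n (s t : time T) := [/\ core (Ps k) (x_ n s), core (Ps k) (x_ n t),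
  (cc k (x_ n t)).2 = (cc k (x_ n s)).2 &
  `|(cc k (x_ n t)).1 - (cc k (x_ n s)).1| <= N.+1%:R * `|\val t - \val s| `^ alpha].

Let linked_exists n s t : `|\val t - \val s| <= N.+1%:R^-1 -> exists k, linked k n s t.
Proof.
have [st|/ltW ts] := leP (\val s) (\val t).
  rewrite ger0_norm ?subr_ge0// => le.
  have [k [h1 h2 h3 _]] := @x_N n (mksimplex st) le.
  by exists k; split; [apply: h1|apply: h1|apply: h2|]; rewrite ?lexx ?st//
    ger0_norm ?subr_ge0.
rewrite ler0_norm ?subr_le0// opprB => le.
have [k [h1 h2 h3 _]] := @x_N n (mksimplex ts) le.
exists k; split; [apply: h1|apply: h1|symmetry; apply: h2|]; rewrite ?lexx ?ts//.
by rewrite ler0_norm ?subr_le0// opprB distrC.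
Qed.

(** Near [y s] the set [A] contains the image of a product neighbourhood in a chart. The transverse
    coordinate of [x_ n t] equals that of [x_ n s], which converges, and the leafwise coordinate
    moves little by the Hölder bound; both are uniform in n. *)
Lemma limit_equicontinuous (s : time T) (A : set M) : nbhs (y s) A ->
  exists2 e : R, 0 < e & U [set n | forall t : time T, `|\val t - \val s| < e -> A (x_ n t)].
Proof.
move=> Ays; suff /choice[j jP] : forall k, exists j : nat,
    U [set n | forall t : time T, `|\val t - \val s| < j.+1%:R^-1 -> linked k n s t -> A (x_ n t)].
  pose J := (N + \sum_k j k)%N; exists J.+1%:R^-1; first by rewrite invr_gt0.
  apply: filterS (filter_forall _ jP) => n nP t tJ.
  have jJ k : (j k <= J)%N by rewrite /J (bigD1 k)//= addnCA leq_addr.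
  have [k l] : exists k, linked k n s t.
    apply: linked_exists; apply: le_trans (ltW tJ) _.
    by rewrite lef_pV2 ?posrE// ler_nat ltnS leq_addr.
  apply: (nP k) => //; apply: lt_le_trans tJ _.
  by rewrite lef_pV2 ?posrE// ler_nat ltnS.
(* If the limit is outside the closed core, then so is [x_ n s] for almost all n, and
   [linked k n s t] is impossible. *)
move=> k; have [yk|yk] := pselect (core (Ps k) (y s)); last first.
  exists 0%N; have [Uk|] := in_ultra_setVsetC [set n | core (Ps k) (x_ n s)] UU.
    by case: yk; exact: limit_core.
  by apply: filterS => n nk t _ [].
have bu := box_coord (core_dom yk).
have := param_continuous bu; rewrite /prop_for/continuous_at coordK; last exact: core_dom.
move=> /(_ _ Ays)[[B1 B2] /= [/nbhs_normP[r /= r0 rB] nB2] B12].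
have Y1 : (cc k (x_ n s)).1 @[n --> U] --> (cc k (y s)).1.
  by apply: (cvg_comp _ _ (limit_coord yk)); exact: cvg_fst.
have Y2 : (cc k (x_ n s)).2 @[n --> U] --> (cc k (y s)).2.
  by apply: (cvg_comp _ _ (limit_coord yk)); exact: cvg_snd.
have r20 : 0 < r / 2 by rewrite divr_gt0.
(* Chosen so that (N+1) e^alpha = r/2; the other half of [r] is spent on the convergence at time
   [s]. *)
pose e := (r / 2 / N.+1%:R) `^ (alpha^-1).
have e0 : 0 < e by rewrite powR_gt0// divr_gt0.
have [j je] : exists j : nat, j.+1%:R^-1 <= e.
  have [j _ /(_ j (leqnn _)) /= h] := near_infty_natSinv_lt (PosNum e0).
  by exists j; apply/ltW.
have UY1 : U [set n | `|(cc k (y s)).1 - (cc k (x_ n s)).1| < r / 2].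
  by move/cvgrPdist_lt : Y1; apply.
have UY2 : U [set n | B2 (cc k (x_ n s)).2] by exact: (Y2 _ nB2).
exists j; apply: filterS (filterI UY2 UY1) => n [/= z1 y1] t tj [h1 h2 h3 h4].
rewrite -(coordK (core_dom h2)); apply: B12; rewrite [cc k _]surjective_pairing h3.
split => //=; apply: rB; rewrite /= (splitr r).
rewrite (le_lt_trans (ler_distD (cc k (x_ n s)).1 _ _))// ltrD// distrC.
apply: (le_lt_trans h4); rewrite -ltr_pdivlMl// mulrC.
have -> : r / 2 / N.+1%:R = e `^ alpha.
  by rewrite /e -powRrM mulVf ?gt_eqF// powRr1// ltW// divr_gt0.
by rewrite gt0_ltr_powR ?nnegrE// ?ltW// (lt_le_trans tj).
Qed.

Lemma limit_continuous : continuous y.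
Proof.
(* A closed neighbourhood is interposed because pointwise limits preserve membership in closed
   sets. *)
move=> s A Ays; have [B cB BA] : exists2 B, closed B /\ nbhs (y s) B & B `<=` A.
  have [e e0 eA] := nbhs_mdist_ex Ays.
  exists [set m | mdist (y s) m <= e / 2].
    split; first exact: closed_mdist_le.
    apply: filterS (nbhs_mdist_lt (y s) (_ : 0 < e / 2)) => [m /ltW//|].
    by rewrite divr_gt0.
  by move=> m /= me; apply: eA; apply: le_lt_trans me _; rewrite ltr_pdivrMr//; lra.
have [e e0 eU] := limit_equicontinuous cB.2.
have : nbhs s [set t : time T | `|\val t - \val s| < e].
  have := @val_continuous _ (time_set T) s.
  by move=> /cvgrPdist_lt/(_ _ e0); apply: filterS => t; rewrite distrC.
apply: filterS => t te; apply: BA.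
apply: (@closed_cvg _ M U _ (fun n => x_ n t) B cB.1 _ (y t) (@x_y t)).
by apply: filterS eU => n /(_ _ te).
Qed.

(** Otherwise, for almost all n, some time [t n] is bad. These times converge along [U] to some [s],
    where equicontinuity keeps [x_ n (t n)] close to [y s] and continuity of the limit keeps
    [y (t n)] close to [y s]. *)
Lemma limit_uniform (e : R) : 0 < e -> U [set n | forall t, mdist (y t) (x_ n t) < e].
Proof.
move=> e0; have [//|nU] := in_ultra_setVsetC [set n | forall t, mdist (y t) (x_ n t) < e] UU.
exfalso.
have /choice[t tP] : forall n, exists t, (~` [set n | forall t, mdist (y t) (x_ n t) < e]) n ->
    e <= mdist (y t) (x_ n t).
  move=> n; have [nP|nP] := pselect ((~` [set n | forall t, mdist (y t) (x_ n t) < e]) n); last first.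
    by exists (to_time T 0).
  have /existsNP[t /negP tn] := nP; exists t => _.
  by rewrite leNgt.
have := @time_compact R T; rewrite compact_ultra.
move=> /(_ _ (ultra_fmap t UU) (@filterT _ U _))[s [_ Us]].
have e20 : 0 < e / 2 by rewrite divr_gt0.
have [e' e'0 eU] := limit_equicontinuous (nbhs_mdist_lt (y s) e20).
have U1 : U [set n | `|\val (t n) - \val s| < e'].
  have : nbhs s [set t : time T | `|\val t - \val s| < e'].
    have := @val_continuous _ (time_set T) s.
    by move=> /cvgrPdist_lt/(_ _ e'0); apply: filterS => u; rewrite distrC.
  by move=> /Us.
have U2 : U [set n | mdist (y s) (y (t n)) < e / 2].
  exact: (Us _ (limit_continuous (nbhs_mdist_lt (y s) e20))).
have [n [[[/tP h1 h2] h3] h4]] := filter_ex (filterI (filterI (filterI nU U1) U2) eU).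
have h5 : mdist (y s) (x_ n (t n)) < e / 2 := h4 _ h2.
have := metric_triangle (y (t n)) (y s) (x_ n (t n)).
move/(le_trans h1); rewrite (metric_sym (y (t n)) (y s)) leNgt => /negP; apply.
by rewrite (splitr e) ltrD.
Qed.

End limit_path.

(** * Riemann-Stieltjes integrals *)

Section riemann_stieltjes.
Context {R : realType}.
Implicit Types (f g : R -> R).

Definition lipschitz_cst (K : R) f := forall s t, `|f t - f s| <= K * `|t - s|.

(* The increments of [J] are the Riemann-Stieltjes integrals of [f] against [g]; unlike
   convergence of Riemann sums, this inequality passes to pointwise limits of [J]. *)
Definition rs_primitive f g (a b : R) (J : R -> R) := exists C : R,
  forall s xi t, a <= s -> s <= xi -> xi <= t -> t <= b ->
  `|J t - J s - f xi * (g t - g s)| <= C * (t - s) ^+ 2.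

Section existence.
Variables (f g : R -> R) (a b K L : R).
Hypotheses (K0 : 0 <= K) (L0 : 0 <= L).
Hypotheses (fK : lipschitz_cst K f) (gL : lipschitz_cst L g).
Hypothesis ab : a <= b.

Let h (n : nat) : R := (b - a) / n.+1%:R.
Let node n (j : nat) : R := a + j%:R * h n.
Let S n (t : R) : R := \sum_(0 <= j < n.+1)
  f (node n j) * (g (Num.min t (node n j.+1)) - g (Num.min t (node n j))).

Let h0 n : 0 <= h n. Proof. by rewrite divr_ge0// subr_ge0. Qed.

Let nodeS n j : node n j.+1 = node n j + h n.
Proof. by rewrite /node -natr1 mulrDl mul1r addrA. Qed.

Let increments (u : R -> R) n t : a <= t -> t <= b ->
  \sum_(0 <= j < n.+1) (u (Num.min t (node n j.+1)) - u (Num.min t (node n j))) = u t - u a.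
Proof.
move=> at_ tb; rewrite (telescope_sumr (fun j => u (Num.min t (node n j))))//.
congr (u _ - u _); last by rewrite /node mul0r addr0 min_r.
by rewrite /node /h mulrC divfK ?pnatr_eq0// addrC subrK min_l.
Qed.

(** The sums for all [t] use one partition, truncated at [t] by the minimum. Subtraction leaves the
    parts of the cells inside [s, t], and only cells meeting [s, t] count; their left nodes are
    within t - s + h of [xi]. *)
Let S_increment n s xi t : a <= s -> s <= xi -> xi <= t -> t <= b ->
  `|S n t - S n s - f xi * (g t - g s)| <= K * L * (t - s + h n) * (t - s).
Proof.
move=> as_ sx xt tb; have st := le_trans sx xt.
pose D (u : R -> R) j := u (Num.min t (node n j.+1)) - u (Num.min t (node n j))
  - (u (Num.min s (node n j.+1)) - u (Num.min s (node n j))).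
have DE u : \sum_(0 <= j < n.+1) D u j = u t - u s.
  rewrite sumrB !increments ?(le_trans st) ?(le_trans as_)//; ring.
have -> : S n t - S n s - f xi * (g t - g s) =
    \sum_(0 <= j < n.+1) (f (node n j) - f xi) * D g j.
  rewrite -(DE g) mulr_sumr /S -!sumrB; apply: eq_bigr => j _; rewrite /D; ring.
have -> : K * L * (t - s + h n) * (t - s) =
    \sum_(0 <= j < n.+1) K * L * (t - s + h n) * D id j.
  by rewrite -mulr_sumr (DE id).
apply: (le_trans (ler_norm_sum _ _ _)); apply: ler_sum => j _.
have hn := h0 n; have nS := nodeS n j.
have [tj|tj] := leP t (node n j).
  rewrite /D !min_l ?subrr ?subr0 ?normr0 ?mulr0 ?normr0//; rewrite ?nS; lra.
have [sj|sj] := leP (node n j.+1) s.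
  rewrite /D !min_r ?subrr ?mulr0 ?normr0//; rewrite ?nS in sj *; lra.
rewrite normrM; have h1 : `|f (node n j) - f xi| <= K * (t - s + h n).
  apply: (le_trans (fK _ _)); rewrite ler_wpM2l// ler_norml; rewrite nS in sj.
  by apply/andP; split; lra.
have Dg : `|D g j| <= L * D id j.
  have -> : D id j = Num.min t (node n j.+1) - Num.max s (node n j).
    rewrite /D (min_r (ltW tj)) (min_l (ltW sj)).
    by case: (leP s (node n j)) => sc; ring.
  have -> : D g j = g (Num.min t (node n j.+1)) - g (Num.max s (node n j)).
    rewrite /D (min_r (ltW tj)) (min_l (ltW sj)).
    by case: (leP s (node n j)) => sc; ring.
  apply: (le_trans (gL _ _)); rewrite ger0_norm//.
  rewrite subr_ge0 ge_max !le_min st (ltW sj) (ltW tj)/= nS; lra.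
apply: le_trans (ler_pM _ _ h1 Dg) _ => //.
by rewrite le_eqVlt; apply/orP; left; apply/eqP; ring.
Qed.

(** For each [t] the sums are bounded, hence converge along an ultrafilter, and the mesh in
    [S_increment] tends to 0. This takes the place of a Cauchy estimate. *)
Lemma rs_primitive_exists : exists J, rs_primitive f g a b J.
Proof.
have [U UU oU] := ultra_nat_exists.
have /choice[J JP] : forall t : R, exists v : R, a <= t -> t <= b -> S n t @[n --> U] --> v.
  move=> t; have [[at_ tb]|nt] := pselect (a <= t /\ t <= b); last first.
    by exists 0 => h1 h2; case: nt.
  (* The bound given by [S_increment] with s = xi = a, the mesh being at most b - a. *)
  pose B := `|f a * (g t - g a)| + K * L * (t - a + (b - a)) * (t - a).
  have bd n : S n t \in `[- B, B].
    rewrite in_itv/= -ler_norml.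
    have := @S_increment n a a t (lexx _) (lexx _) at_ tb.
    have -> : S n a = 0.
      apply: big1 => j _; rewrite !min_l ?subrr ?mulr0// /node lerDl mulr_ge0//.
    rewrite subr0 => hS.
    have hle : h n <= b - a.
      by rewrite /h ler_pdivrMr// ler_peMr ?subr_ge0// ler1n.
    rewrite -[S n t](subrK (f a * (g t - g a))) (le_trans (ler_normD _ _))//.
    rewrite addrC lerD2l (le_trans hS)// ler_wpM2r ?subr_ge0// ler_wpM2l ?mulr_ge0//.
    by rewrite lerD2l.
  have := @segment_compact R (- B) B; rewrite compact_ultra.
  move=> /(_ ((fun n => S n t) @ U) (ultra_fmap _ UU))[|v [_ Uv]].
    apply: (@filterS _ U _ setT); last exact: filterT.
    by move=> n _; exact: bd.
  by exists v.
exists J, (K * L) => s xi t as_ sx xt tb; have st := le_trans sx xt.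
have Js := JP _ as_ (le_trans st tb); have Jt := JP _ (le_trans as_ st) tb.
have h1 : `|S n t - S n s - f xi * (g t - g s)| @[n --> U] -->
    `|J t - J s - f xi * (g t - g s)|.
  by apply: cvg_norm; apply: cvgB; [exact: (cvgB Jt Js)|exact: cvg_cst].
have h2 : K * L * (t - s + h n) * (t - s) @[n --> U] --> K * L * (t - s + 0) * (t - s).
  apply: cvgMl; apply: cvgMr; apply: cvgD; first exact: cvg_cst.
  apply: cvg_trans (_ : h n @[n --> \oo] --> 0); first exact: cvg_app oU.
  rewrite -(mulr0 (b - a)); apply: cvgMr; exact: cvg_harmonic.
rewrite addr0 in h2; apply: (@le_trans _ _ (K * L * (t - s) * (t - s))).
  by apply: (ler_cvg_to h1 h2); apply: filterE => n; exact: S_increment.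
by rewrite expr2 mulrA.
Qed.

End existence.

Section integral.
Variables (f g J : R -> R) (a b : R).
Hypothesis JP : rs_primitive f g a b J.

(** Errors quadratic in the length of each cell add up to at most |C| times the mesh times t - s. *)
Lemma rs_primitive_is_integral s t : a <= s -> s <= t -> t <= b ->
  is_RS_integral f g s t (J t - J s).
Proof.
have [C CP] := JP; move=> as_ st tb eps e0.
(* Both summands 1 serve to make [D] positive and the final inequality strict. *)
pose D := (`|C| + 1) * (t - s + 1).
have D0 : 0 < D by rewrite mulr_gt0// ?ltr_wpDl// subr_ge0.
exists (eps / D); first by rewrite divr_gt0.
move=> r xi rP xiP.
have nS i : nth t r i = nth t (s :: r) i.+1 by [].
have rs (u : R -> R) : \sum_(i < size r) (u (nth t r i) - u (nth t (s :: r) i)) = u t - u s.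
  under eq_bigr do rewrite nS.
  rewrite -(big_mkord xpredT (fun i => u (nth t (s :: r) i.+1) - u (nth t (s :: r) i))).
  by rewrite (telescope_sumr (fun i => u (nth t (s :: r) i)))// (itv_partition_nth_size _ rP).
rewrite -(rs J) -sumrB; apply: (le_lt_trans (ler_norm_sum _ _ _)).
apply: (@le_lt_trans _ _ (\sum_(i < size r) (`|C| * (eps / D)) * (nth t r i - nth t (s :: r) i))).
  apply: ler_sum => i _; have [d1 /andP[x1 x2]] := xiP i (ltn_ord i).
  have s1 : s <= nth t (s :: r) i by apply: itv_partition_nth_ge => //; rewrite ltnS ltnW.
  have s2 : nth t r i <= t by rewrite nS; apply: itv_partition_nth_le => //; rewrite ltnS.
  rewrite distrC; apply: (le_trans (CP _ _ _ (le_trans as_ s1) x1 x2 (le_trans s2 tb))).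
  have p0 : 0 <= nth t r i - nth t (s :: r) i by rewrite subr_ge0 (le_trans x1).
  rewrite expr2 mulrA ler_wpM2r//.
  apply: (le_trans (ler_wpM2r p0 (ler_norm C))).
  by rewrite ler_wpM2l// ltW.
rewrite -mulr_sumr (rs id) mulrC mulrCA mulrA -ltr_pdivlMr//.
have -> : eps / (eps / D) = D by field; rewrite !gt_eqF.
  have st0 : 0 <= t - s by rewrite subr_ge0.
  have := normr_ge0 C; rewrite /D; nra.
exact: divr_gt0.
Qed.

End integral.

Definition unode (a b : R) n (j : nat) := a + j%:R * ((b - a) / n.+1%:R).

Let nodes a b n := [seq unode a b n j.+1 | j <- iota 0 n.+1].

Let nth_nodes a b n j : (j <= n.+1)%N -> nth b (a :: nodes a b n) j = unode a b n j.
Proof.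
case: j => [_|j jn]; first by rewrite /unode mul0r addr0.
by rewrite /= (nth_map 0%N) ?size_iota// nth_iota.
Qed.

Let nodesP a b n : a < b -> itv_partition a b (nodes a b n).
Proof.
move=> ab; have h0 : 0 < (b - a) / n.+1%:R by rewrite divr_gt0// subr_gt0.
split; last first.
  rewrite (last_nth b) (_ : size _ = n.+1) ?size_map ?size_iota// nth_nodes//.
  rewrite /unode mulrC divfK ?pnatr_eq0//.
  by rewrite addrC subrK.
apply/(pathP b) => i; rewrite size_map size_iota => iS.
have -> : nth b (nodes a b n) i = nth b (a :: nodes a b n) i.+1 by [].
rewrite !nth_nodes// ?(leqW iS)//; last exact: ltnW.
by rewrite /unode ltrD2l ltr_pM2r// ltr_nat.
Qed.

(** An explicit sequence of sums gives uniqueness of the integral, and later exhibits second levels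
    of lifts as countable limits of measurable functions. *)
Lemma riemann_sums_cvg f g a b v : a <= b -> is_RS_integral f g a b v ->
  (fun n => \sum_(i < n.+1) f (unode a b n i) * (g (unode a b n i.+1) - g (unode a b n i)))
    @ \oo --> v.
Proof.
rewrite le_eqVlt => /orP[/eqP <- I|ab I].
  (* For [a = b] the empty list is a partition with sum 0, so [v] is smaller than every positive
     number in absolute value. *)
  have -> : v = 0.
    apply/eqP; rewrite -normr_le0; apply/ler_addgt0Pl => e e0.
    have [D _ /(_ [::] (fun=> 0))] := I e e0; rewrite big_ord0 sub0r normrN addr0.
    by move=> h; apply/ltW/h => //; split=> //=.
  apply: cvg_near_cst; apply: nearW => n; apply: big1 => i _.
  by rewrite /unode subrr mul0r !mulr0 !addr0 subrr mulr0.
apply/cvgrPdist_lt => e e0; have [D D0 H] := I e e0.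
have c0 : (fun n => (b - a) * (n.+1%:R)^-1) @ \oo --> (b - a) * 0.
  by apply: cvgMr; exact: cvg_harmonic.
rewrite mulr0 in c0.
near=> n; rewrite distrC.
have hn : (b - a) / n.+1%:R < D.
  apply: le_lt_trans (ler_norm _) _; rewrite -normrN -[- _]sub0r.
  by near: n; move/cvgrPdist_lt: c0; exact.
have := H (nodes a b n) (fun i => unode a b n i) (nodesP n ab).
rewrite size_map size_iota; move: (nodesP n ab) => nP.
have E i : (i < n.+1)%N -> nth b (nodes a b n) i = unode a b n i.+1.
  by move=> iS; rewrite -nth_nodes.
have E' i : (i < n.+1)%N -> nth b (a :: nodes a b n) i = unode a b n i.
  by move=> iS; rewrite nth_nodes// ltnW.
under eq_bigr do rewrite E ?E'//.
apply=> i iS; rewrite E// E'// lexx /unode; split.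
  by move: hn; set c := _ / _; rewrite -(natr1 i) (mulrDl i%:R) mul1r; lra.
by rewrite /= lerD2l ler_wpM2r ?ler_nat// divr_ge0// subr_ge0 ltW.
Unshelve. all: by end_near. Qed.

Lemma RS_integralE f g a b v : a <= b -> is_RS_integral f g a b v ->
  RS_integral f g a b = v.
Proof.
move=> ab I; rewrite /RS_integral; case: xgetP => [u -> /= Iu|/(_ v)//].
exact: cvg_unique (riemann_sums_cvg ab Iu) (riemann_sums_cvg ab I).
Qed.

End riemann_stieltjes.

(** * Rough paths and lifts *)

Section holder_norm.
Context {R : realType} {T : {posnum R}} {V : normedModType R}.
Implicit Type f : simplex T -> V.

Lemma holder_norm_leP (beta e : R) f : (holder_norm beta f <= e%:E)%E <->
  forall c, 0 < len c -> `|f c| <= e * len c `^ beta.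
Proof.
split=> [/ereal_supP H c c0|H].
  have := H (`|f c| / len c `^ beta)%:E; rewrite lee_fin ler_pdivrMr ?powR_gt0//.
  by apply; exists c.
apply/ereal_supP => _ [c c0 <-]; rewrite lee_fin ler_pdivrMr ?powR_gt0//; exact: H.
Qed.

Lemma holder_norm_ltyP (beta : R) f : (holder_norm beta f < +oo)%E <->
  exists e : R, forall c, 0 < len c -> `|f c| <= e * len c `^ beta.
Proof.
split=> [|[e /holder_norm_leP/le_lt_trans]]; last by apply; rewrite ltry.
case E: holder_norm => [e| |]// _; first by exists e; apply/holder_norm_leP; rewrite E.
by exists 0; apply/holder_norm_leP; rewrite E leNye.
Qed.

End holder_norm.

Section two_level_paths.
Context {R : realType} {T : {posnum R}} {d : nat}.
Implicit Types (w : two_level T d) (c : simplex T).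

Lemma len_eq0 c : len c = 0 -> src c = tgt c.
Proof. by move/eqP; rewrite subr_eq0 => /eqP st; apply: val_inj. Qed.

(** Chen's relation for the triple (c, c, c). The Hölder norms ignore degenerate intervals, so this
    is what controls [w] on them. *)
Lemma chen_diag w c : chen w -> len c = 0 -> w.1 c = 0 /\ w.2 c = 0.
Proof.
move=> wc /len_eq0 st; have [h1 h2] := wc c c c erefl (esym st) erefl.
have w1 : w.1 c = 0 by apply: (addrI (w.1 c)); rewrite addr0 -h1.
split=> //; apply: (addrI (w.2 c)).
by move: h2; rewrite w1 mulmx0 !addr0 => <-.
Qed.

Lemma chen_boundsP (alpha : R) w : 0 < alpha -> chen w -> rough_bounds alpha w <->
  (holder_norm alpha w.1 < +oo)%E /\ (holder_norm (2 * alpha) w.2 < +oo)%E.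
Proof.
move=> a0 wc; split=> [[h1 h2]|[/holder_norm_ltyP[C1 h1] /holder_norm_ltyP[C2 h2]]].
  split; apply/holder_norm_ltyP.
    move: h1 => /choice[C CP]; exists (\sum_j `|C j|) => c c0.
    apply: le_norm_entry => [|i j]; first by rewrite mulr_ge0 ?powR_ge0 ?sumr_ge0.
    rewrite ord1 (le_trans (CP j c I))// ler_wpM2r ?powR_ge0// (bigD1 j)//=.
    by rewrite (le_trans (ler_norm _))// lerDl sumr_ge0.
  have /choice[C CP] : forall jk : 'I_d * 'I_d, exists C : R, forall c,
      `|w.2 c jk.1 jk.2| <= C * len c `^ (2 * alpha).
    by move=> [j k]; have [C CP] := h2 j k; exists C => c; exact: CP.
  exists (\sum_jk `|C jk|) => c c0.
  apply: le_norm_entry => [|i j]; first by rewrite mulr_ge0 ?powR_ge0 ?sumr_ge0.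
  rewrite (le_trans (CP (i, j) c))// ler_wpM2r ?powR_ge0// (bigD1 (i, j))//=.
  by rewrite (le_trans (ler_norm _))// lerDl sumr_ge0.
split=> [j|j k]; [exists C1|exists C2] => c _.
  have [c0|c0] := eqVneq (len c) 0.
    by have [-> _] := chen_diag wc c0; rewrite mxE normr0 c0 powR0 ?gt_eqF// mulr0.
  by rewrite (le_trans (le_entry_norm _ _ _))// h1// lt_def c0 len_ge0.
have [c0|c0] := eqVneq (len c) 0.
  by have [_ ->] := chen_diag wc c0; rewrite mxE normr0 c0 powR0 ?mulr0// mulf_neq0// gt_eqF.
by rewrite (le_trans (le_entry_norm _ _ _))// h2// lt_def c0 len_ge0.
Qed.

End two_level_paths.

Section chen_continuity.
Context {R : realType} {T : {posnum R}} {d : nat}.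
Implicit Types (w : two_level T d) (c : simplex T).

Lemma powR_small (C b e : R) : 0 < b -> 0 < e ->
  exists2 D : R, 0 < D & forall a, 0 <= a -> a < D -> C * a `^ b < e.
Proof.
move=> b0 e0; have C0 : 0 < `|C| + 1 by rewrite ltr_wpDl.
have eC : 0 < e / (`|C| + 1) by rewrite divr_gt0.
exists ((e / (`|C| + 1)) `^ b^-1); first by rewrite powR_gt0.
move=> a a0 aD; apply: (@le_lt_trans _ _ ((`|C| + 1) * a `^ b)).
  by rewrite ler_wpM2r ?powR_ge0// (le_trans (ler_norm _))// lerDl.
rewrite -ltr_pdivlMl// mulrC.
have -> : e / (`|C| + 1) = ((e / (`|C| + 1)) `^ b^-1) `^ b.
  by rewrite -powRrM mulVf ?gt_eqF// powRr1// ltW.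
by apply: gt0_ltr_powR; rewrite ?nnegrE// powR_ge0.
Qed.

Lemma holder_continuous (h : time T -> R) (C b : R) : 0 < b ->
  (forall c, `|h (tgt c) - h (src c)| <= C * len c `^ b) -> continuous h.
Proof.
move=> b0 H s; have FF : Filter (nbhs s) := nbhs_filter s.
apply/(@cvgrPdist_lt _ _ _ (nbhs s) (nbhs_filter s)) => e e0; have [D D0 DP] := powR_small C b0 e0.
have : \forall t \near s, `|\val s - \val t| < D.
  by have := @val_continuous _ (time_set T) s; 
    move/(@cvgrPdist_lt _ _ _ (nbhs s) (nbhs_filter s)); exact.
apply: (@filterS _ _ FF) => t; have [st|/ltW ts] := leP (\val s) (\val t) => stD.
  have := H (mksimplex st); rewrite /len /src /tgt/= -[X in X <= _]distrC => /le_lt_trans; apply.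
  by apply: DP; rewrite ?subr_ge0//; move: stD; rewrite distrC ger0_norm ?subr_ge0.
have := H (mksimplex ts); rewrite /len /src /tgt/= => /le_lt_trans; apply.
by apply: DP; rewrite ?subr_ge0//; move: stD; rewrite ger0_norm ?subr_ge0.
Qed.

Let zero_le (t : time T) : \val (to_time T 0) <= \val t.
Proof. by rewrite to_timeK ?time_ge0// lexx/=. Qed.

Let zc (t : time T) : simplex T := mksimplex (zero_le t).

(** By Chen's relation [w] is a polynomial in the one-time functions [x] and [y], its values on the
    intervals starting at 0, and the Hölder bounds make these continuous. *)
Lemma chen_continuous (alpha : R) w : 0 < alpha -> chen w -> rough_bounds alpha w ->
  continuous w.1 /\ continuous w.2.
Proof.
move=> a0 wc [b1 b2].
pose x j t : R := w.1 (zc t) ord0 j; pose y j k t : R := w.2 (zc t) j k.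
have E1 c j : w.1 c ord0 j = x j (tgt c) - x j (src c).
  have [h _] := wc (zc (src c)) c (zc (tgt c)) erefl erefl erefl.
  by rewrite /x h mxE; ring.
have E2 c j k : w.2 c j k = y j k (tgt c) - y j k (src c) - x j (src c) * (x k (tgt c) - x k (src c)).
  have [_ h] := wc (zc (src c)) c (zc (tgt c)) erefl erefl erefl.
  rewrite -E1 /y h !mxE big_ord1 !mxE /x; ring.
have cx j : continuous (x j).
  have [C CP] := b1 j; apply: (@holder_continuous _ C alpha) => // c.
  by rewrite -E1; exact: CP.
have cy j k : continuous (y j k).
  have [C CP] := b2 j k.
  have [B _ BP] : exists2 B : R, 0 <= B & forall t, `|x j t| <= B.
    have [C1 CP1] := b1 j; exists (`|C1| * T%:num `^ alpha) => [|t].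
      by rewrite mulr_ge0 ?powR_ge0.
    apply: (le_trans (CP1 (zc t) I)); apply: (@le_trans _ _ (`|C1| * len (zc t) `^ alpha)).
      by rewrite ler_wpM2r ?powR_ge0// ler_norm.
    by rewrite ler_wpM2l// ge0_ler_powR ?nnegrE ?len_ge0 ?len_le// ltW.
  have [C1 CP1] := b1 k.
  have : bigO setT (@len R T) alpha (fun c => y j k (tgt c) - y j k (src c)).
    have h1 : bigO setT (@len R T) alpha (fun c => w.2 c j k).
      apply: (@bigO_le _ _ _ _ T%:num _ _ (2 * alpha)) => //;
        [|by move=> *; exact: len_le|by lra|by lra].
      by move=> *; exact: len_ge0.
    have h2 : bigO setT (@len R T) alpha (fun c => x j (src c) * w.1 c ord0 k).
      apply: bigO_coef; [exact: ltW| |exact: b1].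
      by exists B => c _; rewrite powRr0 mulr1.
    by apply: eq_bigO (bigO_add h1 h2) => c _; rewrite E2 E1; ring.
  by move=> [C2 CP2]; apply: (@holder_continuous _ C2 alpha) => // c; exact: CP2.
have cxs j c : {for c, continuous (fun c => x j (src c))}.
  by apply: (@continuous_comp _ _ _ src (x j)); [exact: src_continuous|exact: cx].
have cxt j c : {for c, continuous (fun c => x j (tgt c))}.
  by apply: (@continuous_comp _ _ _ tgt (x j)); [exact: tgt_continuous|exact: cx].
have cys j k c : {for c, continuous (fun c => y j k (src c))}.
  by apply: (@continuous_comp _ _ _ src (y j k)); [exact: src_continuous|exact: cy].
have cyt j k c : {for c, continuous (fun c => y j k (tgt c))}.
  by apply: (@continuous_comp _ _ _ tgt (y j k)); [exact: tgt_continuous|exact: cy].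
split=> c; apply: (@cvg_entries _ _ _ _ (nbhs c) (nbhs_filter c)) => j k.
  rewrite ord1; under eq_fun do rewrite E1; rewrite E1.
  exact: (continuous_at_sub (cxt k c) (cxs k c)).
under eq_fun do rewrite E2; rewrite E2.
apply: (continuous_at_sub (continuous_at_sub (cyt j k c) (cys j k c))
  (continuous_at_mul (cxs j c) (continuous_at_sub (cxt k c) (cxs k c)))).
Qed.

Lemma chen_rough_path (alpha : R) w : 0 < alpha -> chen w -> rough_bounds alpha w ->
  rough_path alpha w.
Proof.
move=> a0 wc wb; have [c1 c2] := chen_continuous a0 wc wb.
by have [h1 h2] := (chen_boundsP a0 wc).1 wb; split.
Qed.

Lemma rough_path_bounds (alpha : R) w : 0 < alpha -> rough_path alpha w ->
  rough_bounds alpha w.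
Proof. by move=> a0 [_ _ wc h1 h2]; apply/(chen_boundsP a0 wc). Qed.

End chen_continuity.

Section lipschitz_lift.
Context {R : realType} {T : {posnum R}} {d : nat}.
Variable v : time T -> 'rV[R]_d.
Hypothesis vL : lipschitz_path v.
Implicit Type c : simplex T.
Local Notation path j := (fun u : R => v (to_time T u) ord0 j).

Lemma to_time_lip (s t : R) : `|\val (to_time T t) - \val (to_time T s)| <= `|t - s|.
Proof.
have T0 : 0 < T%:num by [].
rewrite /=; move: (T%:num) T0 => r r0.
have h1 := ler_norm (t - s); have h2 := ler_norm (s - t); rewrite distrC in h2.
have h0 := ltW r0; rewrite ler_norml; move: (`|t - s|) h1 h2 => e h1 h2.
by apply/andP; split; case: (leP t r) => ?; case: (leP s r) => ?; rewrite ?(max_r h0);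
  case: (leP 0 t) => ?; case: (leP 0 s) => ?; lra.
Qed.

Lemma path_lip : exists2 K : R, 0 <= K & forall j, lipschitz_cst K (path j).
Proof.
have [K KP] := vL; exists `|K| => // j s t.
have := le_entry_norm (v (to_time T t) - v (to_time T s)) ord0 j; rewrite !mxE => h.
apply: (le_trans h); apply: (le_trans (KP _ _)).
apply: (@le_trans _ _ (`|K| * `|\val (to_time T t) - \val (to_time T s)|)).
  by rewrite ler_wpM2r// ler_norm.
by rewrite ler_wpM2l// to_time_lip.
Qed.

(** One primitive on [0, T] serves all intervals: subtracting the constant [v (src c)] from the
    integrand changes [J] by a multiple of the k-th component of the path. *)
Lemma lift_is_integral j k : exists J, rs_primitive (path j) (path k) 0 T%:num J /\
  forall c, is_RS_integral (fun u => (v (to_time T u) - v (src c)) ord0 j) (path k)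
    (\val (src c)) (\val (tgt c)) (J (\val (tgt c)) - J (\val (src c))
      - v (src c) ord0 j * (v (tgt c) ord0 k - v (src c) ord0 k)).
Proof.
have [K K0 KP] := path_lip.
have T0 : 0 <= T%:num :> R by [].
have [J JP] := rs_primitive_exists K0 K0 (KP j) (KP k) T0.
exists J; split=> // c; pose b := v (src c) ord0 j.
have bP : rs_primitive (fun u => (v (to_time T u) - v (src c)) ord0 j) (path k) 0 T%:num
    (fun t => J t - b * v (to_time T t) ord0 k).
  have [C CP] := JP; exists C => s xi t s0 sx xt tT.
  apply: le_trans (CP s xi t s0 sx xt tT); rewrite le_eqVlt; apply/orP; left; apply/eqP.
  by congr `|_|; rewrite !mxE /b; ring.
have := rs_primitive_is_integral bP (time_ge0 (src c)) (simplex_le c) (time_le (tgt c)).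
by rewrite !val_to_time -/b; congr is_RS_integral; ring.
Qed.

Lemma lift_primitive j k : exists J, rs_primitive (path j) (path k) 0 T%:num J /\
  forall c, (natural_lift v).2 c j k = J (\val (tgt c)) - J (\val (src c))
    - v (src c) ord0 j * (v (tgt c) ord0 k - v (src c) ord0 k).
Proof.
have [J [JP JI]] := lift_is_integral j k; exists J; split=> // c.
by rewrite mxE (RS_integralE (simplex_le c) (JI c)).
Qed.

Lemma lift_level2_cvg c j k :
  (fun n => \sum_(i < n.+1)
     (v (to_time T (unode (\val (src c)) (\val (tgt c)) n i)) - v (src c)) ord0 j
     * (v (to_time T (unode (\val (src c)) (\val (tgt c)) n i.+1)) ord0 k
        - v (to_time T (unode (\val (src c)) (\val (tgt c)) n i)) ord0 k)) @ \oo
  --> (natural_lift v).2 c j k.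
Proof.
have [J [_ JI]] := lift_is_integral j k.
rewrite mxE (RS_integralE (simplex_le c) (JI c)).
exact: (riemann_sums_cvg (simplex_le c) (JI c)).
Qed.

Lemma lift_level1 c j : (natural_lift v).1 c ord0 j = v (tgt c) ord0 j - v (src c) ord0 j.
Proof. by rewrite !mxE. Qed.

Lemma lift_chen : chen (natural_lift v).
Proof.
move=> a b c ac ab bc; split; first by rewrite /= ac -ab -bc [RHS]addrC addrA subrK.
apply/matrixP => j k; have [J [_ JE]] := lift_primitive j k.
have E1 := lift_level1; move: (natural_lift v) JE E1 => L JE E1.
by rewrite !mxE big_ord1 !mxE !E1 !JE ac -ab -bc; ring.
Qed.

Lemma lift_symmetric c j k : (natural_lift v).2 c j k + (natural_lift v).2 c k j =
  (natural_lift v).1 c ord0 j * (natural_lift v).1 c ord0 k.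
Proof.
have [J [[C CP] JE]] := lift_primitive j k; have [J' [[C' CP'] JE']] := lift_primitive k j.
(* The tags at opposite ends make the increments of [phi] quadratic in the length, so [phi]
   is constant. *)
pose phi t := J t + J' t - v (to_time T t) ord0 j * v (to_time T t) ord0 k.
have : phi (\val (tgt c)) = phi (\val (src c)).
  apply: (@superlinear_increments_cst _ phi (\val (src c)) (\val (tgt c)) (C + C') 2%:R).
  - by rewrite ltr1n.
  - move=> s t cs st tc; have s0 := le_trans (time_ge0 (src c)) cs.
    have tT := le_trans tc (time_le (tgt c)).
    rewrite powR_mulrn ?subr_ge0// mulrDl.
    apply: le_trans (lerD (CP s s t s0 (lexx _) st tT) (CP' s t t s0 st (lexx _) tT)).
    apply: le_trans (ler_normD _ _); rewrite le_eqVlt; apply/orP; left; apply/eqP.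
    by congr `|_|; rewrite /phi; ring.
  - exact: simplex_le.
rewrite /phi !val_to_time !lift_level1 JE JE' => h.
have -> : J (\val (tgt c)) = J (\val (src c)) + J' (\val (src c))
    - v (src c) ord0 j * v (src c) ord0 k - J' (\val (tgt c)) + v (tgt c) ord0 j * v (tgt c) ord0 k.
  by rewrite -h; ring.
by ring.
Qed.

Lemma lift_bounds (alpha : R) : 0 < alpha -> alpha < 1 / 2 -> rough_bounds alpha (natural_lift v).
Proof.
move=> a0 a1.
have l0 : forall c, [set: simplex T] c -> 0 <= len c by move=> ? _; exact: len_ge0.
have lT : forall c, [set: simplex T] c -> len c <= T%:num by move=> ? _; exact: len_le.
split=> [j|j k].
  apply: (bigO_le l0 lT (ltW a0) (_ : alpha <= 1)); first by lra.
  have [K K0 KP] := path_lip; exists K => c _; rewrite powRr1 ?len_ge0// lift_level1.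
  have := KP j (\val (src c)) (\val (tgt c)); rewrite !val_to_time => /le_trans; apply.
  by rewrite [`|\val _ - _|]ger0_norm ?len_ge0.
apply: (bigO_le l0 lT _ (_ : 2 * alpha <= 2%:R)); [by lra|by lra|].
have [J [[C CP] JE]] := lift_primitive j k; exists C => c _.
rewrite powR_mulrn ?len_ge0// JE.
have := CP _ _ _ (time_ge0 (src c)) (lexx _) (simplex_le c) (time_le (tgt c)).
by rewrite !val_to_time.
Qed.

Lemma lift_rough_path (alpha : R) : 0 < alpha -> alpha < 1 / 2 ->
  rough_path alpha (natural_lift v).
Proof. by move=> a0 a1; apply: chen_rough_path => //; [exact: lift_chen|exact: lift_bounds]. Qed.

End lipschitz_lift.

Section dyadic_approximation.
Context {R : realType} {T : {posnum R}} {d : nat}.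
Variables (w : time T -> 'rV[R]_d) (l : nat).

Let h : R := T%:num / 2 ^+ l.

Let h0 : 0 < h. Proof. by rewrite divr_gt0// exprn_gt0. Qed.

Let nodew i := w (to_time T (i%:R * h)).

(** The profile rising from 0 to 1 across the i-th dyadic cell. As a sum of such ramps the
    approximation is visibly Lipschitz, with no distinction of the cells containing the two
    times. *)
Let ramp (i : nat) (t : R) : R := Num.max 0 (Num.min 1 (t / h - i%:R)).

Let ramp_lip i s t : `|ramp i t - ramp i s| <= h^-1 * `|t - s|.
Proof.
have -> : h^-1 * `|t - s| = `|t / h - s / h|.
  by rewrite -mulrBl normrM mulrC (ger0_norm (_ : 0 <= h^-1))// invr_ge0 ltW.
rewrite /ramp; move: (t / h) (s / h) (i%:R : R) => {}t {}s a.
have h1 := ler_norm (t - s); have h2 := ler_norm (s - t); rewrite distrC in h2.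
rewrite ler_norml; move: (`|t - s|) h1 h2 => e h1 h2.
by apply/andP; split; case: (leP 1 (t - a)) => ?; case: (leP 1 (s - a)) => ?;
  rewrite ?(max_r ler01); case: (leP 0 (t - a)) => ?; case: (leP 0 (s - a)) => ?; lra.
Qed.

Let dyadicE t : dyadic_approx w l t =
  w (to_time T 0) + \sum_(0 <= i < (2 ^ l).+1) ramp i (\val t) *: (nodew i.+1 - nodew i).
Proof.
rewrite /dyadic_approx; set j := Num.truncn _; rewrite -/h -/(nodew j) -/(nodew j.+1).
have /andP[j1 j2] : j%:R <= \val t / h < j.+1%:R.
  by apply: truncn_itv; rewrite divr_ge0 ?time_ge0// ltW.
(* The value [j = 2 ^ l] occurs at time T, hence one index more than there are cells; [to_time]
   sends the node beyond T back to T. *)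
have jl : (j < (2 ^ l).+1)%N.
  rewrite ltnS -(ler_nat R); apply: (le_trans j1).
  by rewrite ler_pdivrMr// natrX /h mulrC divfK ?expf_neq0// time_le.
rewrite (big_cat_nat (n := j)) ?(ltnW jl)//= (big_ltn jl).
rewrite [X in _ + (_ + (_ + X))]big1_seq ?addr0; last first.
  move=> i; rewrite mem_index_iota => /andP[_ /andP[ji _]].
  have : j.+1%:R <= i%:R :> R by rewrite ler_nat.
  move=> ji'; rewrite /ramp max_l ?scale0r// ge_min; apply/orP; right.
  by rewrite subr_le0; exact: le_trans (ltW j2) ji'.
rewrite (eq_big_nat _ _ (F2 := fun i => nodew i.+1 - nodew i)); last first.
  move=> i /andP[_ ij]; have : i.+1%:R <= j%:R :> R by rewrite ler_nat.
  move=> ij'; rewrite /ramp min_l ?max_r ?scale1r//.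
  by rewrite lerBrDr addrC natr1; exact: le_trans ij' j1.
rewrite telescope_sumr// addrA.
have -> : w (to_time T 0) = nodew 0 by rewrite /nodew mul0r.
rewrite [nodew 0%N + _]addrC subrK; congr (_ + _ *: _).
rewrite /ramp min_r ?max_r; [|by rewrite subr_ge0|by rewrite lerBlDr addrC natr1; exact: ltW].
by rewrite mulrBl mulfK ?gt_eqF.
Qed.

Lemma dyadic_approx_lipschitz : lipschitz_path (dyadic_approx w l).
Proof.
exists (\sum_(0 <= i < (2 ^ l).+1) h^-1 * `|nodew i.+1 - nodew i|) => s t.
rewrite !dyadicE opprD addrACA subrr add0r -sumrB mulr_suml.
apply: (le_trans (ler_norm_sum _ _ _)); apply: ler_sum => i _.
by rewrite -scalerBl normrZ mulrAC ler_wpM2r// ramp_lip.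
Qed.

Lemma dyadic_approx0 : dyadic_approx w l (to_time T 0) = w (to_time T 0).
Proof.
by rewrite /dyadic_approx to_timeK ?lexx//= mul0r truncn0 mul0r subrr mul0r scale0r addr0.
Qed.

End dyadic_approximation.

Section holder_distance.
Context {R : realType} {T : {posnum R}} {d : nat} (alpha : R).
Hypothesis alpha_gt0 : 0 < alpha.
Implicit Types (v w : two_level T d) (c : simplex T).

Lemma holder_dist_leP w v (e : R) : chen w -> chen v ->
  (holder_dist alpha w v <= e%:E)%E <->
  forall c, `|w.1 c - v.1 c| <= e * len c `^ alpha /\
            `|w.2 c - v.2 c| <= e * len c `^ (2 * alpha).
Proof.
move=> wc vc; rewrite /holder_dist ge_max.
split=> [/andP[/holder_norm_leP h1 /holder_norm_leP h2] c|H].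
  have [c0|c0] := eqVneq (len c) 0.
    have [-> ->] := chen_diag wc c0; have [-> ->] := chen_diag vc c0.
    by rewrite !subr0 !normr0 c0 !powR0 ?mulr0// ?mulf_neq0// gt_eqF.
  by have lc : 0 < len c by [rewrite lt_def c0 len_ge0]; split; [exact: h1|exact: h2].
by apply/andP; split; apply/holder_norm_leP => c _; have [] := H c.
Qed.

Lemma holder_dist_ge0 w v : (0 <= holder_dist alpha w v)%E.
Proof.
have T0 : 0 <= T%:num <= T%:num by rewrite lexx andbT.
have z0 : 0 <= (0 : R) <= T%:num by rewrite lexx/=.
have zT : \val (to_time T 0) <= \val (to_time T T%:num).
  by rewrite (to_timeK z0) (to_timeK T0).
pose c := mksimplex zT.
have c0 : 0 < len c by rewrite /len (to_timeK z0) (to_timeK T0) subr0.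
rewrite /holder_dist le_max; apply/orP; left; apply: ereal_sup_ge.
exists (`|(w.1 \- v.1) c| / len c `^ alpha)%:E; first by exists c.
by rewrite lee_fin divr_ge0// powR_ge0.
Qed.

Lemma holder_dist_cvg0P (L : nat -> two_level T d) w :
  (fun n => holder_dist alpha (L n) w) @ \oo --> 0%E <->
  forall e : R, 0 < e -> \forall n \near \oo, (holder_dist alpha (L n) w <= e%:E)%E.
Proof.
split=> [/fine_cvgP[fin /cvgrPdist_le cv] e e0|H].
  near=> n; have f : holder_dist alpha (L n) w \is a fin_num by near: n.
  rewrite -(fineK f) lee_fin (le_trans (ler_norm _))//.
  by rewrite -normrN -sub0r; near: n; exact: cv.
have bd n (e : R) : (holder_dist alpha (L n) w <= e%:E)%E ->
    exists2 r : R, holder_dist alpha (L n) w = r%:E & 0 <= r <= e.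
  have := holder_dist_ge0 (L n) w; case: (holder_dist alpha (L n) w) => [r| |]//.
  by rewrite !lee_fin => r0 re; exists r => //; rewrite r0.
apply/fine_cvgP; split.
  by apply: filterS (H 1 ltr01) => n /bd[r ->].
apply/cvgrPdist_le => e e0; apply: filterS (H e e0) => n /bd[r rE /andP[r0 re]].
rewrite /= rE.
by rewrite sub0r normrN ger0_norm.
Unshelve. all: by end_near. Qed.

Lemma holder_dist_cvg (L : nat -> two_level T d) w : (forall n, chen (L n)) -> chen w ->
  (forall e : R, 0 < e -> \forall n \near \oo, (holder_dist alpha (L n) w <= e%:E)%E) ->
  forall c, (L n).1 c @[n --> \oo] --> w.1 c /\ (L n).2 c @[n --> \oo] --> w.2 c.
Proof.
move=> Lc wc H c.
have main (b e : R) : 0 < e -> exists2 e' : R, 0 < e' & e' * len c `^ b <= e.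
  move=> e0; exists (e / (len c `^ b + 1)).
    by rewrite divr_gt0// ltr_wpDl// powR_ge0.
  by rewrite mulrAC ler_pdivrMr ?ltr_wpDl ?powR_ge0// ler_pM2l// lerDl.
split; apply/cvgrPdist_le => e e0.
  have [e' e'0 e'e] := main alpha e e0; apply: filterS (H e' e'0) => n.
  by move=> /(holder_dist_leP _ (Lc n) wc)/(_ c)[h _]; rewrite distrC (le_trans h).
have [e' e'0 e'e] := main (2 * alpha) e e0; apply: filterS (H e' e'0) => n.
by move=> /(holder_dist_leP _ (Lc n) wc)/(_ c)[_ h]; rewrite distrC (le_trans h).
Qed.

(** The limit is taken entrywise. Chen's relation and the Cauchy inequalities pass to pointwise
    limits, and [w] inherits its bounds from a single [L n] at distance at most 1. *)
Lemma holder_complete (L : nat -> two_level T d) :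
  (forall n, chen (L n)) -> (forall n, rough_bounds alpha (L n)) ->
  (forall e : R, 0 < e -> exists N, forall k l, (N <= k)%N -> (N <= l)%N ->
     (holder_dist alpha (L k) (L l) < e%:E)%E) ->
  exists w, rough_path alpha w /\
    forall e : R, 0 < e -> \forall n \near \oo, (holder_dist alpha (L n) w <= e%:E)%E.
Proof.
move=> Lc Lb LC.
have LC' (e : R) : 0 < e -> exists N, forall k l, (N <= k)%N -> (N <= l)%N -> forall c,
     `|(L k).1 c - (L l).1 c| <= e * len c `^ alpha /\
     `|(L k).2 c - (L l).2 c| <= e * len c `^ (2 * alpha).
  move=> /LC[N NP]; exists N => k l Nk Nl; apply/holder_dist_leP => //.
  by apply: ltW; exact: NP.
have real_cauchy (u : nat -> R) (b : R) : 0 <= b -> (forall e : R, 0 < e -> exists N,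
    forall k l, (N <= k)%N -> (N <= l)%N -> `|u k - u l| <= e * b) -> u @ \oo --> lim (u @ \oo).
  move=> b0 uC; apply: cauchy_cvg; apply: cauchy_exP => e e0.
  have [|N NP] := uC (e / (b + 1)); first by rewrite divr_gt0// ltr_wpDl.
  exists (u N); change (\forall k \near \oo, ball (u N) e (u k)); near=> k.
  rewrite -ball_normE /=; apply: (le_lt_trans (NP N k _ _)) => //.
    by near: k; exact: nbhs_infty_ge.
  by rewrite mulrAC ltr_pdivrMr ?ltr_wpDl// ltr_pM2l// ltrDl.
pose w : two_level T d := (fun c => \row_j lim ((L n).1 c ord0 j @[n --> \oo]),
  fun c => \matrix_(j, k) lim ((L n).2 c j k @[n --> \oo])).
have w1 c j : (L n).1 c ord0 j @[n --> \oo] --> w.1 c ord0 j.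
  rewrite mxE; apply: (real_cauchy _ (len c `^ alpha)); first exact: powR_ge0.
  move=> e /LC'[N NP]; exists N => k l Nk Nl; have [h _] := NP _ _ Nk Nl c.
  by apply: le_trans h; have := le_entry_norm ((L k).1 c - (L l).1 c) ord0 j; rewrite !mxE.
have w2 c j k : (L n).2 c j k @[n --> \oo] --> w.2 c j k.
  rewrite mxE; apply: (real_cauchy _ (len c `^ (2 * alpha))); first exact: powR_ge0.
  move=> e /LC'[N NP]; exists N => n l Nn Nl; have [_ h] := NP _ _ Nn Nl c.
  by apply: le_trans h; have := le_entry_norm ((L n).2 c - (L l).2 c) j k; rewrite !mxE.
have w1' c : (L n).1 c @[n --> \oo] --> w.1 c.
  by apply: cvg_entries => i j; rewrite ord1; exact: w1.
have w2' c : (L n).2 c @[n --> \oo] --> w.2 c.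
  by apply: cvg_entries => i j; exact: w2.
have wc : chen w.
  move=> a b c ac ab bc; split.
    have E : (fun n => (L n).1 c) = fun n => (L n).1 a + (L n).1 b.
      by apply/funext => n; exact: (proj1 (Lc n a b c ac ab bc)).
    have := w1' c; rewrite E => /cvg_unique; apply => //; exact: cvgD.
  apply/matrixP => j k; rewrite [RHS]mxE [X in _ = X + _]mxE [X in _ = _ + X]mxE big_ord1.
  rewrite [X in _ = _ + X * _]mxE.
  have E : (fun n => (L n).2 c j k) =
      fun n => (L n).2 a j k + (L n).2 b j k + (L n).1 a ord0 j * (L n).1 b ord0 k.
    by apply/funext => n; rewrite (proj2 (Lc n a b c ac ab bc)) !mxE big_ord1 mxE.
  have := w2 c j k; rewrite E => /cvg_unique; apply => //.
  by apply: cvgD; [apply: cvgD; exact: w2|apply: cvgM; exact: w1].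
have Lw (e : R) : 0 < e -> \forall n \near \oo, (holder_dist alpha (L n) w <= e%:E)%E.
  move=> /LC'[N NP]; near=> n; apply/holder_dist_leP => // c.
  have Nn : (N <= n)%N by near: n; exact: nbhs_infty_ge.
  have H1 : `|(L n).1 c - (L l).1 c| @[l --> \oo] --> `|(L n).1 c - w.1 c|.
    by apply: cvg_norm; apply: cvgB; [exact: cvg_cst|exact: w1'].
  have H2 : `|(L n).2 c - (L l).2 c| @[l --> \oo] --> `|(L n).2 c - w.2 c|.
    by apply: cvg_norm; apply: cvgB; [exact: cvg_cst|exact: w2'].
  split.
    apply: (cvgr_to_le H1); near=> l; apply: (proj1 (NP n l Nn _ c)).
    by near: l; exact: nbhs_infty_ge.
  apply: (cvgr_to_le H2); near=> l; apply: (proj2 (NP n l Nn _ c)).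
  by near: l; exact: nbhs_infty_ge.
exists w; split=> //; apply: chen_rough_path => //.
have [n /(holder_dist_leP _ (Lc n) wc) nP] := filter_ex (Lw 1 ltr01).
have [b1 b2] := Lb n; split=> [j|j k].
  have : bigO setT (@len R T) alpha (fun c => (L n).1 c ord0 j - w.1 c ord0 j).
    exists 1 => c _; apply: (le_trans _ (proj1 (nP c))).
    by have := le_entry_norm ((L n).1 c - w.1 c) ord0 j; rewrite !mxE.
  by move=> /(bigO_sub (b1 j)); apply: eq_bigO => c _; ring.
have : bigO setT (@len R T) (2 * alpha) (fun c => (L n).2 c j k - w.2 c j k).
  exists 1 => c _; apply: (le_trans _ (proj2 (nP c))).
  by have := le_entry_norm ((L n).2 c - w.2 c) j k; rewrite !mxE.
by move=> /(bigO_sub (b2 j k)); apply: eq_bigO => c _; ring.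
Unshelve. all: by end_near. Qed.

End holder_distance.

Section geometric_rough_paths.
Context {R : realType} {T : {posnum R}} {d : nat} (alpha : R).
Hypothesis alpha_gt0 : 0 < alpha.
Hypothesis alpha_lt : alpha < 1 / 2.

Lemma holder_dist_le_sym (v w : two_level T d) (e : R) : chen v -> chen w ->
  (holder_dist alpha v w <= e%:E)%E -> (holder_dist alpha w v <= e%:E)%E.
Proof.
move=> vc wc /(holder_dist_leP alpha_gt0 _ vc wc) H.
apply/(holder_dist_leP alpha_gt0 _ wc vc) => c.
by have [h1 h2] := H c; rewrite distrC [X in _ /\ X <= _]distrC.
Qed.

(** Integration by parts for lifts of Lipschitz paths, carried to their closure: small distance
    implies convergence of both levels at each [c]. *)
Lemma geometric_symmetric (w : two_level T d) : geometric_rough_path alpha w ->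
  forall c j k, w.2 c j k + w.2 c k j = w.1 c ord0 j * w.1 c ord0 k.
Proof.
move=> [[_ _ wc _ _] H] c j k.
have /choice[v vP] : forall n : nat, exists v : time T -> 'rV[R]_d, lipschitz_path v /\
    (holder_dist alpha w (natural_lift v) <= n.+1%:R^-1%:E)%E.
  move=> n; have [v [vL _ vn]] := H n.+1%:R^-1 (ltac:(by rewrite invr_gt0)).
  by exists v; split=> //; exact: ltW.
pose L n := natural_lift (v n).
have Lc n : chen (L n) by apply: lift_chen; have [] := vP n.
have Lw (e : R) : 0 < e -> \forall n \near \oo, (holder_dist alpha (L n) w <= e%:E)%E.
  move=> e0; near=> n; have [_ h] := vP n.
  apply: (le_trans (holder_dist_le_sym wc (Lc n) h)); rewrite lee_fin.
  by apply: ltW; near: n; exact: (near_infty_natSinv_lt (PosNum e0)).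
have [w1 w2] := holder_dist_cvg alpha_gt0 Lc wc Lw c.
have h1 : (L n).1 c ord0 j * (L n).1 c ord0 k @[n --> \oo] --> w.1 c ord0 j * w.1 c ord0 k.
  by apply: cvgM; exact: cvg_entry.
have h2 : (L n).2 c j k + (L n).2 c k j @[n --> \oo] --> w.2 c j k + w.2 c k j.
  by apply: cvgD; exact: cvg_entry.
have E : (fun n => (L n).2 c j k + (L n).2 c k j) =
    fun n => (L n).1 c ord0 j * (L n).1 c ord0 k.
  by apply/funext => n; apply: lift_symmetric; have [] := vP n.
by rewrite E in h2; exact: cvg_unique h2 h1.
Unshelve. all: by end_near. Qed.

(** Completeness supplies a limit, which is geometric because the approximations are Lipschitz and
    start at 0. Hence the set inside [xget] is nonempty and the chosen element is a limit of the
    lifts. *)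
Lemma brownian_rough_path_cvg (w0 : GOmega alpha T d) (w : C0 T d) : lifts_cauchy alpha w ->
  forall c, (natural_lift (dyadic_approx w l)).1 c @[l --> \oo]
              --> (\val (brownian_rough_path w0 w)).1 c /\
            (natural_lift (dyadic_approx w l)).2 c @[l --> \oo]
              --> (\val (brownian_rough_path w0 w)).2 c.
Proof.
move=> wC; pose L l := natural_lift (dyadic_approx w l).
have vL l := dyadic_approx_lipschitz w l.
have Lc l : chen (L l) := lift_chen (vL l).
have Lb l : rough_bounds alpha (L l) := lift_bounds (vL l) alpha_gt0 alpha_lt.
have [W [Wr LW]] := holder_complete alpha_gt0 Lc Lb wC.
have Wc : chen W by case: Wr.
have WG : geometric_rough_path alpha W.
  (* Half of [e], because the limit gives a weak inequality and the closure asks for a strict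
     one. *)
  split=> // e e0; have e20 : 0 < e / 2 by rewrite divr_gt0.
  have [l lP] := filter_ex (LW (e / 2) e20); exists (dyadic_approx w l); split=> //.
    by rewrite dyadic_approx0; have [] := set_valP w.
  apply: (le_lt_trans (holder_dist_le_sym (Lc l) Wc lP)); rewrite lte_fin.
  by rewrite ltr_pdivrMr// ltr_pMr// ltr1n.
rewrite /brownian_rough_path asboolT//; case: xgetP => [B _ /holder_dist_cvg0P BP|].
  have Bc : chen (\val B) by case: (set_valP B) => -[].
  exact: (holder_dist_cvg alpha_gt0 Lc Bc BP).
by move=> /(_ (SigSub (mem_set WG))); case; apply/holder_dist_cvg0P.
Qed.

End geometric_rough_paths.

(** * Measurability *)

Section measurability_tools.

Lemma continuous_borel_measurable {R : realType} {X : ptopologicalType} (f : X -> R) :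
  continuous f -> measurable_fun setT (f : borel X -> R).
Proof.
move=> /continuousP cf; apply: (measurability _ (RGenOpens.measurableE R)).
move=> _ [_ [a [b ->] <-]]; rewrite setTI; apply: sub_sigma_algebra.
exact/cf/interval_open.
Qed.

Lemma countable_bigcapT_measurable {d : measure_display} {X : measurableType d} {U : Type}
    (F : U -> set X) : countable [set: U] -> (forall i, measurable (F i)) ->
  measurable (\bigcap_i F i).
Proof.
move=> cU mF; rewrite -[X in measurable X]setCK setC_bigcap; apply: measurableC.
by apply: countable_bigcupT_measurable => // i; exact: measurableC.
Qed.

Lemma sequentially_closed_measurable {R : realType} {d : measure_display}
    {X : measurableType d} (e : nat -> X -> R) (A : set X) :
  (forall k, measurable_fun setT (e k)) ->
  (forall (x_ : nat -> X) x, (forall n, A (x_ n)) ->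
    (forall k, e k (x_ n) @[n --> \oo] --> e k x) -> A x) ->
  measurable A.
Proof.
move=> me cA.
pose B n (q : seq rat) := [set x | forall k, (k < n)%N -> `|e k x - ratr q`_k| < n.+1%:R^-1 :> R].
(* [A] is the intersection over [n] of the union of those rational boxes of radius 1/(n+1)
   in the first [n] coordinates that meet [A]. *)
have -> : A = \bigcap_n \bigcup_q (if `[< B n q `&` A !=set0 >] then B n q else set0).
  apply/seteqP; split=> [x Ax n _|x Bx].
    have /choice[r rP] : forall k, exists r : rat, `|e k x - ratr r| < n.+1%:R^-1 :> R.
      move=> k; have /rat_in_itvoo[r] : e k x - n.+1%:R^-1 < e k x + n.+1%:R^-1.
        by rewrite ltrBlDr -addrA ltrDl addr_gt0// invr_gt0.
      rewrite in_itv/= => /andP[r1 r2]; exists r; rewrite ltr_norml.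
      by move: (e k x) (ratr r) n.+1%:R^-1 r1 r2 => a q i r1 r2; apply/andP; split; lra.
    have Bx : B n (mkseq r n) x by move=> k kn; rewrite nth_mkseq.
    by exists (mkseq r n) => //; rewrite asboolT//; exists x.
  (* A point of [A] in the same box as [x] agrees with it up to 2/(n+1) in the first n coordinates;
     these points converge to [x] in all coordinates, and closedness puts [x] in [A]. *)
  have /choice[y yP] : forall n, exists y, A y /\
      forall k, (k < n)%N -> `|e k x - e k y| < 2 * n.+1%:R^-1.
    move=> n; have [q _] := Bx n I; case: asboolP => // -[y [By Ay]] Bxq.
    exists y; split=> // k kn; rewrite -(subrKA (ratr q`_k)).
    apply: (le_lt_trans (ler_normD _ _)); rewrite [X in _ < X]mulr_natl mulr2n ltrD//.
      exact: Bxq.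
    by rewrite distrC; exact: By.
  apply: (cA y x) => [n|k]; first by have [] := yP n.
  apply/cvgrPdist_lt => eps eps0; near=> n.
  have [_ /(_ k)] := yP n; move=> /(_ _)/lt_trans; apply.
    by near: n; exact: nbhs_infty_gt.
  rewrite -ltr_pdivlMl// mulrC; near: n.
  have eps2 : 0 < eps / 2 by rewrite divr_gt0.
  exact: (near_infty_natSinv_lt (PosNum eps2)).
apply: countable_bigcapT_measurable => // n.
apply: countable_bigcupT_measurable => // q; case: asboolP => // _.
have -> : B n q = \bigcap_k [set x | (k < n)%N -> `|e k x - ratr q`_k| < n.+1%:R^-1 :> R].
  by apply/seteqP; split=> [x Bx k _|x Bx k]; [exact: Bx|exact: (Bx k I)].
apply: countable_bigcapT_measurable => // k.
have [kn|kn] := boolP (k < n)%N; last first.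
  by rewrite (_ : [set x | _] = setT)//; apply/seteqP; split.
have m1 : measurable_fun setT (fun x => `|e k x - ratr q`_k|).
  by apply: measurableT_comp => //; exact: measurable_funB.
rewrite (_ : [set x | _] = setT `&` (fun x => `|e k x - ratr q`_k|) @^-1`
    [set` `]-oo, n.+1%:R^-1[]); first exact: (m1 measurableT).
apply/seteqP; split=> [x /= h|x /= []]; rewrite in_itv/=; first by split=> //; exact: h.
by move=> _ h _.
Unshelve. all: by end_near. Qed.

End measurability_tools.

Section simplex_grid.
Context {R : realType} {T : {posnum R}}.

Lemma to_time_mono (r s : R) : r <= s -> \val (to_time T r) <= \val (to_time T s).
Proof.
move=> rs /=; rewrite ge_max !le_max lexx/= ge_min !le_min.
by case: (leP r T%:num) => rT; case: (leP s T%:num) => sT; rewrite ?rs ?lexx ?orbT//=; lra.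
Qed.

Let ratio (l a : nat) : R := a%:R / l.+1%:R.

Let ratio_le l a b : ratio l (minn a b) <= ratio l b.
Proof. by rewrite ler_wpM2r// ler_nat geq_minr. Qed.

(** A label (l, a, b) gives the times a/(l+1) and b/(l+1), clamped to [0, T]. The minimum of a and b
    as first numerator makes every triple of integers a valid label. *)
Definition grid_point (lab : nat * nat * nat) : simplex T :=
  mksimplex (to_time_mono (ratio_le lab.1.1 lab.1.2 lab.2)).

Lemma grid_dense (c : simplex T) :
  exists q : nat -> nat * nat * nat, grid_point (q n) @[n --> \oo] --> c.
Proof.
pose fl n (t : time T) := Num.truncn (\val t * n.+1%:R).
have flP n (t : time T) : \val t - n.+1%:R^-1 <= ratio n (fl n t) <= \val t.
  have /andP[h1 h2] : (fl n t)%:R <= \val t * n.+1%:R < (fl n t).+1%:R.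
    by apply: truncn_itv; rewrite mulr_ge0// time_ge0.
  apply/andP; split; last by rewrite ler_pdivrMr.
  rewrite lerBlDr -[X in _ + X]mul1r -mulrDl natr1 ler_pdivlMr//; exact: ltW.
have flE n t : \val (to_time T (ratio n (fl n t))) = ratio n (fl n t).
  have /andP[_ h] := flP n t; rewrite to_timeK// divr_ge0//=.
  exact: le_trans h (time_le t).
have fl_cvg (t : time T) : \val (to_time T (ratio n (fl n t))) @[n --> \oo] --> \val t.
  have h : \val t - n.+1%:R^-1 @[n --> \oo] --> \val t - 0.
    by apply: cvgB; [exact: cvg_cst|exact: cvg_harmonic].
  rewrite subr0 in h; under eq_fun do rewrite flE.
  apply: (squeeze_cvgr _ h (cvg_cst _)); apply: nearW => n; exact: flP.
exists (fun n => (n, fl n (src c), fl n (tgt c))); apply: cvg_simplex => /=; last exact: fl_cvg.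
(* Rounding down preserves the order of the two times, so the minimum in [grid_point] has no effect
   here. *)
have E n : minn (fl n (src c)) (fl n (tgt c)) = fl n (src c).
  apply/minn_idPl; apply: le_truncn; rewrite ler_wpM2r//; exact: simplex_le.
by under eq_fun do rewrite E; exact: fl_cvg.
Qed.

End simplex_grid.

(** * Measurability of the Brownian rough path *)

Section brownian_measurability.
Context {R : realType} {T : {posnum R}} {d : nat} (alpha : R).
Hypothesis alpha_gt0 : 0 < alpha.
Hypothesis alpha_lt : alpha < 1 / 2.
Local Notation X := (borel (C0 T d)).
Implicit Type c : simplex T.

Lemma evaluation_continuous (t : time T) (k : 'I_d) :
  continuous (fun w : C0 T d => (w : time T -> 'rV[R]_d) t ord0 k).
Proof.
move=> w A wA; have : nbhs ((w : C0 T d) t) [set y : 'rV[R]_d | A (y ord0 k)].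
  exact: (@matrix_normedtype.coord_continuous R 1 d ord0 k ((w : C0 T d) t) A wA).
move=> /nbhsP[E entE EA].
have wE : nbhs (\val w : {uniform time T -> 'rV[R]_d}) [set h | A (h t ord0 k)].
  apply/uniform_nbhs; exists E; split=> // h hE.
  by apply: EA; apply/xsectionP; exact: hE.
exact: (@val_continuous {uniform time T -> 'rV[R]_d} (@C0_set R T d) w _ wE).
Qed.

Lemma dyadic_approx_measurable l (t : time T) (k : 'I_d) :
  measurable_fun setT (fun w : X => dyadic_approx (w : C0 T d) l t ord0 k).
Proof.
have m s : measurable_fun setT (fun w : X => (w : C0 T d) s ord0 k).
  exact: continuous_borel_measurable (@evaluation_continuous s k).
pose h : R := T%:num / 2 ^+ l; pose j := Num.truncn (\val t / h).
pose s0 := to_time T (j%:R * h); pose s1 := to_time T (j.+1%:R * h).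
have -> : (fun w : X => dyadic_approx (w : C0 T d) l t ord0 k) = fun w : X =>
    (w : C0 T d) s0 ord0 k + ((\val t - j%:R * h) / h) *
      ((w : C0 T d) s1 ord0 k - (w : C0 T d) s0 ord0 k).
  by apply/funext => w; rewrite /dyadic_approx !mxE.
by apply: measurable_funD => //; apply: measurable_funM => //; exact: measurable_funB.
Qed.

Lemma lift_level1_measurable l c (k : 'I_d) :
  measurable_fun setT (fun w : X => (natural_lift (dyadic_approx (w : C0 T d) l)).1 c ord0 k).
Proof.
under eq_fun do rewrite lift_level1.
by apply: measurable_funB; exact: dyadic_approx_measurable.
Qed.

(** The integral is the limit of Riemann sums on uniform partitions, each a polynomial in finitely
    many values of the path. *)
Lemma lift_level2_measurable l c (j k : 'I_d) :
  measurable_fun setT (fun w : X => (natural_lift (dyadic_approx (w : C0 T d) l)).2 c j k).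
Proof.
have m := dyadic_approx_measurable l.
apply: (@measurable_fun_cvg _ _ _ setT (fun n (w : X) => \sum_(i < n.+1)
   (dyadic_approx (w : C0 T d) l (to_time T (unode (\val (src c)) (\val (tgt c)) n i))
     - dyadic_approx (w : C0 T d) l (src c)) ord0 j
   * (dyadic_approx (w : C0 T d) l (to_time T (unode (\val (src c)) (\val (tgt c)) n i.+1)) ord0 k
      - dyadic_approx (w : C0 T d) l (to_time T (unode (\val (src c)) (\val (tgt c)) n i)) ord0 k))).
  move=> n; apply: measurable_sum => i; apply: measurable_funM; last exact: measurable_funB.
  apply: (@eq_measurable_fun _ _ _ _ setT (fun w : X =>
      dyadic_approx (w : C0 T d) l (to_time T (unode (\val (src c)) (\val (tgt c)) n i)) ord0 j
      - dyadic_approx (w : C0 T d) l (src c) ord0 j)); last exact: measurable_funB.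
  have sub (a b : 'rV[R]_d) : a ord0 j - b ord0 j = (a - b) ord0 j by rewrite !mxE.
  by move=> w _; exact: sub.
move=> w _; have := @lift_level2_cvg _ _ _ _ (dyadic_approx_lipschitz (w : C0 T d) l) c j k.
exact.
Qed.

(** Continuity in [c] reduces the supremum to the countable grid, which makes bounds on the distance
    measurable conditions. Degenerate intervals are again settled by [chen_diag]. *)
Lemma holder_dist_grid (w v : two_level T d) (e : R) : 0 <= e ->
  rough_path alpha w -> rough_path alpha v ->
  (holder_dist alpha w v <= e%:E)%E <->
  forall q, let c := grid_point q in
    (forall k, `|w.1 c ord0 k - v.1 c ord0 k| <= e * len c `^ alpha) /\
    (forall j k, `|w.2 c j k - v.2 c j k| <= e * len c `^ (2 * alpha)).
Proof.
move=> e0 [w1 w2 wc _ _] [v1 v2 vc _ _]; split=> [/(holder_dist_leP alpha_gt0 _ wc vc) H q c|H].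
  have [h1 h2] := H c; split=> [k|j k].
    by apply: le_trans h1; have := le_entry_norm (w.1 c - v.1 c) ord0 k; rewrite !mxE.
  by apply: le_trans h2; have := le_entry_norm (w.2 c - v.2 c) j k; rewrite !mxE.
apply/(holder_dist_leP alpha_gt0 _ wc vc) => c.
have [c0|c0] := eqVneq (len c) 0.
  have [-> ->] := chen_diag wc c0; have [-> ->] := chen_diag vc c0.
  by rewrite !subr0 !normr0 c0 !powR0 ?mulr0// ?mulf_neq0// gt_eqF.
have lc : 0 < len c by rewrite lt_def c0 len_ge0.
have [q qc] := @grid_dense R T c.
have lq b : e * len (grid_point (q n) : simplex T) `^ b @[n --> \oo] --> e * len c `^ b.
  have lq : len (grid_point (q n) : simplex T) @[n --> \oo] --> len c.
    exact: (cvg_comp _ _ qc (@len_continuous R T c)).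
  apply: cvgMr; exact: (cvg_comp _ _ lq (@powR_continuous_pos _ b _ lc)).
split; apply: le_norm_entry => [|i j]; rewrite ?mulr_ge0 ?powR_ge0// !mxE.
  have h : `|w.1 (grid_point (q n)) i j - v.1 (grid_point (q n)) i j| @[n --> \oo] -->
      `|w.1 c i j - v.1 c i j|.
    by apply: cvg_norm; apply: cvgB; apply: cvg_entry;
      apply: (cvg_comp _ _ qc); [exact: w1|exact: v1].
  by apply: (ler_cvg_to h (lq alpha)); apply: nearW => n; rewrite ord1; have [] := H (q n).
have h : `|w.2 (grid_point (q n)) i j - v.2 (grid_point (q n)) i j| @[n --> \oo] -->
    `|w.2 c i j - v.2 c i j|.
  by apply: cvg_norm; apply: cvgB; apply: cvg_entry;
    apply: (cvg_comp _ _ qc); [exact: w2|exact: v2].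
by apply: (ler_cvg_to h (lq (2 * alpha))); apply: nearW => n; have [] := H (q n).
Qed.

End brownian_measurability.

Section brownian_coordinates.
Context {R : realType} {T : {posnum R}} {d : nat} (alpha : R).
Hypothesis alpha_gt0 : 0 < alpha.
Hypothesis alpha_lt : alpha < 1 / 2.
Local Notation X := (borel (C0 T d)).
Local Notation L w l := (natural_lift (dyadic_approx (w : C0 T d) l)).

Lemma lifts_cauchy_measurable : measurable ([set w | lifts_cauchy alpha (w : C0 T d)] : set X).
Proof.
have rp (w : C0 T d) l : rough_path alpha (L w l).
  exact: (lift_rough_path (dyadic_approx_lipschitz w l)).
pose A n k l : set X := [set w | (holder_dist alpha (L w k) (L w l) <= (n.+1%:R^-1)%:E)%E].
have -> : [set w | lifts_cauchy alpha (w : C0 T d)] =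
    \bigcap_n \bigcup_N \bigcap_k \bigcap_l A n (N + k)%N (N + l)%N.
  apply/seteqP; split=> [w wC n _|w H e e0].
    have [|N NP] := wC n.+1%:R^-1; first by rewrite invr_gt0.
    by exists N => // k _ l _; apply: ltW; apply: NP; exact: leq_addr.
  have [n ne] := filter_ex (near_infty_natSinv_lt (PosNum e0)).
  have [N _ NP] := H n I; exists N => k l Nk Nl.
  have := NP (k - N)%N I (l - N)%N I; rewrite /A/= !subnKC// => /le_lt_trans; apply.
  by rewrite lte_fin.
apply: countable_bigcapT_measurable => // n; apply: countable_bigcupT_measurable => // N.
apply: countable_bigcapT_measurable => // k0; apply: countable_bigcapT_measurable => // l0.
move: (N + k0)%N (N + l0)%N => k l {k0 l0 N}.
pose B1 q (i : 'I_d) : set X := [set w | let c := grid_point q in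
  `|(L w k).1 c ord0 i - (L w l).1 c ord0 i| <= n.+1%:R^-1 * len c `^ alpha].
pose B2 q (i j : 'I_d) : set X := [set w | let c := grid_point q in
  `|(L w k).2 c i j - (L w l).2 c i j| <= n.+1%:R^-1 * len c `^ (2 * alpha)].
have -> : A n k l = \bigcap_q ((\bigcap_i B1 q i) `&` \bigcap_i \bigcap_j B2 q i j).
  have n0 : (0 : R) <= n.+1%:R^-1 by rewrite invr_ge0.
  apply/seteqP; split=> [w /(holder_dist_grid alpha_gt0 n0 (rp w k) (rp w l)) H q _|w H].
    by have [h1 h2] := H q; split=> [i _|i _ j _]; [exact: h1|exact: h2].
  apply/(holder_dist_grid alpha_gt0 n0 (rp w k) (rp w l)) => q.
  by have [h1 h2] := H q I; split=> [i|i j]; [exact: h1|exact: (h2 i I j I)].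
have sub (f g : X -> R) b : measurable_fun setT f -> measurable_fun setT g ->
    measurable [set w | `|f w - g w| <= b].
  move=> mf mg; rewrite (_ : [set w | _] = setT `&` (fun w => `|f w - g w|) @^-1` [set` `]-oo, b]]).
    have m : measurable_fun setT (fun w => `|f w - g w|).
      by apply: measurableT_comp => //; exact: measurable_funB.
    exact: (m measurableT).
  by apply/seteqP; split=> [w /= h|w /= []]; rewrite in_itv/=.
apply: countable_bigcapT_measurable => // q; apply: measurableI.
  apply: countable_bigcapT_measurable => [|i]; first exact: countableP.
  by apply: sub; exact: lift_level1_measurable.
apply: countable_bigcapT_measurable => [|i]; first exact: countableP.
apply: countable_bigcapT_measurable => [|j]; first exact: countableP.
by apply: sub; exact: lift_level2_measurable.
Qed.

Variable w0 : GOmega alpha T d.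
Local Notation W w := (\val (brownian_rough_path w0 (w : C0 T d))).

(** On the measurable set where the lifts are Cauchy, the function is a pointwise limit of
    measurable ones; off that set it is constant. *)
Let brownian_limit_measurable (f : two_level T d -> R) :
  (forall l, measurable_fun setT (fun w : X => f (L w l))) ->
  (forall w : C0 T d, lifts_cauchy alpha w -> f (L w l) @[l --> \oo] --> f (W w)) ->
  measurable_fun setT (fun w : X => f (W w)).
Proof.
move=> mf cf; have mC := lifts_cauchy_measurable.
rewrite -(setUv [set w | lifts_cauchy alpha (w : C0 T d)]); apply/measurable_funU => //.
  exact: measurableC.
split.
  apply: (@measurable_fun_cvg _ _ _ _ (fun l (w : X) => f (L w l))) => [l|w wC].
    exact: measurable_funTS.
  exact: cf.
apply: (@eq_measurable_fun _ _ _ _ _ (fun=> f (\val w0))); last exact: measurable_cst.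
by move=> w; rewrite inE /= => wC; rewrite /brownian_rough_path asboolF.
Qed.

Lemma brownian_level1_measurable c i : measurable_fun setT (fun w : X => (W w).1 c ord0 i).
Proof.
apply: (@brownian_limit_measurable (fun L => L.1 c ord0 i)) => [l|w wC].
  exact: lift_level1_measurable.
have [h _] := brownian_rough_path_cvg alpha_gt0 alpha_lt w0 wC c.
exact: cvg_entry h.
Qed.

Lemma brownian_level2_measurable c i j : measurable_fun setT (fun w : X => (W w).2 c i j).
Proof.
apply: (@brownian_limit_measurable (fun L => L.2 c i j)) => [l|w wC].
  exact: lift_level2_measurable.
have [_ h] := brownian_rough_path_cvg alpha_gt0 alpha_lt w0 wC c.
exact: cvg_entry h.
Qed.

End brownian_coordinates.

Lemma dense_sequence {X : ptopologicalType} : separable X ->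
  exists q : nat -> X, forall (x : X) A, nbhs x A -> exists n, A (q n).
Proof.
move=> [D /pfcard_geP[D0|[q]] dD].
  have [x []] : setT `&` D !=set0 by apply: dD; [exists point|exact: openT].
  by rewrite D0.
exists q => x A; rewrite nbhsE => -[B [oB Bx] BA].
have [y [By /(@surj _ _ _ _ q)[n _ qn]]] := dD _ (ex_intro _ x Bx) oB.
by exists n; apply: BA; rewrite qn.
Qed.

(** A point of the dense sequence within e/2 of [m] is eventually within e/2 of [m_ j]. So countably
    many distances encode the topology of [M]. *)
Lemma cvg_mdist_dense {R : realType} {M : pmetricType R} (q : nat -> M)
    {J : Type} (G : set_system J) {FG : Filter G} (m_ : J -> M) m :
  (forall (x : M) A, nbhs x A -> exists n, A (q n)) ->
  (forall k, mdist (q k) (m_ j) @[j --> G] --> mdist (q k) m) -> m_ @ G --> m.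
Proof.
move=> dq H A /nbhs_mdist_ex[e e0 eA]; have e20 : 0 < e / 2 by rewrite divr_gt0.
have [k mk] := dq m _ (nbhs_mdist_lt m e20); rewrite /= metric_sym in mk.
have : \forall j \near G, mdist (q k) (m_ j) < e / 2.
  exact: (cvgr_lt _ (H k) _ mk).
apply: filterS => j mj; apply: eA; rewrite [e]splitr.
apply: (le_lt_trans (metric_triangle m (q k) (m_ j))); rewrite ltrD//.
by rewrite metric_sym.
Qed.

Lemma CL_paths_cvg {R : realType} {p : nat} {M : pmetricType R} {Z : metricType R}
    {T : {posnum R}} {F : foliation p M Z} {J : Type} (G : set_system J) {FG : Filter G}
    (x_ : J -> CL_paths T F) (x : CL_paths T F) :
  (forall e : R, 0 < e -> \forall j \near G, forall t, mdist (x t) (x_ j t) < e) ->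
  x_ @ G --> x.
Proof.
move=> H; apply: (@cvg_set_type {uniform time T -> M} (@CL_path_set R p M Z T F) _ G FG x_ x).
move=> A /uniform_nbhs[E [entE EA]]; move: entE; rewrite -entourage_ballE => -[e /= e0 eE].
apply: filterS (H e e0) => j xj; apply: EA => t _; apply: eE => /=.
by rewrite ballEmdist; exact: xj.
Qed.

Lemma sequentially_closed_measurable_count {R : realType} {d : measure_display}
    {X : measurableType d} {K : countType} (e : K -> X -> R) (A : set X) :
  (forall k, measurable_fun setT (e k)) ->
  (forall (x_ : nat -> X) x, (forall n, A (x_ n)) ->
    (forall k, e k (x_ n) @[n --> \oo] --> e k x) -> A x) ->
  measurable A.
Proof.
move=> me cA.
apply: (@sequentially_closed_measurable _ _ _
  (fun n => if unpickle n is Some k then e k else fun=> 0)) => [n|x_ x Ax ex].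
  by case: unpickle => [k|]; [exact: me|exact: measurable_cst].
by apply: (cA x_ x Ax) => k; have := ex (pickle k); rewrite pickleK.
Qed.

(** * Closedness of the controlled solutions and the conclusion *)

Section limit_of_solutions.
Context {R : realType} {p : nat} {M : pmetricType R} {Z : metricType R}.
Context {F : foliation p M Z} {d : nat} (alpha : R) {T : {posnum R}}.
Variables (V : 'I_d.+1 -> vector_field 3 F) (Phi : M -> GOmega alpha T d -> CL_paths T F).
Context {K : nat} (Ps : 'I_K -> piece F).
Hypothesis alpha_gt : 1 / 3 < alpha.
Hypothesis alpha_lt : alpha < 1 / 2.
Hypothesis cM : compact [set: M].
Hypothesis PhiP : lyons_ito_map V Phi.
Local Notation grid := (range (@grid_point R T)).

Let alpha_gt0 : 0 < alpha.
Proof. by apply: lt_trans alpha_gt; rewrite divr_gt0. Qed.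

Lemma controlled_solution (w : two_level T d) (x : time T -> M) m N :
  geometric_rough_path alpha w -> continuous x -> x (to_time T 0) = m ->
  controlled alpha V Ps grid N w x -> rde_solution alpha V m w x.
Proof.
move=> wG cx x0 xN; have [wr _] := wG; have [w1 w2 wc _ _] := wr.
split=> // f f3; apply: (controlled_err alpha_gt alpha_lt cM _ cx w1 w2
  (rough_path_bounds alpha_gt0 wr) (geometric_symmetric alpha_gt0 wG) xN f3).
move=> c; have [q qc] := grid_dense c; by exists (fun n => grid_point (q n)).
Qed.

(** The driving paths converge merely at each grid point; the common [N] compensates for the absence
    of convergence in the rough path distance. *)
Lemma limit_lyons_ito (N : nat) (C : set (CL_paths T F)) (m_ : nat -> M) m
    (w_ : nat -> GOmega alpha T d) (w : GOmega alpha T d) :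
  closed C -> (forall n, controlled alpha V Ps grid N (\val (w_ n)) (Phi (m_ n) (w_ n))) ->
  (forall n, C (Phi (m_ n) (w_ n))) -> m_ @ \oo --> m ->
  (forall q i, (\val (w_ n)).1 (grid_point q) ord0 i @[n --> \oo]
     --> (\val w).1 (grid_point q) ord0 i) ->
  (forall q i j, (\val (w_ n)).2 (grid_point q) i j @[n --> \oo]
     --> (\val w).2 (grid_point q) i j) ->
  controlled alpha V Ps grid N (\val w) (Phi m w) /\ C (Phi m w).
Proof.
move=> cC xN xC mm w1 w2; have [U UU oU] := ultra_nat_exists.
pose x_ n := Phi (m_ n) (w_ n).
have /choice[y yP] : forall t : time T, exists v : M, x_ n t @[n --> U] --> v.
  move=> t; have := cM; rewrite compact_ultra.
  move=> /(_ ((fun n => x_ n t) @ U) (ultra_fmap _ UU))[|v [_ Uv]]; last by exists v.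
  by apply: (@filterS _ U _ setT); [|exact: filterT].
have u1 c i : grid c -> (\val (w_ n)).1 c ord0 i @[n --> U] --> (\val w).1 c ord0 i.
  by move=> [q _ <-]; apply: cvg_trans (w1 q i); exact: cvg_app.
have u2 c i j : grid c -> (\val (w_ n)).2 c i j @[n --> U] --> (\val w).2 c i j.
  by move=> [q _ <-]; apply: cvg_trans (w2 q i j); exact: cvg_app.
have yN : controlled alpha V Ps grid N (\val w) y by exact: (limit_controlled xN yP u1 u2).
have cy : continuous y by exact: (limit_continuous alpha_gt0 xN yP).
have y0 : y (to_time T 0) = m.
  have h : m_ @ U --> m by apply: cvg_trans mm; exact: cvg_app.
  have E : (fun n => x_ n (to_time T 0)) = m_.
    by apply/funext => n; have [[_ -> _] _] := PhiP (m_ n) (w_ n).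
  have := yP (to_time T 0); rewrite E => h'.
  exact: (cvg_unique (@metric_hausdorff _ M) h' h).
(* Uniqueness holds among all continuous solutions, so it applies before [y] is known to stay in a
   leaf; that property then comes from the equality. *)
have yE : y = Phi m w.
  have [_ uniq] := PhiP m w; apply: uniq.
  exact: (controlled_solution (set_valP w) cy y0 yN).
rewrite -yE; split=> //.
have xU : x_ @ U --> Phi m w.
  apply: CL_paths_cvg => e e0; rewrite -yE.
  exact: (limit_uniform alpha_gt0 xN yP e0).
by apply: (closed_cvg C cC _ (Phi m w) xU); apply: filterE.
Qed.

(** An abstract [Y] keeps the Wiener space out of the argument: all that is asked of [W] is that its
    entries at each [c] be measurable. *)
Lemma lyons_ito_measurable {dY : measure_display} (Y : measurableType dY)
    (W : Y -> GOmega alpha T d) :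
  (forall m : M, exists k, nbhs m (core (Ps k))) ->
  (forall c i, measurable_fun setT (fun w => (\val (W w)).1 c ord0 i)) ->
  (forall c i j, measurable_fun setT (fun w => (\val (W w)).2 c i j)) ->
  measurable_fun setT (fun mw : borel M * Y => (Phi mw.1 (W mw.2) : borel (CL_paths T F))).
Proof.
move=> cov W1 W2.
have [q dq] := dense_sequence (separable_space F).
pose f (mw : borel M * Y) : CL_paths T F := Phi mw.1 (W mw.2).
suff closedP (C : set (CL_paths T F)) : closed C -> measurable (f @^-1` C).
  apply: (@measurability _ _ _ (borel (CL_paths T F)) _ _ (@open (CL_paths T F))) => //.
  move=> _ [B oB <-]; rewrite setTI -[X in measurable X]setCK; apply: measurableC.
  exact: (closedP (~` B) (open_closedC oB)).
move=> cC.
pose A N : set (borel M * Y) :=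
  [set mw | controlled alpha V Ps grid N (\val (W mw.2)) (f mw) /\ C (f mw)].
have -> : f @^-1` C = \bigcup_N A N.
  apply/seteqP; split=> [mw Cmw|mw [N _ []]//].
  have [sol _] := PhiP mw.1 (W mw.2); have [wr _] := set_valP (W mw.2).
  have [N NP] := solution_controlled alpha_gt alpha_lt grid sol
    (rough_path_bounds alpha_gt0 wr) cov.
  by exists N.
apply: bigcupT_measurable => N.
(* Countably many labels: distances of the initial point to the dense sequence, then first-level and
   second-level entries on the grid. *)
pose I := (nat + (nat * nat * nat) * 'I_d + (nat * nat * nat) * ('I_d * 'I_d))%type.
pose e (k : I) (mw : borel M * Y) : R := match k with
  | inl (inl n) => mdist (q n) mw.1
  | inl (inr (g, i)) => (\val (W mw.2)).1 (grid_point g) ord0 i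
  | inr (g, (i, j)) => (\val (W mw.2)).2 (grid_point g) i j
  end.
apply: (@sequentially_closed_measurable_count _ _ _ I e).
  move=> [[n|[g i]]|[g [i j]]].
  - have h : measurable_fun setT (fun m : borel M => mdist (q n) m).
      by apply: continuous_borel_measurable => m; exact: mdist_continuous.
    exact: (measurableT_comp h measurable_fst).
  - exact: (measurableT_comp (W1 (grid_point g) i) measurable_snd).
  - exact: (measurableT_comp (W2 (grid_point g) i j) measurable_snd).
move=> x_ x Ax ex; apply: (limit_lyons_ito cC (m_ := fun n => (x_ n).1)
  (w_ := fun n => W (x_ n).2)).
- by move=> n; have [] := Ax n.
- by move=> n; have [] := Ax n.
- by apply: (cvg_mdist_dense dq) => k; exact: (ex (inl (inl k))).
- by move=> g i; exact: (ex (inl (inr (g, i)))).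
- by move=> g i j; exact: (ex (inr (g, (i, j)))).
Qed.

End limit_of_solutions.

Theorem proposition5p2 (R : realType) (alpha : R) (T : {posnum R})
    (p d : nat) (M : pmetricType R) (Z : metricType R)
    (F : foliation p M Z) (V : 'I_d.+1 -> vector_field 3 F)
    (Phi : M -> GOmega alpha T d -> CL_paths T F)
    (mu : probability (borel (C0 T d)) R) (w0 : GOmega alpha T d) :
  1 / 3 < alpha < 1 / 2 ->
  compact [set: M] ->
  lyons_ito_map V Phi ->
  wiener_measure mu ->
  measurable_fun setT
    (fun mw : borel M * g_sigma_algebraType (completed_algebra_gen mu) =>
       (Phi mw.1 (brownian_rough_path w0 mw.2) : borel (CL_paths T F))).
Proof.
move=> /andP[a1 a2] cM PhiP _.
have a0 : 0 < alpha by apply: lt_trans a1; rewrite divr_gt0.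
have [K [Ps cov]] := finite_pieces F cM.
(* A Borel set is its own union with the empty negligible set, so Borel measurability of the entries
   of the rough path carries over to the completion. *)
have : @measurable _ (borel (C0 T d)) `<=` completed_algebra_gen mu.
  by move=> B mB; exists B => //; exists set0; [exact: negligible_set0|rewrite setU0].
(* Left visible, the completed sigma-algebra makes unification diverge. *)
move: (completed_algebra_gen mu) => S mS.
have mW (f : borel (C0 T d) -> R) : measurable_fun setT f ->
    measurable_fun setT (f : g_sigma_algebraType S -> R).
  move=> mf _ B mB; rewrite setTI; apply: sub_sigma_algebra; apply: mS.
  by have := mf measurableT B mB; rewrite setTI.
apply: (@lyons_ito_measurable _ _ _ _ _ _ alpha T V Phi K Ps a1 a2 cM PhiP _
  (g_sigma_algebraType S) (brownian_rough_path w0) cov) => [c i|c i j].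
  exact: (mW _ (brownian_level1_measurable a0 a2 w0 c i)).
exact: (mW _ (brownian_level2_measurable a0 a2 w0 c i j)).
Qed.
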